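(* Let $\varepsilon=1/N$, $x=yN$, $n=zN$ and $y=Y^{-}(z)-\beta\varepsilon^{2/3}$. For $p<z<1$ and $\beta=O(1)$, as $N\to\infty$, $$K_n(x)\sim\varepsilon^{1/3}\exp\left[\varepsilon^{-1}\psi_0(z)+\ln\left(\frac{U_0+p}{U_0-q}\right)\beta\varepsilon^{-1/3}\right]\frac12\,\frac{\vartheta^{-1/3}}{\sqrt{zU_0}}\left[\lambda^{+}(\beta,z)\,\mathrm{Ai}\left(\vartheta^{2/3}\beta\right)+\mathrm{i}\,\lambda^{-}(\beta,z)\,\mathrm{Bi}\left(\vartheta^{2/3}\beta\right)\right],$$ where $U_0=U_0(z)$, $\vartheta=\vartheta(z)$ and $$\lambda^{\pm}(\beta,z)=\exp\left\{\frac{2\pi\mathrm{i}\left[Y^{-}(z)-\beta\varepsilon^{2/3}\right]}{\varepsilon}\right\}\pm1.$$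
   Context: Fix real $0<p,q<1$ with $p+q=1$. For integers $n,N\ge 0$ and real $x$, the Krawtchouk polynomial is $$K_n(x)=K_n(x,N,p,q)=\sum_{k=0}^{n}\binom{x}{k}\binom{N-x}{n-k}q^{k}(-p)^{n-k},$$ where $\binom{a}{k}=a(a-1)\cdots(a-k+1)/k!$ for real $a$ and integer $k\geq 0$. For $0<z<1$ put $$U_0(z)=\sqrt{\frac{pq(1-z)}{z}},\qquad Y^{-}(z)=p+(q-p)z-2zU_0(z),$$ $$\psi_0(z)=z\pi\mathrm{i}+(z-1)\ln(U_0)+Y^{-}(z)\ln(U_0-q)+\left[1-Y^{-}(z)\right]\ln(U_0+p),$$ $$\vartheta(z)=\sqrt{\frac{U_0}{z}}\,\frac{1}{(U_0+p)(q-U_0)}.$$ For $p<z<1$ one has $0<U_0<q$, so $\vartheta>0$ and $U_0-q<0$; the logarithms of negative numbers are read as $\ln(U_0-q)=\ln(q-U_0)-\pi\mathrm{i}$ and $\ln\left(\frac{U_0+p}{U_0-q}\right)=\ln\left(\frac{U_0+p}{q-U_0}\right)+\pi\mathrm{i}$. $\mathrm{Ai}$ and $\mathrm{Bi}$ are the Airy functions.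
   Formalization: Since the right side has zeros for bounded β, ''∼'' is read as: the error is o(1) times the factor before the square bracket, uniformly for z=n/N in compact subsets of (p,1) and bounded β, and the ratio tends to 1 wherever the bracket stays bounded away from 0. *)

(* Defs.v *)
From Stdlib Require Import Reals Factorial.
From Coquelicot Require Import Coquelicot.
Open Scope R_scope.

Fixpoint falling (a : R) (k : nat) : R :=
  match k with O => 1 | S j => falling a j * (a - INR j) end.

Fixpoint rising (a : R) (k : nat) : R :=
  match k with O => 1 | S j => rising a j * (a + INR j) end.

Definition binom (a : R) (k : nat) : R := falling a k / INR (fact k).

Definition Krawtchouk (p q : R) (N n : nat) (x : R) : R :=
  sum_f_R0 (fun k => binom x k * binom (INR N - x) (n - k)
                     * q ^ k * (- p) ^ (n - k)) n.

Definition Cexp (w : C) : C := (exp (Re w) * cos (Im w), exp (Re w) * sin (Im w)).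

Definition Gamma (s : R) : R :=
  RInt_gen (fun t => Rpower t (s - 1) * exp (- t))
           (at_right 0) (Rbar_locally p_infty).

(** The Airy functions by their Maclaurin series (Abramowitz-Stegun 10.4.2-10.4.5,
    DLMF 9.4): [airy_f] and [airy_g] are the solutions of w'' = x w with
    (w(0), w'(0)) = (1, 0) and (0, 1), and [airy_c1] = Ai(0),
    [airy_c2] = - Ai'(0). *)
Definition airy_f (x : R) : R :=
  Series (fun k => 3 ^ k * rising (1 / 3) k * x ^ (3 * k) / INR (fact (3 * k))).

Definition airy_g (x : R) : R :=
  Series (fun k => 3 ^ k * rising (2 / 3) k * x ^ (3 * k + 1)
                   / INR (fact (3 * k + 1))).

Definition airy_c1 : R := Rpower 3 (- (2 / 3)) / Gamma (2 / 3).
Definition airy_c2 : R := Rpower 3 (- (1 / 3)) / Gamma (1 / 3).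

Definition Ai (x : R) : R := airy_c1 * airy_f x - airy_c2 * airy_g x.
Definition Bi (x : R) : R := sqrt 3 * (airy_c1 * airy_f x + airy_c2 * airy_g x).

Section Profile.
Variables p q : R.

Definition U0 (z : R) : R := sqrt (p * q * (1 - z) / z).

Definition Yminus (z : R) : R := p + (q - p) * z - 2 * z * U0 z.

(** For p < z < 1 both U0 - q and (U0 + p) / (U0 - q) are negative; the
    branches chosen are ln (U0 - q) = ln (q - U0) - pi i and
    ln ((U0 + p) / (U0 - q)) = ln ((U0 + p) / (q - U0)) + pi i. *)
Definition ln_U0_sub_q (z : R) : C := (ln (q - U0 z) - PI * Ci)%C.

Definition ln_U0_ratio (z : R) : C := (ln ((U0 z + p) / (q - U0 z)) + PI * Ci)%C.

Definition psi0 (z : R) : C :=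
  (z * PI * Ci + (z - 1) * ln (U0 z) + Yminus z * ln_U0_sub_q z
   + (1 - Yminus z) * ln (U0 z + p))%C.

Definition vartheta (z : R) : R :=
  sqrt (U0 z / z) / ((U0 z + p) * (q - U0 z)).

Definition prefactor (eps z beta : R) : C :=
  (Rpower eps (1 / 3)
   * Cexp (/ eps * psi0 z + ln_U0_ratio z * beta * Rpower eps (- (1 / 3)))
   * (1 / 2) * (Rpower (vartheta z) (- (1 / 3)) / sqrt (z * U0 z)))%C.

Definition lambda_phase (eps z beta : R) : C :=
  Cexp (2 * PI * Ci * (Yminus z - beta * Rpower eps (2 / 3)) / eps)%C.

Definition lambda_plus (eps z beta : R) : C := (lambda_phase eps z beta + 1)%C.
Definition lambda_minus (eps z beta : R) : C := (lambda_phase eps z beta - 1)%C.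

Definition airy_bracket (eps z beta : R) : C :=
  (lambda_plus eps z beta * Ai (Rpower (vartheta z) (2 / 3) * beta)
   + Ci * lambda_minus eps z beta * Bi (Rpower (vartheta z) (2 / 3) * beta))%C.

End Profile.

(* Main.v *)
Require Import Defs.
From Stdlib Require Import Reals.
From Coquelicot Require Import Coquelicot.
From Stdlib Require Import Factorial Lra Lia ClassicalEpsilon.
Open Scope R_scope.

(** The polynomial [K_n(x)] is the coefficient of [w^n] in [(1 + q w)^x (1 - p w)^(N - x)]. After
    [w = - 1 / u] and [u = exp zeta], Cauchy's formula for it becomes an integral of
    [(u - q)^x (u + p)^(N - x) u^(n - N)] with respect to [zeta], and as the integrand is real on
    the parts of the real axis where the contour closes, [K_n(x)] is [(-1)^n / pi] times the
    imaginary part of the integral over a path that crosses the strip [0 <= Im zeta <= pi] upwards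
    ([kcoef_path]). This holds for real exponents, so [x] need not be an integer.

    For [x = N Y^-(z)] the two saddle points of the integrand coalesce at [u = U0], on the segment
    [(0, q)] of the positive axis where [(u - q)^x] has argument [pi x]; for [x] at distance
    [beta N^(1/3)] from this value, the logarithmic derivative of the integrand in [zeta] is
    [- (N z (u - U0)^2 - beta N^(1/3) u) / ((q - u) (u + p))] ([dlog_num_C]). The contour is therefore
    moved so that it comes down the real axis to [ln U0], leaves it there at the angle [2 pi / 3],
    and after a short segment goes straight up to the line [Im zeta = pi] ([contour_shift]). On the
    rest of the contour the modulus of the integrand is monotone along each piece, hence
    exponentially small relative to its value at the saddle point ([tail_axis], [tail_vertical],
    [tail_top]). Along the two remaining segments, with directions [d = 1] and [d = omega], a cubic
    expansion of the exponent turns the integral, rescaled by [N^(1/3)] and divided by the modulus at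
    the saddle point, into [int_0^oo exp (- T^3/3 + X d T) dT] up to an error [O(N^(-1/3))], where [X]
    is the argument of the Airy functions in the statement ([ray_estimate]).

    The real axis and the slanted segment carry the common phase [exp (i pi x)], and the imaginary
    part of their difference is [pi (cos (pi x) Ai X - sin (pi x) Bi X)] ([J_airy]); this is, up to
    the sign [(-1)^n], what the phases of the prefactor and of [lambda^+], [lambda^-] combine to
    ([prefactor_eq], [bracket_eq]). To reach the Airy functions as they are defined, by power series
    with coefficients involving Gamma values, the exponential [exp (X d T)] is integrated term by
    term against [exp (- T^3/3)] ([J_lim]); the constants then match because of
    [Gamma (1/3) Gamma (2/3) = 2 pi / sqrt 3], which is [mom_product].

    All estimates are made with constants that depend only on [p], [q], a lower bound [u0] for the
    saddle point, a lower bound [m0] for its distance to [q], and the bound [B] for [beta], which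
    gives the uniformity in [z] and [beta]. The letter [nu] stands for [N^(1/3)]. *)

(** * Curves in the complex plane *)

(* Unification does not recognise [R] as a normed module over itself in these lemmas. *)
Local Notation is_derive_const_R := (@is_derive_const R_AbsRing R_NormedModule).
Local Notation is_derive_plus_R := (@is_derive_plus R_AbsRing R_NormedModule).
Local Notation is_derive_minus_R := (@is_derive_minus R_AbsRing R_NormedModule).
Local Notation derive_cont_R := (@ex_derive_continuous R_AbsRing R_NormedModule).
Local Notation RInt_correct_R := (@RInt_correct R_CompleteNormedModule).
Local Notation is_RInt_unique_R := (@is_RInt_unique R_CompleteNormedModule).
Local Notation is_RInt_plus_R := (@is_RInt_plus R_NormedModule).
Local Notation is_RInt_minus_R := (@is_RInt_minus R_NormedModule).
Local Notation is_RInt_scal_R := (@is_RInt_scal R_NormedModule).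
Local Notation RInt_Chasles_R := (@RInt_Chasles R_CompleteNormedModule).

Lemma C_ext (u v : C) : Re u = Re v -> Im u = Im v -> u = v.
Proof. destruct u, v; simpl; intros; f_equal; assumption. Qed.

Lemma Re_plus (u v : C) : Re (u + v)%C = Re u + Re v. Proof. reflexivity. Qed.
Lemma Im_plus (u v : C) : Im (u + v)%C = Im u + Im v. Proof. reflexivity. Qed.
Lemma Re_minus (u v : C) : Re (u - v)%C = Re u - Re v. Proof. reflexivity. Qed.
Lemma Im_minus (u v : C) : Im (u - v)%C = Im u - Im v. Proof. reflexivity. Qed.
Lemma Re_opp (u : C) : Re (- u)%C = - Re u. Proof. reflexivity. Qed.
Lemma Im_opp (u : C) : Im (- u)%C = - Im u. Proof. reflexivity. Qed.
Lemma Re_mult (u v : C) : Re (u * v)%C = Re u * Re v - Im u * Im v. Proof. reflexivity. Qed.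
Lemma Im_mult (u v : C) : Im (u * v)%C = Re u * Im v + Im u * Re v. Proof. reflexivity. Qed.
Lemma Re_R (x : R) : Re x = x. Proof. reflexivity. Qed.
Lemma Im_R (x : R) : Im x = 0. Proof. reflexivity. Qed.
Lemma Re_pair (x y : R) : Re (x, y) = x. Proof. reflexivity. Qed.
Lemma Im_pair (x y : R) : Im (x, y) = y. Proof. reflexivity. Qed.
Lemma Re_Ci : Re Ci = 0. Proof. reflexivity. Qed.
Lemma Im_Ci : Im Ci = 1. Proof. reflexivity. Qed.
Lemma Re_Cexp (w : C) : Re (Cexp w) = exp (Re w) * cos (Im w). Proof. reflexivity. Qed.
Lemma Im_Cexp (w : C) : Im (Cexp w) = exp (Re w) * sin (Im w). Proof. reflexivity. Qed.

Lemma mvt (f df : R -> R) (a b : R) : a <= b ->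
  (forall s, a <= s <= b -> is_derive f s (df s)) -> exists c, a <= c <= b /\ f b - f a = df c * (b - a).
Proof.
  intros Hab Hd. destruct (MVT_gen f a b df) as [c [Hc E]].
  - intros x Hx. rewrite Rmin_left, Rmax_right in Hx by lra. apply Hd; lra.
  - intros x Hx. rewrite Rmin_left, Rmax_right in Hx by lra.
    apply continuity_pt_filterlim, derive_cont_R. eexists. now apply Hd.
  - rewrite Rmin_left, Rmax_right in Hc by lra. exists c. split; [exact Hc | exact E].
Qed.

Lemma mvt_le (f df : R -> R) (a b : R) : a <= b ->
  (forall s, a <= s <= b -> is_derive f s (df s)) -> (forall s, a <= s <= b -> 0 <= df s) -> f a <= f b.
Proof.
  intros Hab Hd Hp. destruct (mvt f df a b Hab Hd) as [c [Hc E]]. specialize (Hp c Hc). nra.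
Qed.

Lemma mvt_abs (f df : R -> R) (T K : R) : 0 <= T ->
  (forall s, 0 <= s <= T -> is_derive f s (df s)) -> (forall s, 0 <= s <= T -> Rabs (df s) <= K) ->
  Rabs (f T - f 0) <= K * T.
Proof.
  intros HT Hd HK. destruct (mvt f df 0 T HT Hd) as [c [Hc E]].
  rewrite E, Rminus_0_r, Rabs_mult, (Rabs_pos_eq T) by lra.
  apply Rmult_le_compat_r; [exact HT | now apply HK].
Qed.

(* [auto_derive] leaves derivatives of abstract functions behind; they are replaced by the known values. *)
Ltac dsub H := match type of H with is_derive ?f ?t ?l =>
  replace (Derive (fun x : R => f x) t) with l by (symmetry; exact (is_derive_unique _ _ _ H)) end.

(* Equations that come from normed modules are restated in [R], where [ring] and [field] apply. *)
Ltac req := match goal with |- @eq _ ?x ?y => change (@eq R x y) end.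

Ltac reim := repeat progress rewrite ?Re_plus, ?Im_plus, ?Re_minus, ?Im_minus, ?Re_opp, ?Im_opp,
  ?Re_mult, ?Im_mult, ?Re_R, ?Im_R, ?Re_pair, ?Im_pair, ?Re_Ci, ?Im_Ci.

Lemma Cexp_plus (u v : C) : Cexp (u + v) = (Cexp u * Cexp v)%C.
Proof.
  apply C_ext; rewrite ?Re_mult, ?Im_mult, ?Re_Cexp, ?Im_Cexp, Re_plus, Im_plus, exp_plus,
    ?cos_plus, ?sin_plus; ring.
Qed.

Lemma Cexp_0 : Cexp 0 = 1.
Proof. apply C_ext; rewrite ?Re_Cexp, ?Im_Cexp; reim; rewrite exp_0, ?cos_0, ?sin_0; ring. Qed.

Lemma Cexp_real (x : R) : Cexp x = exp x.
Proof. apply C_ext; rewrite ?Re_Cexp, ?Im_Cexp; reim; rewrite ?cos_0, ?sin_0; ring. Qed.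

Lemma Cmod_Cexp (w : C) : Cmod (Cexp w) = exp (Re w).
Proof.
  unfold Cmod, Cexp; simpl fst; simpl snd.
  replace (_ + _) with ((exp (Re w)) ^ 2 * (Rsqr (sin (Im w)) + Rsqr (cos (Im w))))
    by (unfold Rsqr; ring).
  rewrite sin2_cos2, Rmult_1_r, sqrt_pow2; [reflexivity | left; apply exp_pos].
Qed.

Lemma is_derive_mult_R (f g : R -> R) (t l m : R) :
  is_derive f t l -> is_derive g t m -> is_derive (fun s => f s * g s) t (l * g t + f t * m).
Proof. intros H1 H2. apply (is_derive_mult f g t l m H1 H2). intros; apply Rmult_comm. Qed.

(** Only derivatives along real curves are used: holomorphy enters through the chain rule, which
    for [Cexp], [ulog] and [upow] is proved in this form. *)
Definition cder (g : R -> C) (t : R) (l : C) : Prop :=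
  is_derive (fun s => Re (g s)) t (Re l) /\ is_derive (fun s => Im (g s)) t (Im l).

Definition ccont {T : UniformSpace} (g : T -> C) (x : T) : Prop :=
  continuous (fun s => Re (g s)) x /\ continuous (fun s => Im (g s)) x.

Lemma cder_ext (f g : R -> C) (t : R) (l m : C) :
  (forall s, f s = g s) -> l = m -> cder f t l -> cder g t m.
Proof.
  intros E <- [H1 H2]; split.
  - apply (is_derive_ext (fun s => Re (f s))); [intro s; now rewrite E | exact H1].
  - apply (is_derive_ext (fun s => Im (f s))); [intro s; now rewrite E | exact H2].
Qed.

Lemma cder_const (a : C) (t : R) : cder (fun _ => a) t 0.
Proof. split; exact (is_derive_const_R _ t). Qed.

Lemma cder_line (a d : C) (t : R) : cder (fun s => a + s * d)%C t d.
Proof.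
  split.
  - apply (is_derive_ext (fun s => Re a + s * Re d)); [intro s; req; reim; ring |].
    auto_derive; [exact I | req; ring].
  - apply (is_derive_ext (fun s => Im a + s * Im d)); [intro s; req; reim; ring |].
    auto_derive; [exact I | req; ring].
Qed.

Lemma cder_plus (f g : R -> C) (t : R) (l m : C) :
  cder f t l -> cder g t m -> cder (fun s => f s + g s)%C t (l + m)%C.
Proof. intros [H1 H2] [H3 H4]; split; apply is_derive_plus_R; assumption. Qed.

Lemma cder_minus (f g : R -> C) (t : R) (l m : C) :
  cder f t l -> cder g t m -> cder (fun s => f s - g s)%C t (l - m)%C.
Proof. intros [H1 H2] [H3 H4]; split; apply is_derive_minus_R; assumption. Qed.

Lemma cder_mult (f g : R -> C) (t : R) (l m : C) :
  cder f t l -> cder g t m -> cder (fun s => f s * g s)%C t (l * g t + f t * m)%C.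
Proof.
  intros [H1 H2] [H3 H4]; split.
  - apply (is_derive_ext (fun s => Re (f s) * Re (g s) - Im (f s) * Im (g s)));
      [intro s; reflexivity |].
    replace (Re _) with ((Re l * Re (g t) + Re (f t) * Re m) -
      (Im l * Im (g t) + Im (f t) * Im m)) by (reim; ring).
    apply is_derive_minus_R; apply is_derive_mult_R; assumption.
  - apply (is_derive_ext (fun s => Re (f s) * Im (g s) + Im (f s) * Re (g s)));
      [intro s; reflexivity |].
    replace (Im _) with ((Re l * Im (g t) + Re (f t) * Im m) +
      (Im l * Re (g t) + Im (f t) * Re m)) by (reim; ring).
    apply is_derive_plus_R; apply is_derive_mult_R; assumption.
Qed.

Lemma cder_scal (a : C) (f : R -> C) (t : R) (l : C) :
  cder f t l -> cder (fun s => a * f s)%C t (a * l)%C.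
Proof.
  intro H. eapply cder_ext; [ | | apply (cder_mult _ _ t 0 l (cder_const a t) H)].
  - intro s; reflexivity.
  - simpl; ring.
Qed.

Lemma cder_Cexp (f : R -> C) (t : R) (l : C) :
  cder f t l -> cder (fun s => Cexp (f s)) t (l * Cexp (f t))%C.
Proof.
  assert (K : forall (X Y : R -> R) dX dY, is_derive X t dX -> is_derive Y t dY ->
    is_derive (fun s => exp (X s) * cos (Y s)) t
      (dX * (exp (X t) * cos (Y t)) - dY * (exp (X t) * sin (Y t))) /\
    is_derive (fun s => exp (X s) * sin (Y s)) t
      (dX * (exp (X t) * sin (Y t)) + dY * (exp (X t) * cos (Y t)))).
  { intros X Y dX dY H1 H2.
    split; (auto_derive; [repeat split; eexists; eassumption |]);
      dsub H1; dsub H2; req; ring. }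
  intros [H1 H2]. exact (K _ _ _ _ H1 H2).
Qed.

Lemma cder_ccont (f : R -> C) (t : R) (l : C) : cder f t l -> ccont f t.
Proof. intros [H1 H2]; split; apply derive_cont_R; eexists; eassumption. Qed.

Section Continuity.
Context {T : UniformSpace}.
Implicit Types f g : T -> C.

Lemma ccont_const (a : C) (x : T) : ccont (fun _ => a) x.
Proof. split; apply continuous_const. Qed.

Lemma ccont_real (f : T -> R) x : continuous f x -> ccont (fun s => RtoC (f s)) x.
Proof. intro H; split; [exact H | apply continuous_const]. Qed.

Lemma ccont_plus f g x : ccont f x -> ccont g x -> ccont (fun s => f s + g s)%C x.
Proof. intros [H1 H2] [H3 H4]; split; apply (@continuous_plus T R_AbsRing R_NormedModule); assumption. Qed.

Lemma ccont_minus f g x : ccont f x -> ccont g x -> ccont (fun s => f s - g s)%C x.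
Proof. intros [H1 H2] [H3 H4]; split; apply (@continuous_minus T R_AbsRing R_NormedModule); assumption. Qed.

Lemma ccont_mult f g x : ccont f x -> ccont g x -> ccont (fun s => f s * g s)%C x.
Proof.
  intros [H1 H2] [H3 H4]; split.
  - apply (@continuous_minus T R_AbsRing R_NormedModule); apply (@continuous_mult T R_AbsRing); assumption.
  - apply (@continuous_plus T R_AbsRing R_NormedModule); apply (@continuous_mult T R_AbsRing); assumption.
Qed.

Lemma ccont_Cexp f x : ccont f x -> ccont (fun s => Cexp (f s)) x.
Proof.
  intros [H1 H2]; split; apply (@continuous_mult T R_AbsRing);
    auto using continuous_exp_comp, continuous_cos_comp, continuous_sin_comp.
  - apply (continuous_comp (fun s => Re (f s)) exp); [exact H1 |].
    apply derive_cont_R; auto_derive; exact I.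
  - apply (continuous_comp (fun s => Im (f s)) cos); [exact H2 |].
    apply derive_cont_R; auto_derive; exact I.
  - apply (continuous_comp (fun s => Re (f s)) exp); [exact H1 |].
    apply derive_cont_R; auto_derive; exact I.
  - apply (continuous_comp (fun s => Im (f s)) sin); [exact H2 |].
    apply derive_cont_R; auto_derive; exact I.
Qed.

End Continuity.

(** * Logarithm and real powers on the closed upper half plane *)

(** The logarithm with argument in [(- pi / 2, 3 pi / 2)], cut along the negative imaginary axis. It is
    smooth on the closed upper half plane without [0], with argument [0] on the positive axis and [pi]
    on the negative one, so that the real axis is not a boundary. *)
Definition ulog (v : C) : C :=
  (ln (Cmod v), PI / 2 - 2 * atan (Re v / (Cmod v + Im v))).

(** The complement of the cut. *)
Definition offslit (v : C) : Prop := 0 < Cmod v + Im v.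

Lemma Cmod_sqr (v : C) : Cmod v ^ 2 = Re v ^ 2 + Im v ^ 2.
Proof. unfold Cmod. rewrite pow2_sqrt; [reflexivity |]. generalize (pow2_ge_0 (fst v)), (pow2_ge_0 (snd v)); lra. Qed.

Lemma Im_le_Cmod (v : C) : Rabs (Im v) <= Cmod v.
Proof. eapply Rle_trans; [apply Rmax_r | apply Rmax_Cmod]. Qed.

Lemma Re_le_Cmod (v : C) : Rabs (Re v) <= Cmod v.
Proof. eapply Rle_trans; [apply Rmax_l | apply Rmax_Cmod]. Qed.

Lemma offslit_pos (v : C) : offslit v -> 0 < Cmod v.
Proof.
  unfold offslit; intro H. generalize (Im_le_Cmod v). 
  unfold Rabs; destruct (Rcase_abs (Im v)); lra.
Qed.

Lemma offslit_upper (v : C) : 0 <= Im v -> v <> 0 -> offslit v.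
Proof. intros H1 H2. apply Cmod_gt_0 in H2. unfold offslit; lra. Qed.

(** With [tan m = x / (r + y)], the argument in [ulog] is [pi / 2 - 2 m]. *)
Lemma half_angle (r x y : R) : r ^ 2 = x ^ 2 + y ^ 2 -> 0 < r + y ->
  1 + (x / (r + y)) ^ 2 = 2 * r / (r + y).
Proof.
  intros E H.
  replace ((x / (r + y)) ^ 2) with (x ^ 2 / (r + y) ^ 2) by (field; lra).
  replace (x ^ 2) with ((r - y) * (r + y)) by lra. field. lra.
Qed.

Lemma Cexp_ulog (v : C) : offslit v -> Cexp (ulog v) = v.
Proof.
  intro H. assert (Hp := offslit_pos v H). unfold offslit in H.
  assert (E := Cmod_sqr v).
  set (rho := Cmod v) in *. set (X := Re v) in *. set (Y := Im v) in *.
  assert (Em := half_angle rho X Y E H). rewrite <- Rsqr_pow2 in Em.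
  assert (Hq : 0 < 2 * rho / (rho + Y)) by (apply Rdiv_lt_0_compat; lra).
  assert (Hs : sqrt (2 * rho / (rho + Y)) * sqrt (2 * rho / (rho + Y)) = 2 * rho / (rho + Y))
    by (apply sqrt_sqrt; lra).
  assert (Hs0 := sqrt_lt_R0 _ Hq).
  apply C_ext; rewrite ?Re_Cexp, ?Im_Cexp; unfold ulog; reim; fold rho X Y;
    rewrite exp_ln by assumption.
  - rewrite cos_minus, cos_PI2, sin_PI2, sin_2a, cos_atan, sin_atan, Em.
    set (s := sqrt _) in *.
    replace (rho * _) with (rho * (2 * (X / (rho + Y)) / (s * s))) by (field; lra).
    rewrite Hs. fold X. field. lra.
  - rewrite sin_minus, cos_PI2, sin_PI2, cos_2a, cos_atan, sin_atan, Em.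
    set (s := sqrt _) in *.
    replace (rho * _) with (rho * ((1 - (X / (rho + Y)) ^ 2) / (s * s))) by (field; lra).
    rewrite Hs. fold Y. rewrite Rsqr_pow2 in Em.
    replace (1 - (X / (rho + Y)) ^ 2) with (2 - 2 * rho / (rho + Y)) by lra. field. lra.
Qed.

Lemma cder_ulog (f : R -> C) (t : R) (l : C) :
  offslit (f t) -> cder f t l -> cder (fun s => ulog (f s)) t (l / f t)%C.
Proof.
  intros H [H1 H2]. assert (Hp := offslit_pos _ H). unfold offslit in H.
  assert (E := Cmod_sqr (f t)).
  assert (Ediv : (l / f t)%C = ((Re l * Re (f t) + Im l * Im (f t)) / Cmod (f t) ^ 2,
                     (Im l * Re (f t) - Re l * Im (f t)) / Cmod (f t) ^ 2)).
  { unfold Cdiv, Cinv. change (fst (f t)) with (Re (f t)); change (snd (f t)) with (Im (f t)).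
    rewrite <- E. apply C_ext; reim; field; lra. }
  rewrite Ediv. clear Ediv.
  assert (K : forall (X Y rho : R -> R) dX dY, is_derive X t dX -> is_derive Y t dY ->
    (forall s, rho s = sqrt (X s ^ 2 + Y s ^ 2)) -> rho t ^ 2 = X t ^ 2 + Y t ^ 2 ->
    0 < rho t -> 0 < rho t + Y t ->
    is_derive (fun s => ln (rho s)) t ((dX * X t + dY * Y t) / rho t ^ 2) /\
    is_derive (fun s => PI / 2 - 2 * atan (X s / (rho s + Y s))) t
      ((dY * X t - dX * Y t) / rho t ^ 2)).
  { clear. intros X Y rho dX dY H1 H2 Er E Hp H.
    assert (Hd : is_derive rho t ((X t * dX + Y t * dY) / rho t)).
    { apply (is_derive_ext (fun s => sqrt (X s ^ 2 + Y s ^ 2))); [intro; now rewrite Er |].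
      rewrite Er in *. auto_derive.
      - repeat split; try (eexists; eassumption). 
        destruct (Rle_lt_dec (X t * (X t * 1) + Y t * (Y t * 1)) 0) as [L|L]; [| exact L].
        replace (X t ^ 2 + Y t ^ 2) with (X t * (X t * 1) + Y t * (Y t * 1)) in Hp by ring.
        rewrite sqrt_neg_0 in Hp by exact L. lra.
      - dsub H1; dsub H2.
        replace (X t * (X t * 1) + Y t * (Y t * 1)) with (X t ^ 2 + Y t ^ 2) by ring.
        field. lra. }
    split.
    - auto_derive.
      + split; [eexists; exact Hd | split; [exact Hp | exact I]].
      + dsub Hd. field. lra.
    - auto_derive.
      + repeat split; try (eexists; eassumption). lra.
      + dsub H1; dsub H2; dsub Hd.
        set (r := rho t) in *. set (x := X t) in *. set (y := Y t) in *.
        assert (Em := half_angle r x y E H).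
        simpl pow in Em. unfold Rdiv in Em at 1 2. rewrite Em. req.
        apply (Rmult_eq_reg_r (r ^ 2 * (r + y))); [| apply Rmult_integral_contrapositive; split; [apply pow_nonzero; lra | lra]].
        field_simplify; [| lra | lra].
        replace (x ^ 2) with (r ^ 2 - y ^ 2) by lra. ring. }
  exact (K _ _ (fun s => Cmod (f s)) _ _ H1 H2 (fun _ => eq_refl) E Hp H).
Qed.

Lemma continuous_Cmod {T : UniformSpace} (f : T -> C) x :
  ccont f x -> continuous (fun s => Cmod (f s)) x.
Proof.
  intros [H1 H2].
  apply (continuous_comp (fun s => Re (f s) ^ 2 + Im (f s) ^ 2) sqrt).
  - apply (@continuous_plus T R_AbsRing R_NormedModule);
      apply (@continuous_mult T R_AbsRing); try assumption;
      apply (@continuous_mult T R_AbsRing); try assumption; apply continuous_const.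
  - apply continuous_sqrt.
Qed.

Lemma continuous_Rcomp {T : UniformSpace} (h : R -> R) (f : T -> R) x :
  continuous f x -> ex_derive h (f x) -> continuous (fun s => h (f s)) x.
Proof.
  intros H D. apply (continuous_comp f h); [exact H |].
  now apply derive_cont_R.
Qed.

Lemma ccont_ulog {T : UniformSpace} (f : T -> C) x :
  ccont f x -> offslit (f x) -> ccont (fun s => ulog (f s)) x.
Proof.
  intros Hf H. assert (Hp := offslit_pos _ H). assert (Hc := continuous_Cmod f x Hf).
  destruct Hf as [H1 H2]. split.
  - apply (continuous_Rcomp ln (fun s => Cmod (f s))); [exact Hc |].
    auto_derive; exact Hp.
  - apply (@continuous_minus T R_AbsRing R_NormedModule); [apply continuous_const |].
    apply (@continuous_mult T R_AbsRing); [apply continuous_const |].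
    apply (continuous_Rcomp atan (fun s => Re (f s) / (Cmod (f s) + Im (f s))));
      [| auto_derive; exact I].
    apply (@continuous_mult T R_AbsRing); [exact H1 |].
    apply (continuous_Rcomp Rinv (fun s => Cmod (f s) + Im (f s))).
    + apply (@continuous_plus T R_AbsRing R_NormedModule); assumption.
    + auto_derive. unfold offslit in H. lra.
Qed.

Definition upow (a : R) (v : C) : C :=
  if Req_EM_T (Cmod v) 0 then 0 else Cexp (a * ulog v).

Lemma upow_0 (a : R) : upow a 0 = 0.
Proof. unfold upow. destruct (Req_EM_T (Cmod 0) 0) as [_|n]; [reflexivity |]. now destruct n; apply Cmod_0. Qed.

Lemma upow_pos (a : R) (v : C) : 0 < Cmod v -> upow a v = Cexp (a * ulog v).
Proof. intro H. unfold upow. destruct (Req_EM_T (Cmod v) 0) as [e|_]; [lra | reflexivity]. Qed.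

Lemma Cmod_upow (a : R) (v : C) : 0 < Cmod v -> Cmod (upow a v) = Rpower (Cmod v) a.
Proof.
  intro H. rewrite upow_pos by exact H. rewrite Cmod_Cexp. unfold Rpower, ulog. f_equal.
  reim; ring.
Qed.

Lemma Cmod_upow_lt (a e : R) (v : C) : 0 < a -> 0 < e -> Cmod v < Rpower e (/ a) -> Cmod (upow a v) < e.
Proof.
  intros Ha He Hv. destruct (Req_EM_T (Cmod v) 0) as [E|E].
  - apply Cmod_eq_0 in E. subst v. rewrite upow_0, Cmod_0. exact He.
  - assert (0 < Cmod v) by (generalize (Cmod_ge_0 v); lra).
    rewrite Cmod_upow by assumption.
    replace e with (Rpower (Rpower e (/ a)) a) at 1.
    + unfold Rpower at 1 2. apply exp_increasing, Rmult_lt_compat_l; [exact Ha |]. now apply ln_increasing.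
    + rewrite Rpower_mult, Rinv_l, Rpower_1 by lra. reflexivity.
Qed.

Lemma upow_pred (a : R) (v : C) : offslit v -> upow a v = (v * upow (a - 1) v)%C.
Proof.
  intro H. assert (Hp := offslit_pos v H). rewrite !upow_pos by exact Hp.
  rewrite <- (Cexp_ulog v H) at 2. rewrite <- Cexp_plus. f_equal. rewrite RtoC_minus. ring.
Qed.

(** Points at which the power [upow a] is continuous, resp. differentiable: at the branch
    point the modulus [Cmod v ^ a] beats the jump of the argument. *)
Definition pow_cont (a : R) (v : C) : Prop := offslit v \/ (v = 0 /\ 0 < a).
Definition pow_diff (a : R) (v : C) : Prop := offslit v \/ (v = 0 /\ 1 < a).

Lemma pow_diff_cont (a : R) (v : C) : pow_diff a v -> pow_cont a v.
Proof. intros [H|[H1 H2]]; [now left | right; split; [exact H1 | lra]]. Qed.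

Lemma pow_diff_pred (a : R) (v : C) : pow_diff a v -> pow_cont (a - 1) v.
Proof. intros [H|[H1 H2]]; [now left | right; split; [exact H1 | lra]]. Qed.

Lemma locally_pos {T : UniformSpace} (h : T -> R) x : continuous h x -> 0 < h x -> locally x (fun s => 0 < h s).
Proof.
  intros H Hp. apply (H (fun y => 0 < y)). exists (mkposreal _ Hp). intros y Hy.
  change (Rabs (y - h x) < h x) in Hy. apply Rabs_def2 in Hy. lra.
Qed.

Lemma ccont_upow {T : UniformSpace} (a : R) (f : T -> C) x :
  ccont f x -> pow_cont a (f x) -> ccont (fun s => upow a (f s)) x.
Proof.
  intros Hf [H|[H Ha]].
  - assert (Hp := offslit_pos _ H).
    assert (L : ccont (fun s => Cexp (a * ulog (f s))) x).
    { apply ccont_Cexp, ccont_mult; [apply ccont_const | now apply ccont_ulog]. }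
    assert (N := locally_pos _ x (continuous_Cmod f x Hf) Hp).
    destruct L as [L1 L2]. split.
    + apply (continuous_ext_loc _ (fun s => Re (Cexp (a * ulog (f s))))); [| exact L1].
      apply (filter_imp (fun s => 0 < Cmod (f s))); [| exact N].
      intros s Hs. now rewrite upow_pos.
    + apply (continuous_ext_loc _ (fun s => Im (Cexp (a * ulog (f s))))); [| exact L2].
      apply (filter_imp (fun s => 0 < Cmod (f s))); [| exact N].
      intros s Hs. now rewrite upow_pos.
  - assert (K : forall e : posreal, locally x (fun s => Cmod (upow a (f s)) < e)).
    { intro e. assert (Hc := continuous_Cmod f x Hf).
      assert (Hr : 0 < Rpower e (/ a)) by apply exp_pos.
      apply (filter_imp (fun s => Cmod (f s) < Rpower e (/ a))).
      - intros s Hs. apply Cmod_upow_lt; [exact Ha | apply cond_pos | exact Hs].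
      - apply (Hc (fun y => y < Rpower e (/ a))). rewrite H, Cmod_0.
        exists (mkposreal _ Hr). intros y Hy. change (Rabs (y - 0) < Rpower e (/ a)) in Hy.
        apply Rabs_def2 in Hy. lra. }
    split; unfold continuous; rewrite H, upow_0; apply filterlim_locally; intro e;
      apply (filter_imp (fun s => Cmod (upow a (f s)) < e)); try apply K; intros s Hs.
    + change (Rabs (Re (upow a (f s)) - 0) < e). rewrite Rminus_0_r.
      eapply Rle_lt_trans; [apply Re_le_Cmod | exact Hs].
    + change (Rabs (Im (upow a (f s)) - 0) < e). rewrite Rminus_0_r.
      eapply Rle_lt_trans; [apply Im_le_Cmod | exact Hs].
Qed.

Lemma Cmod_le_abs (v : C) : Cmod v <= Rabs (Re v) + Rabs (Im v).
Proof.
  apply Rsqr_incr_0_var; [| generalize (Rabs_pos (Re v)), (Rabs_pos (Im v)); lra].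
  rewrite !Rsqr_pow2, Cmod_sqr, <- (pow2_abs (Re v)), <- (pow2_abs (Im v)).
  generalize (Rabs_pos (Re v)), (Rabs_pos (Im v)); nra.
Qed.

(** A function with [|g(s)| < e] as soon as [M |s - t| < e^(1/a)], that is, [g = O(|s - t|^a)] with
    [a > 1], has derivative [0] at [t]; this is how the branch point is crossed. *)
Lemma is_derive_small_at_0 (g : R -> R) (t a M d : R) :
  1 < a -> 0 < M -> 0 < d -> g t = 0 ->
  (forall s e, Rabs (s - t) < d -> 0 < e -> M * Rabs (s - t) < Rpower e (/ a) -> Rabs (g s) < e) ->
  is_derive g t 0.
Proof.
  intros Ha HM Hd H0 H. apply is_derive_Reals. intros e He.
  set (k := Rpower (e / M) (/ (a - 1))).
  assert (Hk : 0 < k) by apply exp_pos.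
  assert (Hm : 0 < Rmin d (k / M / 2)) by (apply Rmin_pos; [exact Hd | apply Rdiv_lt_0_compat; [apply Rdiv_lt_0_compat; assumption | lra]]).
  exists (mkposreal _ Hm). simpl. intros y Hy0 Hy.
  assert (Hyd : Rabs y < d) by (eapply Rlt_le_trans; [exact Hy | apply Rmin_l]).
  assert (Hyk : M * Rabs y < k).
  { apply Rlt_le_trans with (M * (k / M / 2 * 2)); [| right; field; lra].
    apply Rmult_lt_compat_l; [exact HM |].
    assert (Rabs y < k / M / 2) by (eapply Rlt_le_trans; [exact Hy | apply Rmin_r]). 
    generalize (Rabs_pos y); lra. }
  assert (Hyp : 0 < Rabs y) by now apply Rabs_pos_lt.
  rewrite H0, !Rminus_0_r. unfold Rdiv. rewrite Rabs_mult, Rabs_inv.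
  apply (Rmult_lt_reg_r (Rabs y)); [exact Hyp |]. rewrite Rmult_assoc, Rinv_l, Rmult_1_r by lra.
  apply H; [replace (t + y - t) with y by ring; exact Hyd | now apply Rmult_lt_0_compat |].
  replace (t + y - t) with y by ring.
  (* with X = M|y|, the claim is X^a < (e/M) X, that is X^(a-1) < e/M *)
  set (X := M * Rabs y) in *. assert (HX : 0 < X) by now apply Rmult_lt_0_compat.
  replace (e * Rabs y) with (e / M * X) by (unfold X; field; lra).
  assert (HeM : 0 < e / M) by now apply Rdiv_lt_0_compat.
  rewrite <- (Rpower_1 X) at 1 by exact HX.
  unfold Rpower. apply exp_increasing. rewrite ln_mult by assumption.
  assert (Hl : ln X < / (a - 1) * ln (e / M)).
  { rewrite <- (ln_exp (/ (a - 1) * ln (e / M))). now apply ln_increasing. }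
  rewrite Rmult_1_l. apply (Rmult_lt_reg_l a); [lra |].
  rewrite <- (Rmult_assoc a (/ a)), Rinv_r, Rmult_1_l by lra.
  apply (Rmult_lt_compat_l (a - 1)) in Hl; [| lra].
  rewrite <- Rmult_assoc, Rinv_r, Rmult_1_l in Hl by lra. lra.
Qed.

Lemma is_derive_lip (f : R -> R) (t l : R) : is_derive f t l ->
  exists d, 0 < d /\ forall s, Rabs (s - t) < d -> Rabs (f s - f t) <= (Rabs l + 1) * Rabs (s - t).
Proof.
  intro H. apply is_derive_Reals in H. destruct (H 1 Rlt_0_1) as [d Hd].
  exists d. split; [apply cond_pos |]. intros s Hs.
  destruct (Req_dec (s - t) 0) as [E|E].
  - replace s with t by lra. rewrite !Rminus_diag, Rabs_R0. lra.
  - specialize (Hd (s - t) E Hs). replace (t + (s - t)) with s in Hd by ring.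
    replace (f s - f t) with ((((f s - f t) / (s - t)) - l + l) * (s - t)) by (field; exact E).
    rewrite Rabs_mult. apply Rmult_le_compat_r; [apply Rabs_pos |].
    eapply Rle_trans; [apply Rabs_triang |]. lra.
Qed.

(** The rule holds at the branch point as well when [1 < a], whatever the direction in which the
    curve passes through it. *)
Lemma cder_upow (a : R) (f : R -> C) (t : R) (l : C) :
  pow_diff a (f t) -> cder f t l ->
  cder (fun s => upow a (f s)) t (a * upow (a - 1) (f t) * l)%C.
Proof.
  intros [H|[H Ha]] Hf.
  - assert (Hp := offslit_pos _ H).
    assert (L : cder (fun s => Cexp (a * ulog (f s))) t (a * upow (a - 1) (f t) * l)%C).
    { eapply cder_ext; [intro; reflexivity | | apply cder_Cexp, cder_scal, cder_ulog; eassumption].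
      rewrite upow_pos by exact Hp.
      replace (a * ulog (f t))%C with ((a - 1)%R * ulog (f t) + ulog (f t))%C by (rewrite RtoC_minus; ring).
      rewrite Cexp_plus, Cexp_ulog by exact H. field.
      intro E. rewrite E, Cmod_0 in Hp. lra. }
    assert (N := locally_pos _ t (continuous_Cmod f t (cder_ccont _ _ _ Hf)) Hp).
    destruct L as [L1 L2]. split.
    + apply (is_derive_ext_loc (fun s => Re (Cexp (a * ulog (f s))))); [| exact L1].
      apply (filter_imp (fun s => 0 < Cmod (f s))); [| exact N].
      intros s Hs. now rewrite upow_pos.
    + apply (is_derive_ext_loc (fun s => Im (Cexp (a * ulog (f s))))); [| exact L2].
      apply (filter_imp (fun s => 0 < Cmod (f s))); [| exact N].
      intros s Hs. now rewrite upow_pos.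
  - rewrite H, upow_0. replace (a * 0 * l)%C with (RtoC 0) by ring.
    destruct Hf as [H1 H2].
    destruct (is_derive_lip _ _ _ H1) as [d1 [Hd1 L1]].
    destruct (is_derive_lip _ _ _ H2) as [d2 [Hd2 L2]].
    set (M := Rabs (Re l) + 1 + (Rabs (Im l) + 1)).
    assert (HM : 0 < M) by (unfold M; generalize (Rabs_pos (Re l)), (Rabs_pos (Im l)); lra).
    assert (Hd : 0 < Rmin d1 d2) by now apply Rmin_pos.
    assert (K : forall s e, Rabs (s - t) < Rmin d1 d2 -> 0 < e -> M * Rabs (s - t) < Rpower e (/ a) ->
      Cmod (upow a (f s)) < e).
    { intros s e Hs He Hb. apply Cmod_upow_lt; [lra | exact He |].
      eapply Rle_lt_trans; [| exact Hb]. eapply Rle_trans; [apply Cmod_le_abs |].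
      unfold M. rewrite Rmult_plus_distr_r. apply Rplus_le_compat.
      - replace (Re (f s)) with (Re (f s) - Re (f t)) by (rewrite H; reim; ring).
        apply L1. eapply Rlt_le_trans; [exact Hs | apply Rmin_l].
      - replace (Im (f s)) with (Im (f s) - Im (f t)) by (rewrite H; reim; ring).
        apply L2. eapply Rlt_le_trans; [exact Hs | apply Rmin_r]. }
    split.
    + apply (is_derive_small_at_0 _ t a M (Rmin d1 d2)); try assumption.
      * rewrite H, upow_0; reflexivity.
      * intros s e ? ? ?. eapply Rle_lt_trans; [apply Re_le_Cmod | now apply K].
    + apply (is_derive_small_at_0 _ t a M (Rmin d1 d2)); try assumption.
      * rewrite H, upow_0; reflexivity.
      * intros s e ? ? ?. eapply Rle_lt_trans; [apply Im_le_Cmod | now apply K].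
Qed.

(** * Integrals along segments *)

Lemma continuous_clamp (t : R) : continuous (fun s => Rmax 0 (Rmin s 1)) t.
Proof.
  apply (continuous_ext (fun s => (1 + Rabs s - Rabs (s - 1)) / 2)).
  - intro s. unfold Rmax, Rmin, Rabs.
    destruct (Rle_dec s 1), (Rcase_abs s), (Rcase_abs (s - 1));
      match goal with |- context [Rle_dec 0 ?u] => destruct (Rle_dec 0 u) end; lra.
  - apply (@continuous_mult R_UniformSpace R_AbsRing); [| apply continuous_const].
    apply (@continuous_minus R_UniformSpace R_AbsRing R_NormedModule).
    + apply (@continuous_plus R_UniformSpace R_AbsRing R_NormedModule); [apply continuous_const |].
      apply continuous_Rabs.
    + apply continuous_Rabs_comp.
      apply (@continuous_minus R_UniformSpace R_AbsRing R_NormedModule);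
        [apply continuous_id | apply continuous_const].
Qed.

(** Differentiation under the integral sign with an integrand that is only controlled for
    [0 <= t <= 1]: the parameter [t] is clamped to that interval. *)
Lemma is_derive_RInt_01 (f fs : R -> R -> R) (s0 d : R) :
  0 < d ->
  (forall s t, Rabs (s - s0) < d -> 0 <= t <= 1 -> is_derive (fun u => f u t) s (fs s t)) ->
  (forall t, 0 <= t <= 1 -> continuous (fun v : R * R => fs (fst v) (snd v)) (s0, t)) ->
  (forall s, Rabs (s - s0) < d -> ex_RInt (f s) 0 1) ->
  is_derive (fun s => RInt (f s) 0 1) s0 (RInt (fs s0) 0 1).
Proof.
  intros Hd H1 H2 H3.
  assert (Near : locally s0 (fun s => Rabs (s - s0) < d)).
  { exists (mkposreal d Hd). intros y Hy. exact Hy. }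
  set (cl := fun t => Rmax 0 (Rmin t 1)).
  assert (Cl : forall t, 0 <= cl t <= 1).
  { intro t. unfold cl. split; [apply Rmax_l | apply Rmax_lub; [lra | apply Rmin_r]]. }
  assert (Cid : forall t, 0 <= t <= 1 -> cl t = t).
  { intros t Ht. unfold cl. rewrite Rmin_left, Rmax_right; lra. }
  assert (D : forall s t, Rabs (s - s0) < d -> Derive (fun z => f z (cl t)) s = fs s (cl t)).
  { intros s t Hs. apply is_derive_unique, H1; [exact Hs | apply Cl]. }
  apply (is_derive_ext_loc (fun s => RInt (fun t => f s (cl t)) 0 1)).
  - apply (filter_imp (fun s => Rabs (s - s0) < d)); [| exact Near].
    intros s Hs. apply RInt_ext. intros t Ht. rewrite Rmin_left, Rmax_right in Ht by lra.
    rewrite Cid by lra. reflexivity.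
  - replace (RInt (fs s0) 0 1) with (RInt (fun t => Derive (fun u => f u (cl t)) s0) 0 1).
    + apply is_derive_RInt_param.
      * apply (filter_imp (fun s => Rabs (s - s0) < d)); [| exact Near].
        intros s Hs t _. exists (fs s (cl t)). apply H1; [exact Hs | apply Cl].
      * intros t Ht. rewrite Rmin_left, Rmax_right in Ht by lra.
        apply continuity_2d_pt_ext_loc with (f := fun u v => fs u (cl v)).
        -- exists (mkposreal d Hd). intros u v Hu Hv. now rewrite D.
        -- apply continuity_2d_pt_filterlim.
           apply (continuous_comp_2 (fun z : R * R => fst z) (fun z : R * R => cl (snd z)) fs).
           ++ apply continuous_fst.
           ++ apply (continuous_comp (fun z : R * R => snd z) cl);
                [apply continuous_snd | apply continuous_clamp].
           ++ simpl. rewrite Cid by lra. apply H2. lra.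
      * apply (filter_imp (fun s => Rabs (s - s0) < d)); [| exact Near].
        intros s Hs. apply (ex_RInt_ext (f s)); [| now apply H3].
        intros t Ht. rewrite Rmin_left, Rmax_right in Ht by lra. rewrite Cid by lra. reflexivity.
    + apply RInt_ext. intros t Ht. rewrite Rmin_left, Rmax_right in Ht by lra.
      rewrite D by (rewrite Rminus_diag, Rabs_R0; exact Hd). rewrite Cid by lra. reflexivity.
Qed.

(** The imaginary part of the integral of [F] over the segment from [z] to [z + d]. *)
Definition seg (F : C -> C) (z d : C) : R := RInt (fun t => Im (F (z + t * d) * d)%C) 0 1.

(** [E'] is a continuous complex derivative of [E] on [D]. *)
Definition holo (D : C -> Prop) (E E' : C -> C) : Prop :=
  (forall f t l, D (f t) -> cder f t l -> cder (fun s => E (f s)) t (E' (f t) * l)%C) /\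
  (forall (T : UniformSpace) (f : T -> C) x, ccont f x -> D (f x) -> ccont (fun s => E' (f s)) x).

Lemma ex_RInt_01 (f : R -> R) : (forall t, 0 <= t <= 1 -> continuous f t) -> ex_RInt f 0 1.
Proof.
  intro H. apply (@ex_RInt_continuous R_CompleteNormedModule).
  intros t Ht. apply H. now rewrite Rmin_left, Rmax_right in Ht by lra.
Qed.

Lemma ex_seg (F : C -> C) (z d : C) :
  (forall t, 0 <= t <= 1 -> ccont (fun s : R => F (z + s * d)%C) t) ->
  ex_RInt (fun t => Im (F (z + t * d) * d)%C) 0 1.
Proof.
  intro H. apply ex_RInt_01. intros t Ht.
  apply (ccont_mult (fun s : R => F (z + s * d)%C) (fun _ => d));
    [now apply H | apply ccont_const].
Qed.

Lemma seg_FTC (D : C -> Prop) (E E' : C -> C) (z d : C) :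
  holo D E E' -> (forall t : R, 0 <= t <= 1 -> D (z + t * d)%C) ->
  seg E' z d = Im (E (z + d)%C) - Im (E z).
Proof.
  intros [H1 H2] HD. unfold seg.
  replace (Im (E (z + d)%C)) with (Im (E (z + 1 * d)%C)) by (do 2 f_equal; ring).
  replace (Im (E z)) with (Im (E (z + 0 * d)%C)) by (do 2 f_equal; ring).
  apply is_RInt_unique.
  apply (is_RInt_derive (fun t : R => Im (E (z + t * d)%C))).
  - intros t Ht. rewrite Rmin_left, Rmax_right in Ht by lra.
    apply (H1 (fun s : R => (z + s * d)%C)); [now apply HD | apply cder_line].
  - intros t Ht. rewrite Rmin_left, Rmax_right in Ht by lra.
    apply (ccont_mult (fun s : R => E' (z + s * d)%C) (fun _ => d)); [| apply ccont_const].
    apply H2; [eapply cder_ccont, cder_line | now apply HD].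
Qed.

Lemma seg_shift (D : C -> Prop) (E E' : C -> C) (z d : C) (r e : R) :
  holo D E E' -> 0 < e ->
  (forall s t : R, Rabs (s - r) < e -> 0 <= t <= 1 -> D (s + z + t * d)%C) ->
  is_derive (fun s : R => seg E (s + z) d) r (seg E' (r + z) d).
Proof.
  intros [H1 H2] He HD. unfold seg.
  apply (is_derive_RInt_01 (fun s t => Im (E (s + z + t * d) * d)%C)
           (fun s t => Im (E' (s + z + t * d) * d)%C) r e He).
  - intros s t Hs Ht.
    assert (K : cder (fun u : R => (E (u + z + t * d) * d)%C) s (E' (s + z + t * d) * d)%C).
    { eapply cder_ext with (f := fun u : R => (d * E ((z + t * d) + u * 1))%C).
      - intro u. replace (z + t * d + u * 1)%C with (u + z + t * d)%C by ring. ring.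
      - reflexivity.
      - replace (E' (s + z + t * d) * d)%C with (d * (E' ((z + t * d) + s * 1) * 1))%C
          by (replace (z + t * d + s * 1)%C with (s + z + t * d)%C by ring; ring).
        apply cder_scal. apply (H1 (fun u : R => (z + t * d + u * 1)%C)).
        + replace (z + t * d + s * 1)%C with (s + z + t * d)%C by ring. now apply HD.
        + apply cder_line. }
    exact (proj2 K).
  - intros t Ht.
    apply (ccont_mult (fun v : R * R => E' (fst v + z + snd v * d)%C) (fun _ => d));
      [| apply ccont_const].
    apply H2.
    + apply ccont_plus; [apply ccont_plus; [apply ccont_real, continuous_fst | apply ccont_const] |].
      apply ccont_mult; [apply ccont_real, continuous_snd | apply ccont_const].
    + apply HD; [| exact Ht]. simpl. rewrite Rminus_diag, Rabs_R0. exact He.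
  - intros s Hs. apply ex_seg. intros t Ht. eapply cder_ccont.
    apply (H1 (fun u : R => (s + z + u * d)%C)); [now apply HD | apply cder_line].
Qed.

(** * The integrand *)

(** With [u = exp w], the integrand [(u - q)^a (u + p)^b u^c]. *)
Definition kfun (q p a b c : R) (w : C) : C :=
  (upow a (Cexp w - q) * upow b (Cexp w + p) * Cexp (c * w))%C.

(** The derivative in [w] stays in the family because [exp w] raises [c] by one. *)
Definition dkfun (q p a b c : R) (w : C) : C :=
  (a * kfun q p (a - 1) b (c + 1) w + b * kfun q p a (b - 1) (c + 1) w + c * kfun q p a b c w)%C.

Lemma kfun_succ (q p a b c : R) (w : C) : kfun q p a b (c + 1) w = (Cexp w * kfun q p a b c w)%C.
Proof.
  unfold kfun. replace ((c + 1)%R * w)%C with (c * w + w)%C by (rewrite RtoC_plus; ring).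
  rewrite Cexp_plus. ring.
Qed.

Lemma ccont_kfun {T : UniformSpace} (q p : T -> R) (a b c : R) (f : T -> C) x :
  continuous q x -> continuous p x -> ccont f x ->
  pow_cont a (Cexp (f x) - q x)%C -> pow_cont b (Cexp (f x) + p x)%C ->
  ccont (fun s => kfun (q s) (p s) a b c (f s)) x.
Proof.
  intros Hq Hp Hf H1 H2. unfold kfun.
  apply ccont_mult; [apply ccont_mult |].
  - apply ccont_upow; [| exact H1].
    apply ccont_minus; [now apply ccont_Cexp | now apply ccont_real].
  - apply ccont_upow; [| exact H2].
    apply ccont_plus; [now apply ccont_Cexp | now apply ccont_real].
  - apply ccont_Cexp, ccont_mult; [apply ccont_const | exact Hf].
Qed.

Lemma holo_kfun (q p a b c : R) :
  holo (fun w => pow_diff a (Cexp w - q)%C /\ pow_diff b (Cexp w + p)%C) (kfun q p a b c) (dkfun q p a b c).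
Proof.
  split.
  - intros f t l [Ha Hb] Hf.
    assert (He := cder_Cexp f t l Hf).
    eapply cder_ext; [intro; reflexivity | | apply cder_mult; [apply cder_mult |]].
    2: { apply (cder_upow a (fun s => Cexp (f s) - q)%C); [exact Ha |].
         apply cder_minus; [exact He | apply cder_const]. }
    2: { apply (cder_upow b (fun s => Cexp (f s) + p)%C); [exact Hb |].
         apply cder_plus; [exact He | apply cder_const]. }
    2: { apply cder_Cexp, cder_scal; exact Hf. }
    unfold dkfun. rewrite !kfun_succ. unfold kfun. simpl. ring.
  - intros T f x Hf [Ha Hb]. unfold dkfun.
    apply ccont_plus; [apply ccont_plus |]; (apply ccont_mult; [apply ccont_const |]);
      apply (ccont_kfun (fun _ => q) (fun _ => p)); auto using continuous_const, pow_diff_cont, pow_diff_pred.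
Qed.

(** * Coefficients of the generating function *)

Lemma falling_S_l (a : R) (k : nat) : falling a (S k) = a * falling (a - 1) k.
Proof.
  induction k as [|k IH]; [simpl; ring |].
  change (falling a (S (S k))) with (falling a (S k) * (a - INR (S k))).
  rewrite IH. change (falling (a - 1) (S k)) with (falling (a - 1) k * (a - 1 - INR k)).
  rewrite S_INR. ring.
Qed.

Lemma binom_absorb (a : R) (k : nat) : INR (S k) * binom a (S k) = a * binom (a - 1) k.
Proof.
  unfold binom. rewrite falling_S_l, fact_simpl, mult_INR.
  assert (INR (fact k) <> 0) by apply INR_fact_neq_0.
  assert (INR (S k) <> 0) by (apply not_0_INR; lia).
  field. auto.
Qed.

(** The coefficient of [w ^ n] in [(1 + q w) ^ a (1 - p w) ^ b]. *)
Definition kcoef (q p a b : R) (n : nat) : R :=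
  sum_f_R0 (fun k => binom a k * binom b (n - k) * q ^ k * (- p) ^ (n - k)) n.

(** Euler's operator [w d/dw] applied to the generating function. *)
Lemma kcoef_S (q p a b : R) (n : nat) :
  INR (S n) * kcoef q p a b (S n) = q * a * kcoef q p (a - 1) b n - p * b * kcoef q p a (b - 1) n.
Proof.
  unfold kcoef. set (t := fun k => binom a k * binom b (S n - k) * q ^ k * (- p) ^ (S n - k)).
  replace (INR (S n) * sum_f_R0 t (S n)) with
    (sum_f_R0 (fun k => INR k * t k) (S n) + sum_f_R0 (fun k => INR (S n - k) * t k) (S n)).
  2: { rewrite <- sum_plus, scal_sum. apply sum_eq. intros k Hk.
       rewrite minus_INR by lia. ring. }
  rewrite (decomp_sum (fun k => INR k * t k)) by lia. simpl pred.
  rewrite (tech5 (fun k => INR (S n - k) * t k)). rewrite Nat.sub_diag.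
  replace (sum_f_R0 (fun i => INR (S i) * t (S i)) n) with
    (q * a * sum_f_R0 (fun k => binom (a - 1) k * binom b (n - k) * q ^ k * (- p) ^ (n - k)) n).
  2: { rewrite scal_sum. apply sum_eq. intros k Hk. unfold t.
       replace (S n - S k)%nat with (n - k)%nat by lia.
       replace (INR (S k) * (binom a (S k) * binom b (n - k) * q ^ S k * (- p) ^ (n - k)))
         with (INR (S k) * binom a (S k) * (binom b (n - k) * q ^ S k * (- p) ^ (n - k))) by ring.
       rewrite binom_absorb. simpl. ring. }
  replace (sum_f_R0 (fun k => INR (S n - k) * t k) n) with
    (- (p * b * sum_f_R0 (fun k => binom a k * binom (b - 1) (n - k) * q ^ k * (- p) ^ (n - k)) n)).
  2: { rewrite <- Ropp_mult_distr_l_reverse, scal_sum. apply sum_eq. intros k Hk. unfold t.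
       replace (S n - k)%nat with (S (n - k)) by lia.
       replace (INR (S (n - k)) * (binom a k * binom b (S (n - k)) * q ^ k * (- p) ^ S (n - k)))
         with (INR (S (n - k)) * binom b (S (n - k)) * (binom a k * q ^ k * (- p) ^ S (n - k))) by ring.
       rewrite binom_absorb. simpl. ring. }
  simpl INR. ring.
Qed.

(** * The contour *)

Definition strip (m : R) (w : C) : Prop := m < Re w /\ 0 <= Im w <= PI.

Definition omega : C := (- (1 / 2), sqrt 3 / 2).
Definition rise (tau : R) : C := (0, PI - tau * (sqrt 3 / 2)).

(** From [r] in the direction of the cube root of unity as far as [tau], then straight up to the line
    [Im w = PI]. *)
Definition path (tau r : R) (F : C -> C) : R :=
  seg F r (tau * omega)%C + seg F (r + tau * omega)%C (rise tau).

Definition path_end (tau r : R) : C := (r - tau / 2, PI).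

Lemma sqrt3_bounds : 0 < sqrt 3 < 2.
Proof.
  split; [apply sqrt_lt_R0; lra |].
  rewrite <- (sqrt_pow2 2) by lra. apply sqrt_lt_1; lra.
Qed.

Lemma path_end_eq (tau r : R) : (r + tau * omega + rise tau)%C = path_end tau r.
Proof. unfold omega, rise, path_end. apply C_ext; reim; field. Qed.

Section Path.
Variables (m tau r : R).
Hypotheses (Htau : 0 <= tau <= 1) (Hr : m < r - tau / 2).

Lemma strip_seg1 (t : R) : 0 <= t <= 1 -> strip m (r + t * (tau * omega))%C.
Proof.
  intro Ht. generalize sqrt3_bounds PI_RGT_0; intros. unfold omega, strip; reim.
  assert (E : PI > 3) by (generalize PI2_3_2; lra).
  assert (0 <= t * tau <= 1) by nra. assert (t * tau <= tau) by nra.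
  split; [nra |]. split; nra.
Qed.

Lemma strip_seg2 (t : R) : 0 <= t <= 1 -> strip m (r + tau * omega + t * rise tau)%C.
Proof.
  intro Ht. generalize sqrt3_bounds PI_RGT_0; intros. unfold omega, rise, strip; reim.
  assert (E : PI > 3) by (generalize PI2_3_2; lra).
  assert (0 <= tau * sqrt 3 <= 2) by nra.
  split; [nra |]. split; nra.
Qed.

Lemma path_FTC (E E' : C -> C) : holo (strip m) E E' ->
  path tau r E' = Im (E (path_end tau r)) - Im (E r).
Proof.
  intro H. unfold path.
  rewrite (seg_FTC (strip m) E E' r _ H strip_seg1).
  rewrite (seg_FTC (strip m) E E' _ _ H strip_seg2), path_end_eq. ring.
Qed.

Definition ccont_on (F : C -> C) : Prop := forall (f : R -> C) t, ccont f t -> strip m (f t) -> ccont (fun s => F (f s)) t.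

Lemma holo_ccont_on (E E' : C -> C) : holo (strip m) E E' -> ccont_on E'.
Proof. intros [_ H] f t Hf. now apply H. Qed.

Lemma ex_path (F : C -> C) : ccont_on F ->
  ex_RInt (fun t => Im (F (r + t * (tau * omega)) * (tau * omega))%C) 0 1 /\
  ex_RInt (fun t => Im (F (r + tau * omega + t * rise tau) * rise tau)%C) 0 1.
Proof.
  intro H. split; apply ex_seg; intros t Ht.
  - apply H; [eapply cder_ccont, cder_line | now apply strip_seg1].
  - apply (H (fun s : R => r + tau * omega + s * rise tau)%C);
      [eapply cder_ccont, cder_line | now apply strip_seg2].
Qed.

Lemma path_lin (F1 F2 F3 : C -> C) (k1 k2 : R) : ccont_on F1 -> ccont_on F2 ->
  (forall w, strip m w -> F3 w = (k1 * F1 w + k2 * F2 w)%C) ->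
  path tau r F3 = k1 * path tau r F1 + k2 * path tau r F2.
Proof.
  intros C1 C2 H. destruct (ex_path F1 C1) as [A1 B1]. destruct (ex_path F2 C2) as [A2 B2].
  assert (K : forall (f1 f2 f3 : R -> R), ex_RInt f1 0 1 -> ex_RInt f2 0 1 ->
    (forall t, 0 <= t <= 1 -> f3 t = k1 * f1 t + k2 * f2 t) ->
    RInt f3 0 1 = k1 * RInt f1 0 1 + k2 * RInt f2 0 1).
  { intros f1 f2 f3 I1 I2 E. apply is_RInt_unique.
    apply (is_RInt_ext (fun t => plus (scal k1 (f1 t)) (scal k2 (f2 t)))).
    - intros t Ht. rewrite Rmin_left, Rmax_right in Ht by lra. symmetry; apply E; lra.
    - apply is_RInt_plus_R; apply is_RInt_scal_R;
        now apply RInt_correct_R. }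
  unfold path, seg.
  rewrite (K _ _ (fun t => Im (F3 (r + t * (tau * omega)) * (tau * omega))%C) A1 A2).
  rewrite (K _ _ (fun t => Im (F3 (r + tau * omega + t * rise tau) * rise tau)%C) B1 B2). ring.
  - intros t Ht. rewrite H by now apply strip_seg2. reim. req. ring.
  - intros t Ht. rewrite H by now apply strip_seg1. reim. req. ring.
Qed.

End Path.

(** Translating the contour changes the integral only by the values at its two ends, by [path_FTC]:
    this replaces Cauchy's theorem. *)
Lemma path_shift (m tau r : R) (E E' : C -> C) : 0 <= tau <= 1 -> m < r - tau / 2 ->
  holo (strip m) E E' -> is_derive (fun s => path tau s E) r (path tau r E').
Proof.
  intros Ht Hr H. unfold path. set (e := r - tau / 2 - m).
  assert (He : 0 < e) by (unfold e; lra).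
  assert (Hs : forall s, Rabs (s - r) < e -> m < s - tau / 2).
  { intros s Hs. apply Rabs_def2 in Hs. unfold e in Hs. lra. }
  apply is_derive_plus_R.
  - apply (is_derive_ext (fun s : R => seg E (s + 0)%C (tau * omega)%C)).
    { intro s. f_equal. ring. }
    replace (RtoC r) with (r + 0)%C by ring.
    apply (seg_shift (strip m) E E' 0 (tau * omega)%C r e H He).
    intros s t H1 H2. replace (s + 0)%C with (RtoC s) by ring. apply strip_seg1; auto.
  - apply (seg_shift (strip m) E E' (tau * omega)%C (rise tau) r e H He).
    intros s t H1 H2. apply strip_seg2; auto.
Qed.

(** * Krawtchouk polynomials as contour integrals *)

Lemma Im_Cexp_ge_0 (w : C) : 0 <= Im w <= PI -> 0 <= Im (Cexp w).
Proof.
  intro H. rewrite Im_Cexp. apply Rmult_le_pos; [left; apply exp_pos | apply sin_ge_0; lra].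
Qed.

Lemma offslit_shift (q : R) (w : C) : Rabs q <= 1 -> strip 0 w -> offslit (Cexp w + q)%C.
Proof.
  intros Hq [H1 H2]. apply offslit_upper.
  - reim. generalize (Im_Cexp_ge_0 w H2); lra.
  - intro E. assert (E' : Cexp w = (- q)%R) by (rewrite RtoC_opp; replace (Cexp w) with (Cexp w + q - q)%C by ring; rewrite E; ring).
    apply (f_equal Cmod) in E'. rewrite Cmod_Cexp, Cmod_R, Rabs_Ropp in E'.
    generalize (exp_increasing _ _ H1). rewrite exp_0. lra.
Qed.

Lemma offslit_shift' (q : R) (w : C) : Rabs q <= 1 -> strip 0 w -> offslit (Cexp w - q)%C.
Proof.
  intros Hq Hw. replace (Cexp w - q)%C with (Cexp w + (- q)%R)%C by (rewrite RtoC_opp; ring).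
  apply offslit_shift; [now rewrite Rabs_Ropp | exact Hw].
Qed.

Lemma holo_kfun_far (q p a b c : R) : Rabs q <= 1 -> Rabs p <= 1 ->
  holo (strip 0) (kfun q p a b c) (dkfun q p a b c).
Proof.
  intros Hq Hp. destruct (holo_kfun q p a b c) as [H1 H2]. split.
  - intros f t l Hw. apply H1. split; left; [apply offslit_shift' | apply offslit_shift]; assumption.
  - intros T f x Hf Hw. apply H2; [exact Hf |].
    split; left; [apply offslit_shift' | apply offslit_shift]; assumption.
Qed.

Lemma ccont_kfun_far (q p a b c : R) : Rabs q <= 1 -> Rabs p <= 1 -> ccont_on 0 (kfun q p a b c).
Proof.
  intros Hq Hp f t Hf Hw. apply (ccont_kfun (fun _ => q) (fun _ => p)); auto using continuous_const.
  - left; now apply offslit_shift'.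
  - left; now apply offslit_shift.
Qed.

(** The counterpart of [kcoef_S] for the integrand: [a + b + c] plays the role of [n]. *)
Lemma dkfun_far (q p a b c : R) (w : C) : Rabs q <= 1 -> Rabs p <= 1 -> strip 0 w ->
  dkfun q p a b c w = ((a + b + c)%R * kfun q p a b c w
    + (a * q * kfun q p (a - 1) b c w - b * p * kfun q p a (b - 1) c w))%C.
Proof.
  intros Hq Hp Hw. unfold dkfun. rewrite !kfun_succ.
  assert (E1 : kfun q p a b c w = ((Cexp w - q) * kfun q p (a - 1) b c w)%C).
  { unfold kfun. rewrite (upow_pred a) by now apply offslit_shift'. ring. }
  assert (E2 : kfun q p a b c w = ((Cexp w + p) * kfun q p a (b - 1) c w)%C).
  { unfold kfun. rewrite (upow_pred b) by now apply offslit_shift. ring. }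
  rewrite !RtoC_plus.
  replace ((a + b + c) * kfun q p a b c w)%C
    with (a * kfun q p a b c w + b * kfun q p a b c w + c * kfun q p a b c w)%C by ring.
  rewrite E1 at 2. rewrite E2 at 2. ring.
Qed.

Lemma ulog_pos (x : R) : 0 < x -> ulog x = ln x.
Proof.
  intro H. unfold ulog. rewrite Cmod_R, Rabs_pos_eq by lra. reim.
  apply C_ext; reim; [reflexivity |].
  replace (x / (x + 0)) with 1 by (field; lra). rewrite atan_1. field.
Qed.

Lemma ulog_neg (x : R) : 0 < x -> ulog (- x)%R = (ln x, PI).
Proof.
  intro H. unfold ulog. rewrite Cmod_R, Rabs_Ropp, Rabs_pos_eq by lra. reim.
  apply C_ext; reim; [reflexivity |].
  replace (- x / (x + 0)) with (- (1)) by (field; lra). rewrite atan_opp, atan_1. field.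
Qed.

Lemma Cexp_top (r : R) : Cexp (r, PI) = (- exp r)%R.
Proof. apply C_ext; rewrite ?Re_Cexp, ?Im_Cexp; reim; rewrite ?cos_PI, ?sin_PI; ring. Qed.

Lemma Cmod_R_pos (x : R) : x <> 0 -> 0 < Cmod x.
Proof. intro H. rewrite Cmod_R. now apply Rabs_pos_lt. Qed.

Lemma kfun_real (q p a b c r : R) : q < exp r -> - p < exp r -> Im (kfun q p a b c r) = 0.
Proof.
  intros H1 H2. unfold kfun. rewrite Cexp_real, <- RtoC_minus, <- RtoC_plus, <- RtoC_mult, Cexp_real.
  rewrite !upow_pos by (apply Cmod_R_pos; lra).
  rewrite !ulog_pos by lra. rewrite <- !RtoC_mult, !Cexp_real, <- !RtoC_mult. reflexivity.
Qed.

Lemma sin_nat_PI (n : nat) : sin (INR n * PI) = 0.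
Proof. apply sin_eq_0_1. exists (Z.of_nat n). now rewrite <- INR_IZR_INZ. Qed.

(** On [Im w = pi] to the left of [- p] in the variable [u], all three factors are negative and the
    exponents add up to an integer. *)
Lemma kfun_top_real (q p a b c r : R) (n : nat) : a + b + c = INR n -> - q < exp r -> p < exp r ->
  Im (kfun q p a b c (r, PI)) = 0.
Proof.
  intros Hn H1 H2. unfold kfun. rewrite Cexp_top, <- RtoC_minus, <- RtoC_plus.
  rewrite !upow_pos by (apply Cmod_R_pos; lra).
  replace (- exp r - q) with (- (exp r + q)) by ring.
  replace (- exp r + p) with (- (exp r - p)) by ring.
  rewrite !ulog_neg by lra. rewrite <- !Cexp_plus, Im_Cexp.
  replace (Im _) with (INR n * PI) by (rewrite <- Hn; reim; ring).
  rewrite sin_nat_PI. ring.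
Qed.

Lemma ulog_Cexp (w : C) : 0 <= Im w <= PI -> ulog (Cexp w) = w.
Proof.
  intro H. unfold ulog. rewrite Cmod_Cexp, ln_exp, Re_Cexp, Im_Cexp.
  apply C_ext; reim; [reflexivity |].
  set (al := PI / 4 - Im w / 2).
  assert (Hc : 0 < cos al) by (apply cos_gt_0; unfold al; generalize PI_RGT_0; lra).
  replace (exp (Re w) * cos (Im w) / (exp (Re w) + exp (Re w) * sin (Im w))) with (tan al).
  - rewrite atan_tan by (unfold al; generalize PI_RGT_0; lra). unfold al. field.
  - replace (Im w) with (PI / 2 - 2 * al) by (unfold al; field).
    rewrite cos_minus, sin_minus, cos_PI2, sin_PI2, sin_2a, cos_2a_cos. unfold tan.
    assert (0 < exp (Re w)) by apply exp_pos.
    field. repeat split; try lra.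
    replace (exp (Re w) + _) with (2 * exp (Re w) * (cos al * cos al)) by ring.
    apply Rgt_not_eq, Rmult_lt_0_compat; [lra |]. now apply Rmult_lt_0_compat.
Qed.

(** The derivative of [kfun (s q) (s p) a b c] in [s]. *)
Definition kfun_scale (q p a b c s : R) (w : C) : C :=
  ((- (a * q))%R * kfun (s * q) (s * p) (a - 1) b c w
   + (b * p)%R * kfun (s * q) (s * p) a (b - 1) c w)%C.

Lemma scale_bound (q e s s0 : R) : 0 <= q < 1 -> 0 <= s0 <= 1 -> e <= 1 - q ->
  Rabs (s - s0) < e -> Rabs (s * q) <= 1.
Proof.
  intros Hq H0 He Hs. apply Rabs_def2 in Hs. apply Rabs_le. split; nra.
Qed.

Lemma seg_scale (q p a b c s0 : R) (z d : C) : 0 <= q < 1 -> 0 <= p < 1 -> 0 <= s0 <= 1 ->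
  (forall t, 0 <= t <= 1 -> strip 0 (z + t * d)%C) ->
  is_derive (fun s => seg (kfun (s * q) (s * p) a b c) z d) s0 (seg (kfun_scale q p a b c s0) z d).
Proof.
  intros Hq Hp Hs0 HD. unfold seg.
  set (e := Rmin (1 - q) (1 - p)).
  assert (He : 0 < e) by (apply Rmin_pos; lra).
  assert (Bq : forall s, Rabs (s - s0) < e -> Rabs (s * q) <= 1).
  { intros s Hs. apply (scale_bound q e s s0); auto. apply Rmin_l. }
  assert (Bp : forall s, Rabs (s - s0) < e -> Rabs (s * p) <= 1).
  { intros s Hs. apply (scale_bound p e s s0); auto. apply Rmin_r. }
  apply (is_derive_RInt_01 (fun s t => Im (kfun (s * q) (s * p) a b c (z + t * d) * d)%C)
    (fun s t => Im (kfun_scale q p a b c s (z + t * d) * d)%C) s0 e He).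
  - intros s t Hs Ht. specialize (HD t Ht). set (w := (z + t * d)%C) in *.
    assert (K : cder (fun u => (d * kfun (u * q) (u * p) a b c w)%C) s (kfun_scale q p a b c s w * d)%C).
    { eapply cder_ext; [intro; reflexivity | | apply cder_scal].
      2: { unfold kfun. apply cder_mult; [apply cder_mult | apply cder_const].
           - apply (cder_upow a (fun u : R => Cexp w - (u * q)%R)%C) with (l := RtoC (- q)).
             + left. apply offslit_shift'; auto.
             + eapply cder_ext with (f := fun u : R => (Cexp w + u * (- q)%R)%C);
                 [intro u; rewrite RtoC_mult, RtoC_opp; ring | reflexivity | apply cder_line].
           - apply (cder_upow b (fun u : R => Cexp w + (u * p)%R)%C) with (l := RtoC p).
             + left. apply offslit_shift; auto.
             + eapply cder_ext with (f := fun u : R => (Cexp w + u * p)%C);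
                 [intro u; rewrite RtoC_mult; ring | reflexivity | apply cder_line]. }
      unfold kfun_scale, kfun. rewrite !RtoC_opp, !RtoC_mult. ring. }
    destruct K as [_ K]. apply (is_derive_ext (fun u => Im (d * kfun (u * q) (u * p) a b c w)%C)); [| exact K].
    intro u. f_equal. ring.
  - intros t Ht. apply (ccont_mult (fun v : R * R => kfun_scale q p a b c (fst v) (z + snd v * d)) (fun _ => d));
      [| apply ccont_const].
    assert (Cz : ccont (fun v : R * R => (z + snd v * d)%C) (s0, t)).
    { apply ccont_plus; [apply ccont_const |].
      apply ccont_mult; [apply ccont_real, continuous_snd | apply ccont_const]. }
    assert (Cs : forall k, continuous (fun v : R * R => fst v * k) (s0, t)).
    { intro k. apply (@continuous_mult (prod_UniformSpace R_UniformSpace R_UniformSpace) R_AbsRing);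
        [apply continuous_fst | apply continuous_const]. }
    assert (Z : Rabs (s0 - s0) < e) by (rewrite Rminus_diag, Rabs_R0; exact He).
    unfold kfun_scale. apply ccont_plus; (apply ccont_mult; [apply ccont_const |]);
      apply (ccont_kfun (fun v : R * R => fst v * q) (fun v : R * R => fst v * p)); auto; simpl;
      left; (apply offslit_shift || apply offslit_shift'); auto.
  - intros s Hs. apply ex_seg. intros t Ht.
    apply (ccont_kfun_far (s * q) (s * p) a b c); auto. eapply cder_ccont, cder_line.
Qed.

Lemma path_const (tau r : R) : path tau r (fun _ => 1) = PI.
Proof.
  unfold path, seg. rewrite !RInt_const. unfold omega, rise, scal; simpl; unfold mult; simpl.
  field.
Qed.

Lemma path_ext (tau r m : R) (F1 F2 : C -> C) : 0 <= tau <= 1 -> m < r - tau / 2 ->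
  (forall w, strip m w -> F1 w = F2 w) -> path tau r F1 = path tau r F2.
Proof.
  intros Ht Hr H. unfold path, seg. f_equal; apply RInt_ext; intros t Hx;
    rewrite Rmin_left, Rmax_right in Hx by lra; rewrite H; auto.
  - apply strip_seg1; auto; lra.
  - apply strip_seg2; auto; lra.
Qed.

Section Coefficient.
Variables (q p tau r : R).
Hypotheses (Hq : 0 <= q < 1) (Hp : 0 <= p < 1) (Ht : 0 <= tau <= 1) (Hr : 0 < r - tau / 2).

Lemma exp_r_gt : 1 < exp r /\ 1 < exp (r - tau / 2).
Proof. split; rewrite <- exp_0; apply exp_increasing; lra. Qed.

Lemma path_dkfun_far (s a b c : R) (n : nat) : 0 <= s <= 1 -> a + b + c = INR n ->
  path tau r (dkfun (s * q) (s * p) a b c) = 0.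
Proof.
  intros Hs Hn. destruct exp_r_gt as [H1 H2].
  rewrite (path_FTC 0 tau r Ht Hr (kfun (s * q) (s * p) a b c)).
  - unfold path_end. rewrite (kfun_top_real _ _ _ _ _ _ n) by (assumption || nra).
    rewrite kfun_real by nra. ring.
  - apply holo_kfun_far; rewrite Rabs_pos_eq; nra.
Qed.

(** Scaling [q] and [p] down to [0] does not change the mean value of
    [(1 - q / u) ^ a (1 + p / u) ^ b], which is [1] in the limit. *)
Lemma path_kfun_0 (a b : R) : path tau r (kfun q p a b (- a - b)) = PI.
Proof.
  set (c := - a - b). set (M := fun s => path tau r (kfun (s * q) (s * p) a b c)).
  assert (D : forall s, 0 <= s <= 1 -> is_derive M s (path tau r (kfun_scale q p a b c s))).
  { intros s Hs. unfold M, path. apply is_derive_plus_R.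
    - apply seg_scale; auto. intros t Hx. apply strip_seg1; auto.
    - apply seg_scale; auto. intros t Hx. apply strip_seg2; auto. }
  assert (Z : forall s, 0 < s <= 1 -> path tau r (kfun_scale q p a b c s) = 0).
  { intros s Hs. assert (Hs' : 0 <= s <= 1) by lra.
    assert (E := path_dkfun_far s a b c 0 Hs'). rewrite <- (Rmult_0_r (- / s)), <- E by (unfold c; simpl; ring).
    rewrite (path_lin 0 tau r Ht Hr (dkfun (s * q) (s * p) a b c) (fun _ => 0) _ (- / s) 0); [ring | | |].
    - eapply holo_ccont_on, holo_kfun_far; rewrite Rabs_pos_eq; nra.
    - intros f t _ _. apply ccont_const.
    - intros w Hw. rewrite dkfun_far; [| rewrite Rabs_pos_eq; nra | rewrite Rabs_pos_eq; nra | exact Hw].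
      replace (a + b + c) with 0 by (unfold c; ring). unfold kfun_scale.
      rewrite !RtoC_opp, !RtoC_mult, RtoC_inv by lra. field.
      intro X; apply RtoC_inj in X; lra. }
  replace (path tau r (kfun q p a b c)) with (M 1) by (unfold M; now rewrite !Rmult_1_l).
  replace PI with (M 0).
  - destruct (MVT_gen M 0 1 (fun _ => 0)) as [x [_ E]]; [| | lra].
    + intros s Hs. rewrite Rmin_left, Rmax_right in Hs by lra.
      rewrite <- (Z s) by lra. apply D. lra.
    + intros s Hs. rewrite Rmin_left, Rmax_right in Hs by lra.
      apply continuity_pt_filterlim, derive_cont_R. eexists. now apply D.
  - unfold M. rewrite !Rmult_0_l. rewrite (path_ext tau r 0 _ (fun _ => 1) Ht Hr); [apply path_const |].
    intros w [_ Hw]. unfold kfun.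
    replace (Cexp w - 0)%C with (Cexp w) by ring. replace (Cexp w + 0)%C with (Cexp w) by ring.
    rewrite !upow_pos by (rewrite Cmod_Cexp; apply exp_pos).
    rewrite ulog_Cexp by exact Hw. rewrite <- !Cexp_plus, <- Cexp_0. f_equal.
    unfold c. rewrite RtoC_minus, RtoC_opp. ring.
Qed.

(** Integrating the derivative of [kfun] over the contour gives [0], as its values at the ends are
    real; this is the recursion [kcoef_S] in [n] for the integrals, simultaneously for all exponents. *)
Lemma kcoef_path (n : nat) : forall a b,
  path tau r (kfun q p a b (INR n - a - b)) = PI * (-1) ^ n * kcoef q p a b n.
Proof.
  induction n as [|n IH]; intros a b.
  - replace (INR 0 - a - b) with (- a - b) by (simpl; ring).
    rewrite path_kfun_0. unfold kcoef, binom; simpl. field.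
  - set (c := INR (S n) - a - b).
    assert (E := path_dkfun_far 1 a b c (S n) ltac:(lra) ltac:(unfold c; ring)).
    rewrite !Rmult_1_l in E.
    assert (Aq : Rabs q <= 1) by (rewrite Rabs_pos_eq; lra).
    assert (Ap : Rabs p <= 1) by (rewrite Rabs_pos_eq; lra).
    rewrite (path_lin 0 tau r Ht Hr (kfun q p a b c)
      (fun w => (a * q)%R * kfun q p (a - 1) b c w + (- (b * p))%R * kfun q p a (b - 1) c w)%C _ (INR (S n)) 1) in E.
    + rewrite (path_lin 0 tau r Ht Hr (kfun q p (a - 1) b c) (kfun q p a (b - 1) c)
        (fun w => (a * q)%R * kfun q p (a - 1) b c w + (- (b * p))%R * kfun q p a (b - 1) c w)%C (a * q) (- (b * p))) in E;
        [| apply ccont_kfun_far; assumption | apply ccont_kfun_far; assumption | intros; reflexivity].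
      replace c with (INR n - (a - 1) - b) in E at 2 by (unfold c; rewrite S_INR; ring).
      replace c with (INR n - a - (b - 1)) in E at 2 by (unfold c; rewrite S_INR; ring).
      rewrite !IH in E.
      assert (Hn : INR (S n) <> 0) by (apply not_0_INR; lia).
      apply (Rmult_eq_reg_l (INR (S n))); [| exact Hn].
      replace (INR (S n) * (PI * (-1) ^ S n * kcoef q p a b (S n)))
        with (PI * (-1) ^ S n * (INR (S n) * kcoef q p a b (S n))) by ring.
      rewrite kcoef_S. simpl pow. lra.
    + apply ccont_kfun_far; assumption.
    + intros f t Hf Hw. apply ccont_plus; (apply ccont_mult; [apply ccont_const |]);
        now apply (ccont_kfun_far q p).
    + intros w Hw. rewrite dkfun_far by assumption.
      replace (a + b + c) with (INR (S n)) by (unfold c; ring).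
      rewrite RtoC_opp, !RtoC_mult. ring.
Qed.

End Coefficient.

(** * Cubic exponentials *)

Lemma exp_le (x y : R) : x <= y -> exp x <= exp y.
Proof. intros [H|H]; [left; now apply exp_increasing | right; now rewrite H]. Qed.

(** The cubic dominates every linear term, with a constant that is uniform in [c <= A]. *)
Lemma exp_cubic_bound (k A : R) : 0 < k ->
  exists K, 0 < K /\ forall T c, 0 <= T -> c <= A -> exp (- (k * T ^ 3) + c * T) <= K * exp (- T).
Proof.
  intro Hk. set (B := Rabs A + 1). exists (exp (B * (1 + B / k))). split; [apply exp_pos |].
  intros T c HT Hc. rewrite <- exp_plus. apply exp_le.
  assert (HA : c <= B - 1) by (unfold B; generalize (Rle_abs A); lra).
  assert (HB : 1 <= B) by (unfold B; generalize (Rabs_pos A); lra).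
  assert (HBk : 0 < B / k) by (apply Rdiv_lt_0_compat; lra).
  assert (Hc' : c * T <= (B - 1) * T) by (apply Rmult_le_compat_r; lra).
  destruct (Rle_lt_dec T (1 + B / k)) as [L|L].
  - assert (0 <= k * T ^ 3) by (apply Rmult_le_pos; [lra | apply pow_le; lra]).
    assert (B * T <= B * (1 + B / k)) by (apply Rmult_le_compat_l; lra). lra.
  - assert (B < k * T).
    { apply Rlt_trans with (k * (B / k) + k * 1); [field_simplify; lra |].
      rewrite <- Rmult_plus_distr_l. apply Rmult_lt_compat_l; lra. }
    assert (B * T <= k * T ^ 3).
    { replace (k * T ^ 3) with (k * T * T * T) by ring.
      assert (0 <= k * T * T) by (apply Rmult_le_pos; [nra | lra]).
      assert (B * 1 <= k * T * T) by (apply Rmult_le_compat; lra). nra. }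
    assert (0 <= B * (1 + B / k)) by nra. lra.
Qed.

Lemma exp_taylor_term (T : R) (n : nat) : 0 <= T -> T ^ n / INR (fact n) <= exp T.
Proof.
  intro HT. 
  assert (H : is_lim_seq (sum_n (fun k => T ^ k / INR (fact k))) (exp T)).
  { apply (is_lim_seq_ext (sum_n (fun k => / INR (fact k) * T ^ k))); [| exact (proj1 (is_pseries_R _ _ _) (is_exp_Reals T))].
    intro m. apply sum_n_ext. intro k. req. field. apply INR_fact_neq_0. }
  assert (P : forall k, 0 <= T ^ k / INR (fact k)).
  { intro k. apply Rmult_le_pos; [now apply pow_le |]. left. apply Rinv_0_lt_compat, INR_fact_lt_0. }
  apply Rle_trans with (sum_n (fun k => T ^ k / INR (fact k)) n).
  - destruct n as [|n]; [rewrite sum_O; lra |]. rewrite sum_Sn. unfold plus; simpl plus.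
    assert (0 <= sum_n (fun k => T ^ k / INR (fact k)) n).
    { rewrite sum_n_Reals. apply cond_pos_sum. exact P. }
    unfold plus; simpl. lra.
  - apply (is_lim_seq_incr_compare _ _ H). intro m. rewrite sum_Sn. unfold plus; simpl.
    generalize (P (S m)). simpl. lra.
Qed.

(** * Limits at infinity *)

Definition lim_infty (F : R -> R) (l : R) : Prop :=
  forall e, 0 < e -> exists r, 0 <= r /\ forall x, r <= x -> Rabs (F x - l) < e.

Lemma lim_infty_incr (F : R -> R) (B : R) :
  (forall x y, 0 <= x <= y -> F x <= F y) -> (forall x, 0 <= x -> F x <= B) ->
  exists l, lim_infty F l.
Proof.
  intros Hi HB.
  destruct (completeness (fun y => exists x, 0 <= x /\ y = F x)) as [l [Hu Hl]].
  - exists B. intros y [x [Hx ->]]. now apply HB.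
  - exists (F 0), 0. split; [lra | reflexivity].
  - exists l. intros e He.
    destruct (Classical_Prop.classic (exists x, 0 <= x /\ l - e < F x)) as [[x [Hx Hlx]]|N].
    + exists x. split; [exact Hx |]. intros y Hy.
      assert (F x <= F y) by (apply Hi; lra).
      assert (F y <= l) by (apply Hu; exists y; split; [lra | reflexivity]).
      apply Rabs_def1; lra.
    + exfalso. assert (l <= l - e); [| lra]. apply Hl. intros y [x [Hx ->]].
      apply Rnot_lt_le. intro Hlt. apply N. exists x. now split.
Qed.

Lemma lim_infty_is_lim (F : R -> R) (l : R) : lim_infty F l <-> is_lim F p_infty l.
Proof.
  split.
  - intro H. apply is_lim_spec. intros [e He]. destruct (H e He) as [r [_ K]].
    exists r. intros x Hx. apply K. lra.
  - intros H e He. apply is_lim_spec in H. destruct (H (mkposreal e He)) as [r K].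
    exists (Rmax 0 (r + 1)). split; [apply Rmax_l |]. intros x Hx. apply K.
    generalize (Rmax_r 0 (r + 1)). lra.
Qed.

Lemma lim_infty_unique (F : R -> R) (l m : R) : lim_infty F l -> lim_infty F m -> l = m.
Proof.
  intros H1 H2. apply lim_infty_is_lim in H1, H2. apply is_lim_unique in H1, H2.
  rewrite H1 in H2. now injection H2.
Qed.

Lemma lim_infty_ext (F G : R -> R) (l : R) : (forall x, 0 <= x -> F x = G x) -> lim_infty F l -> lim_infty G l.
Proof.
  intros E H e He. destruct (H e He) as [r [Hr K]]. exists r. split; [exact Hr |].
  intros x Hx. rewrite <- E by lra. now apply K.
Qed.

Lemma lim_infty_const (k : R) : lim_infty (fun _ => k) k.
Proof. apply lim_infty_is_lim, is_lim_const. Qed.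

Lemma lim_infty_plus (F G : R -> R) (l m : R) : lim_infty F l -> lim_infty G m ->
  lim_infty (fun x => F x + G x) (l + m).
Proof. intros H1 H2. apply lim_infty_is_lim, is_lim_plus'; now apply lim_infty_is_lim. Qed.

Lemma lim_infty_scal (k : R) (F : R -> R) (l : R) : lim_infty F l -> lim_infty (fun x => k * F x) (k * l).
Proof. intro H. apply lim_infty_is_lim in H. apply lim_infty_is_lim. exact (is_lim_scal_l F k _ _ H). Qed.

Lemma lim_infty_mult (F G : R -> R) (l m : R) : lim_infty F l -> lim_infty G m ->
  lim_infty (fun x => F x * G x) (l * m).
Proof.
  intros H1 H2. apply lim_infty_is_lim in H1, H2. apply lim_infty_is_lim.
  exact (is_lim_mult F G _ _ _ H1 H2 I).
Qed.

Lemma lim_infty_exp (K : R) : lim_infty (fun x => K * exp (- x)) 0.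
Proof.
  replace 0 with (K * 0) by ring. apply lim_infty_scal. intros e He.
  exists (Rmax 0 (- ln e + 1)). split; [apply Rmax_l |]. intros x Hx.
  rewrite Rminus_0_r, Rabs_pos_eq by (left; apply exp_pos).
  rewrite <- (exp_ln e) by exact He. apply exp_increasing.
  generalize (Rmax_r 0 (- ln e + 1)). lra.
Qed.

Lemma lim_infty_squeeze (F : R -> R) (K : R) : (forall x, 0 <= x -> Rabs (F x) <= K * exp (- x)) -> lim_infty F 0.
Proof.
  intros H e He. destruct (lim_infty_exp K e He) as [r [P L]]. exists r. split; [exact P |].
  intros x Hx. rewrite Rminus_0_r. eapply Rle_lt_trans; [apply H; lra |].
  specialize (L x Hx). rewrite Rminus_0_r in L. eapply Rle_lt_trans; [apply Rle_abs | exact L].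
Qed.

(** * Moments of the cubic exponential *)

Lemma ex_RInt_cont (f : R -> R) (a b : R) : (forall x, continuous f x) -> ex_RInt f a b.
Proof. intro H. apply (@ex_RInt_continuous R_CompleteNormedModule). intros; apply H. Qed.

Lemma cont_ex_derive (f : R -> R) : (forall x, ex_derive f x) -> forall x, continuous f x.
Proof. intros H x. apply derive_cont_R, H. Qed.

Definition mom (k : nat) (r : R) : R := RInt (fun T => T ^ k * exp (- (T ^ 3 / 3))) 0 r.

Lemma cont_mom (k : nat) (x : R) : continuous (fun T => T ^ k * exp (- (T ^ 3 / 3))) x.
Proof. apply cont_ex_derive. intro y. auto_derive. exact I. Qed.

Lemma mom_term_bound (k : nat) : exists K, 0 < K /\ forall T, 0 <= T ->
  T ^ k * exp (- (T ^ 3 / 3)) <= K * exp (- T).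
Proof.
  destruct (exp_cubic_bound (/ 3) 1) as [K [HK H]]; [lra |].
  exists (INR (fact k) * K). split; [apply Rmult_lt_0_compat; [apply INR_fact_lt_0 | exact HK] |].
  intros T HT. specialize (H T 1 HT (Rle_refl 1)).
  replace (- (/ 3 * T ^ 3) + 1 * T) with (T + - (T ^ 3 / 3)) in H by field.
  rewrite exp_plus in H. rewrite Rmult_assoc.
  eapply Rle_trans; [| apply Rmult_le_compat_l; [left; apply INR_fact_lt_0 | exact H]].
  rewrite <- Rmult_assoc. apply Rmult_le_compat_r; [left; apply exp_pos |].
  assert (E := exp_taylor_term T k HT). apply (Rmult_le_compat_l (INR (fact k))) in E; [| left; apply INR_fact_lt_0].
  replace (INR (fact k) * (T ^ k / INR (fact k))) with (T ^ k) in E by (field; apply INR_fact_neq_0). exact E.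
Qed.

Lemma RInt_exp_opp (a b : R) : RInt (fun T => exp (- T)) a b = exp (- a) - exp (- b).
Proof.
  apply is_RInt_unique.
  replace (exp (- a) - exp (- b)) with (minus (- exp (- b)) (- exp (- a))) by (unfold minus, plus, opp; simpl; ring).
  apply (is_RInt_derive (fun T => - exp (- T)) (fun T => exp (- T))).
  - intros x _. auto_derive; [exact I | req; ring].
  - intros x _. revert x. apply cont_ex_derive. intro y. auto_derive. exact I.
Qed.

Lemma RInt_exp_bound (f : R -> R) (K a b : R) : a <= b -> ex_RInt f a b ->
  (forall T, a <= T <= b -> Rabs (f T) <= K * exp (- T)) -> Rabs (RInt f a b) <= K * (exp (- a) - exp (- b)).
Proof.
  intros Hab Hf H.
  rewrite <- RInt_exp_opp.
  assert (C : forall a b, ex_RInt (fun T => exp (- T)) a b).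
  { intros; apply ex_RInt_cont, cont_ex_derive. intro y. auto_derive. exact I. }
  apply (norm_RInt_le f (fun T => K * exp (- T)) a b (RInt f a b)); [exact Hab | exact H | |].
  - now apply RInt_correct_R.
  - apply is_RInt_scal_R. now apply RInt_correct_R.
Qed.

Lemma mom_Chasles (k : nat) (x y : R) : mom k y = mom k x + RInt (fun T => T ^ k * exp (- (T ^ 3 / 3))) x y.
Proof.
  unfold mom. symmetry. apply RInt_Chasles_R; apply ex_RInt_cont, cont_mom.
Qed.

Lemma mom_lim (k : nat) : exists l, lim_infty (mom k) l.
Proof.
  destruct (mom_term_bound k) as [K [HK H]].
  apply (lim_infty_incr _ K).
  - intros x y Hxy. rewrite (mom_Chasles k x y).
    assert (0 <= RInt (fun T => T ^ k * exp (- (T ^ 3 / 3))) x y); [| lra].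
    apply RInt_ge_0; [lra | apply ex_RInt_cont, cont_mom |].
    intros T HT. apply Rmult_le_pos; [apply pow_le; lra | left; apply exp_pos].
  - intros x Hx. eapply Rle_trans; [apply Rle_abs |].
    eapply Rle_trans; [apply (RInt_exp_bound _ K); [exact Hx | apply ex_RInt_cont, cont_mom |] |].
    + intros T HT. rewrite Rabs_pos_eq; [apply H; lra |].
      apply Rmult_le_pos; [apply pow_le; lra | left; apply exp_pos].
    + rewrite Ropp_0, exp_0. generalize (exp_pos (- x)). nra.
Qed.

(** Integration by parts, from [(exp (- T^3/3))' = - T^2 exp (- T^3/3)]. *)
Lemma mom_rec (k : nat) (x : R) : mom (k + 3) x = INR (S k) * mom k x - x ^ S k * exp (- (x ^ 3 / 3)).
Proof.
  assert (E : RInt (fun T => INR (S k) * (T ^ k * exp (- (T ^ 3 / 3))) - T ^ (k + 3) * exp (- (T ^ 3 / 3))) 0 x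
    = x ^ S k * exp (- (x ^ 3 / 3)) - 0 ^ S k * exp (- (0 ^ 3 / 3))).
  { apply is_RInt_unique. apply (is_RInt_derive (fun T => T ^ S k * exp (- (T ^ 3 / 3)))).
    - intros y _. auto_derive; [exact I |]. req. 
      change (match k with 0%nat => 1 | S _ => INR k + 1 end) with (INR (S k)).
      simpl Nat.pred. rewrite pow_add. generalize (INR (S k)); intro N. unfold Rdiv. simpl. field.
    - intros y _. revert y. apply cont_ex_derive. intro y. auto_derive. exact I. }
  rewrite pow_i in E by lia.
  assert (E2 : RInt (fun T => INR (S k) * (T ^ k * exp (- (T ^ 3 / 3))) - T ^ (k + 3) * exp (- (T ^ 3 / 3))) 0 x
    = INR (S k) * mom k x - mom (k + 3) x).
  { apply is_RInt_unique. apply is_RInt_minus_R; [apply is_RInt_scal_R |];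
      apply RInt_correct_R, ex_RInt_cont, cont_mom. }
  lra.
Qed.

Lemma mom_rec_lim (k : nat) (l : R) : lim_infty (mom k) l -> lim_infty (mom (k + 3)) (INR (S k) * l).
Proof.
  intro H. apply (lim_infty_ext (fun x => INR (S k) * mom k x + (-1) * (x ^ S k * exp (- (x ^ 3 / 3))))).
  - intros x _. rewrite mom_rec. ring.
  - replace (INR (S k) * l) with (INR (S k) * l + -1 * 0) by ring.
    apply lim_infty_plus; [now apply lim_infty_scal |]. apply lim_infty_scal.
    destruct (mom_term_bound (S k)) as [K [_ HK]]. apply (lim_infty_squeeze _ K).
    intros x Hx. rewrite Rabs_pos_eq; [now apply HK |].
    apply Rmult_le_pos; [now apply pow_le | left; apply exp_pos].
Qed.

Lemma mom_lim_rising (i j : nat) (l : R) : lim_infty (mom i) l ->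
  lim_infty (mom (i + 3 * j)) (3 ^ j * rising ((INR i + 1) / 3) j * l).
Proof.
  intro H. induction j as [|j IH].
  - replace (i + 3 * 0)%nat with i by lia. simpl. now rewrite !Rmult_1_l.
  - replace (i + 3 * S j)%nat with (i + 3 * j + 3)%nat by lia.
    apply mom_rec_lim in IH.
    replace (3 ^ S j * rising ((INR i + 1) / 3) (S j) * l) with
      (INR (S (i + 3 * j)) * (3 ^ j * rising ((INR i + 1) / 3) j * l)); [exact IH |].
    rewrite S_INR, plus_INR, mult_INR. simpl. field.
Qed.

(** * The exponential series *)

Fixpoint psum (f : nat -> R) (n : nat) : R :=
  match n with O => 0 | S m => psum f m + f m end.

Lemma psum_ext (f g : nat -> R) n : (forall j, (j < n)%nat -> f j = g j) -> psum f n = psum g n.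
Proof.
  induction n as [|n IH]; intro H; [reflexivity |]. simpl. rewrite IH, H by (intros; auto with arith). reflexivity.
Qed.

Lemma psum_sum_n (f : nat -> R) n : psum f (S n) = sum_n f n.
Proof.
  induction n as [|n IH]; [rewrite sum_O; simpl; ring |].
  rewrite sum_Sn, <- IH. reflexivity.
Qed.

Lemma psum_S (f : nat -> R) n : psum f (S n) = psum f n + f n.
Proof. reflexivity. Qed.

Lemma psum_3 (f : nat -> R) n : psum f (3 * n) =
  psum (fun j => f (3 * j)%nat) n + psum (fun j => f (1 + 3 * j)%nat) n + psum (fun j => f (2 + 3 * j)%nat) n.
Proof.
  induction n as [|n IH]; [simpl; ring |].
  replace (3 * S n)%nat with (S (S (S (3 * n)))) by lia.
  rewrite !psum_S, IH. change (1 + 3 * n)%nat with (S (3 * n)). change (2 + 3 * n)%nat with (S (S (3 * n))).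
  ring.
Qed.

Lemma psum_scal (k : R) (f : nat -> R) n : psum (fun j => k * f j) n = k * psum f n.
Proof. induction n as [|n IH]; simpl; [ring | rewrite IH; ring]. Qed.

(** Partial sums of the exponential series under the linear functionals [Im (k * _)]. Differentiation
    replaces [k] by [k c], so the remainder is estimated for all [k] at once, by induction on [n]. *)
Definition etay (k c : C) (n : nat) (t : R) : R :=
  psum (fun j => Im (k * c ^ j)%C * (t ^ j / INR (fact j))) n.

Lemma etay_derive (k c : C) (n : nat) (t : R) :
  is_derive (etay k c (S n)) t (etay (k * c)%C c n t).
Proof.
  unfold etay. induction n as [|n IH].
  - apply (is_derive_ext (fun _ => Im (k * c ^ 0)%C)).
    + intro s. rewrite psum_S. req. generalize (Im (k * c ^ 0)%C); intro v. simpl. field.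
    + apply is_derive_const_R.
  - change (psum (fun j => Im (k * c ^ j)%C * (t ^ j / INR (fact j))) (S (S n))) with
     (psum (fun j => Im (k * c ^ j)%C * (t ^ j / INR (fact j))) (S n)
      + Im (k * c ^ S n)%C * (t ^ S n / INR (fact (S n)))).
    apply (is_derive_ext (fun t => psum (fun j => Im (k * c ^ j)%C * (t ^ j / INR (fact j))) (S n)
      + Im (k * c ^ S n)%C * (t ^ S n / INR (fact (S n))))); [reflexivity |].
    change (psum (fun j : nat => Im (k * c * c ^ j) * (t ^ j / INR (fact j))) (S n)) with
      (psum (fun j : nat => Im (k * c * c ^ j) * (t ^ j / INR (fact j))) n
        + Im (k * c * c ^ n) * (t ^ n / INR (fact n))).
    apply is_derive_plus_R; [exact IH |].
    replace (k * c * c ^ n)%C with (k * c ^ S n)%C by (simpl; ring).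
    generalize (Im (k * c ^ S n)%C); intro v.
    rewrite fact_simpl, mult_INR.
    assert (HS : INR (S n) <> 0) by (apply not_0_INR; lia).
    assert (HF : INR (fact n) <> 0) by apply INR_fact_neq_0.
    auto_derive; [exact I |]. req. 
    change (match n with 0%nat => 1 | S _ => INR n + 1 end) with (INR (S n)).
    simpl Nat.pred. field. auto.
Qed.

Lemma etay_0 (k c : C) (n : nat) : etay k c (S n) 0 = Im k.
Proof.
  unfold etay. induction n as [|n IH].
  - rewrite psum_S. replace (k * c ^ 0)%C with k by (simpl; ring).
    generalize (Im k); intro v. simpl. field.
  - change (psum (fun j => Im (k * c ^ j)%C * (0 ^ j / INR (fact j))) (S n)
      + Im (k * c ^ S n)%C * (0 ^ S n / INR (fact (S n))) = Im k).
    rewrite IH, pow_i by lia. unfold Rdiv. ring.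
Qed.

Lemma cder_exp_line (k c : C) (t : R) : cder (fun s => k * Cexp (s * c))%C t (k * c * Cexp (t * c))%C.
Proof.
  eapply cder_ext; [intro; reflexivity | | apply cder_scal, cder_Cexp].
  2: eapply cder_ext with (f := fun s : R => (0 + s * c)%C);
       [intro; ring | reflexivity | apply cder_line].
  simpl. ring.
Qed.

Lemma Im_exp_bound (k c : C) (t : R) : 0 <= t -> Rabs (Im (k * Cexp (t * c))%C) <= Cmod k * exp (Cmod c * t).
Proof.
  intro Ht. eapply Rle_trans; [apply Im_le_Cmod |]. rewrite Cmod_mult, Cmod_Cexp.
  apply Rmult_le_compat_l; [apply Cmod_ge_0 |]. apply exp_le. reim.
  generalize (Re_le_Cmod c), (Rle_abs (Re c)); nra.
Qed.

Lemma etay_bound (n : nat) : forall (k c : C) (T t : R), 0 <= t <= T ->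
  Rabs (Im (k * Cexp (t * c))%C - etay k c n t) <= Cmod k * Cmod c ^ n * exp (Cmod c * T) * (t ^ n / INR (fact n)).
Proof.
  induction n as [|n IH]; intros k c T t Ht.
  - unfold etay; simpl. change (fact 0) with 1%nat. rewrite Rminus_0_r. simpl INR.
    eapply Rle_trans; [apply Im_exp_bound; lra |].
    replace (Cmod k * 1 * exp (Cmod c * T) * (1 / 1)) with (Cmod k * exp (Cmod c * T)) by field.
    apply Rmult_le_compat_l; [apply Cmod_ge_0 |]. apply exp_le, Rmult_le_compat_l; [apply Cmod_ge_0 | lra].
  - set (K := Cmod k * Cmod c ^ S n * exp (Cmod c * T)).
    set (g := fun s : R => Im (k * Cexp (s * c))%C - etay k c (S n) s).
    set (dg := fun s : R => Im (k * c * Cexp (s * c))%C - etay (k * c)%C c n s).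
    assert (Dg : forall s, is_derive g s (dg s)).
    { intro s. apply is_derive_minus_R; [apply cder_exp_line | apply etay_derive]. }
    assert (Bg : forall s, 0 <= s <= T -> Rabs (dg s) <= K * (s ^ n / INR (fact n))).
    { intros s Hs. eapply Rle_trans; [apply (IH (k * c)%C c T s Hs) |].
      right. unfold K. rewrite Cmod_mult. simpl. ring. }
    assert (G0 : g 0 = 0).
    { unfold g. rewrite etay_0. replace (0 * c)%C with (RtoC 0) by ring. rewrite Cexp_0. reim. ring. }
    assert (DP : forall s, is_derive (fun s => K * (s ^ S n / INR (fact (S n)))) s (K * (s ^ n / INR (fact n)))).
    { intro s. rewrite fact_simpl, mult_INR.
      assert (HS : INR (S n) <> 0) by (apply not_0_INR; lia).
      assert (HF : INR (fact n) <> 0) by apply INR_fact_neq_0.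
      auto_derive; [exact I |]. req.
      change (match n with 0%nat => 1 | S _ => INR n + 1 end) with (INR (S n)).
      simpl Nat.pred. field. auto. }
    assert (Z : K * (0 ^ S n / INR (fact (S n))) = 0) by (rewrite pow_i by lia; unfold Rdiv; ring).
    apply Rabs_le. fold (g t). split.
    + assert (H := mvt_le (fun s => K * (s ^ S n / INR (fact (S n))) + g s)
               (fun s => K * (s ^ n / INR (fact n)) + dg s) 0 t (proj1 Ht)).
      cbv beta in H. rewrite Z, G0 in H. enough (0 + 0 <= K * (t ^ S n / INR (fact (S n))) + g t) by lra.
      apply H; intros s Hs; [now apply is_derive_plus_R |].
      generalize (Bg s ltac:(lra)), (Rle_abs (- dg s)). rewrite Rabs_Ropp. lra.
    + assert (H := mvt_le (fun s => K * (s ^ S n / INR (fact (S n))) - g s)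
               (fun s => K * (s ^ n / INR (fact n)) - dg s) 0 t (proj1 Ht)).
      cbv beta in H. rewrite Z, G0 in H. enough (0 - 0 <= K * (t ^ S n / INR (fact (S n))) - g t) by lra.
      apply H; intros s Hs; [now apply is_derive_minus_R |].
      generalize (Bg s ltac:(lra)), (Rle_abs (dg s)). lra.
Qed.

(** * Airy-type integrals *)

(** The imaginary part of [k] times the integral of [exp (- T^3/3 + c T)] over [[0, r]]. *)
Definition J (k c : C) (r : R) : R := RInt (fun T => exp (- (T ^ 3 / 3)) * Im (k * Cexp (T * c))%C) 0 r.

Lemma cont_J (k c : C) (x : R) : continuous (fun T => exp (- (T ^ 3 / 3)) * Im (k * Cexp (T * c))%C) x.
Proof.
  apply (@continuous_mult R_UniformSpace R_AbsRing).
  - revert x. apply cont_ex_derive. intro y. auto_derive. exact I.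
  - exact (proj2 (cder_ccont _ _ _ (cder_exp_line k c x))).
Qed.

(** For [i = 0] and [i = 1] these are the terms of [airy_f] and of [airy_g] divided by [X]; the case
    [i = 2] belongs to a Scorer function and cancels in the end. *)
Definition airy_coef (i j : nat) (X : R) : R :=
  3 ^ j * rising ((INR i + 1) / 3) j * X ^ (3 * j) / INR (fact (i + 3 * j)).

Lemma rising_pos (a : R) (j : nat) : 0 < a -> 0 < rising a j.
Proof.
  intro Ha. induction j as [|j IH]; simpl; [lra |]. apply Rmult_lt_0_compat; [exact IH |].
  generalize (pos_INR j); lra.
Qed.

(** [(3 j + i)!] contains, besides the factors of [3^j rising ((i + 1) / 3) j], two more factors in
    each block of three. *)
Lemma rising_fact_bound (i j : nat) : (i <= 2)%nat ->
  3 ^ j * rising ((INR i + 1) / 3) j / INR (fact (i + 3 * j)) <= / INR (fact j).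
Proof.
  intro Hi. assert (Hi' : 0 <= INR i <= 2).
  { split; [apply pos_INR |]. apply le_INR in Hi. simpl in Hi. lra. }
  induction j as [|j IH].
  - simpl (3 ^ 0 * _). rewrite Nat.mul_0_r, Nat.add_0_r. change (fact 0) with 1%nat. simpl INR at 2.
    assert (1 <= INR (fact i)) by (change 1 with (INR 1); apply le_INR; generalize (lt_O_fact i); lia).
    unfold Rdiv. rewrite !Rmult_1_l. apply Rinv_le_contravar; lra.
  - assert (HF : 0 < INR (fact (i + 3 * j))) by apply INR_fact_lt_0.
    assert (HFj : 0 < INR (fact j)) by apply INR_fact_lt_0.
    replace (i + 3 * S j)%nat with (S (S (S (i + 3 * j)))) by lia.
    rewrite !fact_simpl, !mult_INR, !S_INR, plus_INR, mult_INR.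
    simpl (INR 3). assert (Hj := pos_INR j).
    set (n := INR i + (1 + 1 + 1) * INR j).
    assert (Hn : 0 <= n) by (unfold n; lra).
    change (3 ^ S j * rising ((INR i + 1) / 3) (S j)) with
      (3 * 3 ^ j * (rising ((INR i + 1) / 3) j * ((INR i + 1) / 3 + INR j))).
    replace (_ / _) with ((3 ^ j * rising ((INR i + 1) / 3) j / INR (fact (i + 3 * j)))
      * (3 * ((INR i + 1) / 3 + INR j) / ((n + 1 + 1 + 1) * (n + 1 + 1) * (n + 1))))
      by (field; lra).
    rewrite Rinv_mult, Rmult_comm.
    apply Rmult_le_compat.
    + apply Rmult_le_pos; [lra |]. left. apply Rinv_0_lt_compat. repeat apply Rmult_lt_0_compat; lra.
    + apply Rmult_le_pos; [| left; now apply Rinv_0_lt_compat].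
      apply Rmult_le_pos; [apply pow_le; lra | left; apply rising_pos; lra].
    + replace (3 * ((INR i + 1) / 3 + INR j)) with (n + 1) by (unfold n; field).
      replace ((n + 1) / ((n + 1 + 1 + 1) * (n + 1 + 1) * (n + 1))) with (/ ((n + 3) * (n + 2))) by (field; lra).
      apply Rinv_le_contravar; [lra |]. assert (INR j <= n) by (unfold n; lra). nra.
    + exact IH.
Qed.

Lemma ex_series_airy (i : nat) (X : R) : (i <= 2)%nat -> ex_series (fun j => airy_coef i j X).
Proof.
  intro Hi. apply (@ex_series_le R_AbsRing R_CompleteNormedModule _ (fun j => / INR (fact j) * (Rabs X ^ 3) ^ j)).
  - intro j. change (Rabs (airy_coef i j X) <= / INR (fact j) * (Rabs X ^ 3) ^ j).
    unfold airy_coef. replace (3 ^ j * rising ((INR i + 1) / 3) j * X ^ (3 * j) / INR (fact (i + 3 * j)))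
      with (3 ^ j * rising ((INR i + 1) / 3) j / INR (fact (i + 3 * j)) * X ^ (3 * j))
      by (field; apply INR_fact_neq_0).
    rewrite Rabs_mult, <- RPow_abs, pow_mult.
    apply Rmult_le_compat_r; [apply pow_le, pow_le, Rabs_pos |].
    rewrite Rabs_pos_eq; [now apply rising_fact_bound |].
    apply Rmult_le_pos; [apply Rmult_le_pos; [apply pow_le; lra | left; apply rising_pos] |].
    + generalize (pos_INR i); lra.
    + left; apply Rinv_0_lt_compat, INR_fact_lt_0.
  - exists (exp (Rabs X ^ 3)). exact (proj1 (is_pseries_R _ _ _) (is_exp_Reals (Rabs X ^ 3))).
Qed.

Lemma J_tail (A : R) : exists K, 0 < K /\ forall (k c : C) r s, Cmod c <= A -> 0 <= r <= s ->
  Rabs (J k c s - J k c r) <= Cmod k * K * exp (- r).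
Proof.
  destruct (exp_cubic_bound (/ 3) A) as [K [HK H]]; [lra |]. exists K. split; [exact HK |].
  intros k c r s Hc Hrs.
  assert (E : J k c s - J k c r = RInt (fun T => exp (- (T ^ 3 / 3)) * Im (k * Cexp (T * c))%C) r s).
  { unfold J. rewrite <- (RInt_Chasles_R _ 0 r s) by apply ex_RInt_cont, cont_J.
    unfold plus; simpl; ring. }
  rewrite E.
  eapply Rle_trans; [apply (RInt_exp_bound _ (Cmod k * K)); [lra | apply ex_RInt_cont, cont_J |] |].
  - intros T HT. rewrite Rabs_mult, (Rabs_pos_eq (exp _)) by (left; apply exp_pos).
    eapply Rle_trans; [apply Rmult_le_compat_l; [left; apply exp_pos | apply Im_exp_bound; lra] |].
    specialize (H T (Cmod c) ltac:(lra) Hc).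
    replace (- (/ 3 * T ^ 3) + Cmod c * T) with (- (T ^ 3 / 3) + Cmod c * T) in H by field.
    rewrite exp_plus in H. generalize (Cmod_ge_0 k); nra.
  - assert (0 <= Cmod k * K) by (generalize (Cmod_ge_0 k); nra).
    generalize (exp_pos (- s)); nra.
Qed.

(** The remainder of the exponential series is [(|c| T)^n / n!] up to exponentials, and
    [(2 |c| T)^n / n! <= exp (2 |c| T)] leaves a factor [2^(-n)]. *)
Lemma J_taylor (c : C) : exists K, 0 < K /\ forall k n r, 0 <= r ->
  Rabs (J k c r - psum (fun j => Im (k * c ^ j)%C / INR (fact j) * mom j r) n) <= Cmod k * K * (/ 2) ^ n.
Proof.
  destruct (exp_cubic_bound (/ 3) (3 * Cmod c)) as [K [HK H]]; [lra |].
  exists K. split; [exact HK |]. intros k n r Hr.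
  assert (Ce : forall x, continuous (fun T => exp (- (T ^ 3 / 3)) * etay k c n T) x).
  { intro x. apply (@continuous_mult R_UniformSpace R_AbsRing).
    - revert x. apply cont_ex_derive. intro y. auto_derive. exact I.
    - destruct n as [|n]; [apply continuous_const |]. 
      apply derive_cont_R. eexists. apply etay_derive. }
  assert (Es : RInt (fun T => exp (- (T ^ 3 / 3)) * etay k c n T) 0 r =
    psum (fun j => Im (k * c ^ j)%C / INR (fact j) * mom j r) n).
  { clear Ce. unfold etay. apply is_RInt_unique. induction n as [|n IH].
    - simpl. apply (is_RInt_ext (fun _ => 0)); [intros; req; ring |].
      assert (E := @is_RInt_const R_NormedModule 0 r 0).
      change (is_RInt (fun _ : R => 0) 0 r ((r - 0) * 0)) in E. rewrite Rmult_0_r in E. exact E.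
    - simpl psum. apply (is_RInt_ext (fun T => plus
        (exp (- (T ^ 3 / 3)) * psum (fun j => Im (k * c ^ j)%C * (T ^ j / INR (fact j))) n)
        (scal (Im (k * c ^ n)%C / INR (fact n)) (T ^ n * exp (- (T ^ 3 / 3)))))).
      + intros T _. unfold plus, scal; simpl. unfold mult; simpl. field. apply INR_fact_neq_0.
      + apply is_RInt_plus_R; [exact IH |].
        apply is_RInt_scal_R. apply RInt_correct_R, ex_RInt_cont, cont_mom. }
  rewrite <- Es. unfold J.
  assert (Ed : RInt (fun T => exp (- (T ^ 3 / 3)) * Im (k * Cexp (T * c))%C) 0 r - RInt (fun T => exp (- (T ^ 3 / 3)) * etay k c n T) 0 r
    = RInt (fun T => exp (- (T ^ 3 / 3)) * (Im (k * Cexp (T * c))%C - etay k c n T)) 0 r).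
  { symmetry. apply is_RInt_unique.
    apply (is_RInt_ext (fun T => minus (exp (- (T ^ 3 / 3)) * Im (k * Cexp (T * c))%C) (exp (- (T ^ 3 / 3)) * etay k c n T))).
    - intros T _. unfold minus, plus, opp; simpl. ring.
    - apply is_RInt_minus_R; apply RInt_correct_R, ex_RInt_cont;
        [apply cont_J | exact Ce]. }
  rewrite Ed.
  eapply Rle_trans; [apply (RInt_exp_bound _ (Cmod k * (/ 2) ^ n * K)); [exact Hr | |] |].
  - apply ex_RInt_cont. intro x.
    apply (continuous_ext (fun T => minus (exp (- (T ^ 3 / 3)) * Im (k * Cexp (T * c))%C) (exp (- (T ^ 3 / 3)) * etay k c n T))).
    + intros T. unfold minus, plus, opp; simpl. ring.
    + apply (@continuous_minus R_UniformSpace R_AbsRing R_NormedModule); [apply cont_J | apply Ce].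
  - intros T HT. rewrite Rabs_mult, (Rabs_pos_eq (exp _)) by (left; apply exp_pos).
    eapply Rle_trans; [apply Rmult_le_compat_l; [left; apply exp_pos | apply (etay_bound n k c T T); lra] |].
    assert (H1 := exp_taylor_term (2 * Cmod c * T) n ltac:(generalize (Cmod_ge_0 c); nra)).
    specialize (H T (3 * Cmod c) ltac:(lra) (Rle_refl _)).
    replace (- (/ 3 * T ^ 3) + 3 * Cmod c * T) with (- (T ^ 3 / 3) + (Cmod c * T + 2 * Cmod c * T)) in H by field.
    rewrite !exp_plus in H.
    replace (exp (- (T ^ 3 / 3)) * (Cmod k * Cmod c ^ n * exp (Cmod c * T) * (T ^ n / INR (fact n)))) with
      (Cmod k * (/ 2) ^ n * (exp (- (T ^ 3 / 3)) * (exp (Cmod c * T) * ((2 * Cmod c * T) ^ n / INR (fact n))))).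
    + rewrite Rmult_assoc with (r1 := Cmod k * (/ 2) ^ n) (r2 := K).
      apply Rmult_le_compat_l; [apply Rmult_le_pos; [apply Cmod_ge_0 | apply pow_le; lra] |].
      eapply Rle_trans; [| exact H].
      apply Rmult_le_compat_l; [left; apply exp_pos |].
      apply Rmult_le_compat_l; [left; apply exp_pos | exact H1].
    + rewrite !Rpow_mult_distr. assert (E2 : (/ 2) ^ n * 2 ^ n = 1) by (rewrite <- Rpow_mult_distr, Rinv_l, pow1; lra).
      replace (2 ^ n * Cmod c ^ n * T ^ n / INR (fact n)) with (2 ^ n * (Cmod c ^ n * (T ^ n / INR (fact n)))) by (field; apply INR_fact_neq_0).
      transitivity ((/ 2) ^ n * 2 ^ n * (exp (- (T ^ 3 / 3)) * (Cmod k * Cmod c ^ n * exp (Cmod c * T) * (T ^ n / INR (fact n))))); [ring | rewrite E2; ring].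
  - rewrite Ropp_0, exp_0.
    assert (0 <= Cmod k * (/ 2) ^ n * K).
    { apply Rmult_le_pos; [apply Rmult_le_pos; [apply Cmod_ge_0 | apply pow_le; lra] | lra]. }
    generalize (exp_pos (- r)); nra.
Qed.

Lemma psum_lim (a : nat -> R) (F : nat -> R -> R) (l : nat -> R) n :
  (forall j, lim_infty (F j) (l j)) -> lim_infty (fun r => psum (fun j => a j * F j r) n) (psum (fun j => a j * l j) n).
Proof.
  intro H. induction n as [|n IH]; simpl; [apply lim_infty_const |].
  apply lim_infty_plus; [exact IH | now apply lim_infty_scal].
Qed.

Definition airy_sum (i : nat) (X : R) : R := Series (fun j => airy_coef i j X).

Lemma is_lim_psum (f : nat -> R) : ex_series f -> is_lim_seq (psum f) (Series f).
Proof.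
  intro H. apply Series_correct in H. apply is_lim_seq_incr_1.
  apply (is_lim_seq_ext (sum_n f)); [intro; symmetry; apply psum_sum_n | exact H].
Qed.

(** Integrating the exponential series of [exp (c T)] term by term; when [c ^ 3] is real the
    sum splits into three real series according to the exponent modulo 3. *)
Lemma J_lim (k c : C) (X : R) (M : nat -> R) : (c * (c * c) = X ^ 3)%C ->
  (forall i, lim_infty (mom i) (M i)) ->
  lim_infty (J k c) (Im k * M 0%nat * airy_sum 0 X + Im (k * c)%C * M 1%nat * airy_sum 1 X
    + Im (k * (c * c))%C * M 2%nat * airy_sum 2 X).
Proof.
  intros Hc HM e He.
  destruct (J_taylor c) as [K [HK Ht]].
  set (L := Im k * M 0%nat * airy_sum 0 X + _ + _).
  set (f := fun j => Im (k * c ^ j)%C / INR (fact j) * M j).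
  assert (EM : forall i j, M (i + 3 * j)%nat = 3 ^ j * rising ((INR i + 1) / 3) j * M i).
  { intros i j. apply (lim_infty_unique (mom (i + 3 * j))); [apply HM | now apply mom_lim_rising]. }
  assert (Ef : forall i j, f (i + 3 * j)%nat = Im (k * c ^ i)%C * M i * airy_coef i j X).
  { intros i j. unfold f. rewrite EM.
    replace (c ^ (i + 3 * j))%C with (c ^ i * (X ^ (3 * j))%R)%C.
    - unfold airy_coef. replace (k * (c ^ i * (X ^ (3 * j))%R))%C with ((X ^ (3 * j))%R * (k * c ^ i))%C by ring.
      rewrite im_scal_l. field. apply INR_fact_neq_0.
    - rewrite Cpow_add_r, Cpow_mult_r. f_equal. rewrite pow_mult, RtoC_pow, RtoC_pow, <- Hc. f_equal. ring. }
  assert (El : is_lim_seq (fun n => psum f (3 * n)) L).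
  { apply (is_lim_seq_ext (fun n => Im (k * c ^ 0)%C * M 0%nat * psum (fun j => airy_coef 0 j X) n
      + Im (k * c ^ 1)%C * M 1%nat * psum (fun j => airy_coef 1 j X) n
      + Im (k * c ^ 2)%C * M 2%nat * psum (fun j => airy_coef 2 j X) n)).
    - intro n. rewrite psum_3, <- !psum_scal. f_equal; [f_equal |]; apply psum_ext; intros j _; symmetry.
      + exact (Ef 0%nat j).
      + exact (Ef 1%nat j).
      + exact (Ef 2%nat j).
    - replace L with (Im (k * c ^ 0)%C * M 0%nat * airy_sum 0 X + Im (k * c ^ 1)%C * M 1%nat * airy_sum 1 X
        + Im (k * c ^ 2)%C * M 2%nat * airy_sum 2 X).
      + apply is_lim_seq_plus'; [apply is_lim_seq_plus' |];
          apply (is_lim_seq_scal_l _ _ (Finite _)); apply is_lim_psum, ex_series_airy; lia.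
      + unfold L. replace (k * c ^ 0)%C with k by (simpl; ring).
        replace (k * c ^ 1)%C with (k * c)%C by (simpl; ring).
        replace (k * c ^ 2)%C with (k * (c * c))%C by (simpl; ring). reflexivity. }
  assert (Eg : is_lim_seq (fun n => Cmod k * K * (/ 2) ^ (3 * n)) 0).
  { replace (Finite 0) with (Rbar_mult (Cmod k * K) 0) by (simpl; f_equal; ring).
    apply (is_lim_seq_scal_l _ _ (Finite 0)).
    apply (is_lim_seq_ext (fun n => (/ 8) ^ n)); [intro n; rewrite pow_mult; f_equal; field |].
    apply is_lim_seq_geom. rewrite Rabs_pos_eq; lra. }
  apply is_lim_seq_spec in El. apply is_lim_seq_spec in Eg.
  assert (He3 : 0 < e / 3) by lra.
  destruct (El (mkposreal _ He3)) as [n1 H1]. destruct (Eg (mkposreal _ He3)) as [n2 H2].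
  set (n := Nat.max n1 n2).
  specialize (H1 n (Nat.le_max_l _ _)). specialize (H2 n (Nat.le_max_r _ _)). simpl pos in H1, H2.
  assert (Lp : lim_infty (fun r => psum (fun j => Im (k * c ^ j)%C / INR (fact j) * mom j r) (3 * n)) (psum f (3 * n))).
  { apply psum_lim. exact HM. }
  destruct (Lp (e / 3) He3) as [r0 [Hr0 H3]]. exists r0. split; [exact Hr0 |].
  intros r Hr. specialize (H3 r Hr). specialize (Ht k (3 * n)%nat r ltac:(lra)).
  set (P := psum (fun j => Im (k * c ^ j)%C / INR (fact j) * mom j r) (3 * n)) in *.
  rewrite Rminus_0_r in H2. apply Rabs_def2 in H2.
  replace (J k c r - L) with ((J k c r - P) + ((P - psum f (3 * n)) + (psum f (3 * n) - L))) by ring.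
  eapply Rle_lt_trans; [apply Rabs_triang |].
  assert (T2 := Rabs_triang (P - psum f (3 * n)) (psum f (3 * n) - L)). lra.
Qed.

(** * The product of the first two moments *)

Lemma is_derive_mom (k : nat) (x : R) : is_derive (mom k) x (x ^ k * exp (- (x ^ 3 / 3))).
Proof.
  apply (is_derive_RInt (fun T => T ^ k * exp (- (T ^ 3 / 3))) (mom k) 0 x); [| apply cont_mom].
  exists (mkposreal 1 Rlt_0_1). intros y _.
  apply RInt_correct_R, ex_RInt_cont, cont_mom.
Qed.

Lemma mom_scale (k : nat) (x : R) : mom k x = RInt (fun u => x * ((x * u) ^ k * exp (- ((x * u) ^ 3 / 3)))) 0 1.
Proof.
  unfold mom. symmetry.
  assert (E := @RInt_comp_lin R_CompleteNormedModule (fun T => T ^ k * exp (- (T ^ 3 / 3))) x 0 0 1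
    ltac:(apply ex_RInt_cont, cont_mom)).
  rewrite Rmult_0_r, Rmult_1_r, !Rplus_0_r in E. rewrite <- E.
  apply RInt_ext. intros u _. unfold scal; simpl. unfold mult; simpl. now rewrite !Rplus_0_r.
Qed.

(** The function that, added to the product of the two moments over [[0, x]], makes it constant. *)
Definition mom_corr (x : R) : R :=
  RInt (fun u => (1 + u) / (1 + u ^ 3) * exp (- (x ^ 3 * (1 + u ^ 3) / 3))) 0 1.

Lemma cube_pos (u : R) : 0 <= u -> 0 < 1 + u ^ 3.
Proof. intro H. generalize (pow_le u 3 H); lra. Qed.

Lemma is_derive_mom_corr (x : R) : is_derive mom_corr x
  (RInt (fun u => - ((1 + u) * x ^ 2 * exp (- (x ^ 3 * (1 + u ^ 3) / 3)))) 0 1).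
Proof.
  apply (is_derive_RInt_01 (fun x u => (1 + u) / (1 + u ^ 3) * exp (- (x ^ 3 * (1 + u ^ 3) / 3)))
    (fun x u => - ((1 + u) * x ^ 2 * exp (- (x ^ 3 * (1 + u ^ 3) / 3)))) x 1); [lra | | |].
  - intros s t _ Ht. assert (H := cube_pos t ltac:(lra)).
    auto_derive; [exact I |]. req. unfold Rdiv. simpl. simpl in H. field. lra.
  - intros t Ht.
    assert (F : continuous (fun v : R * R => fst v) (x, t)) by apply continuous_fst.
    assert (S : continuous (fun v : R * R => snd v) (x, t)) by apply continuous_snd.
    assert (K : forall (h : R * R -> R), continuous h (x, t) -> forall n, continuous (fun v => h v ^ n) (x, t)).
    { intros h Hh n. apply (continuous_Rcomp (fun y => y ^ n) h); [exact Hh | auto_derive; exact I]. }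
    set (TT := prod_UniformSpace R_UniformSpace R_UniformSpace).
    assert (Mu : forall f g : R * R -> R, continuous f (x, t) -> continuous g (x, t) -> continuous (fun v => f v * g v) (x, t))
      by (intros; now apply (@continuous_mult TT R_AbsRing)).
    assert (Pl : forall f g : R * R -> R, continuous f (x, t) -> continuous g (x, t) -> continuous (fun v => f v + g v) (x, t))
      by (intros; now apply (@continuous_plus TT R_AbsRing R_NormedModule)).
    assert (Op : forall f : R * R -> R, continuous f (x, t) -> continuous (fun v => - f v) (x, t))
      by (intros; now apply (@continuous_opp TT R_AbsRing R_NormedModule)).
    assert (Co : forall k : R, continuous (fun _ : R * R => k) (x, t)) by (intro; apply continuous_const).
    apply Op, Mu; [apply Mu; [apply Pl; auto | now apply K] |].
    apply (continuous_Rcomp exp (fun v : R * R => - (fst v ^ 3 * (1 + snd v ^ 3) / 3)));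
      [| auto_derive; exact I].
    apply Op, Mu; [| auto]. apply Mu; [now apply K |]. apply Pl; [auto | now apply K].
  - intros s _. apply ex_RInt_01. intros t Ht. assert (H := cube_pos t ltac:(lra)).
    apply derive_cont_R. auto_derive. simpl in H. lra.
Qed.

(** The derivative of [int_0^x exp(-t^3/3) dt * int_0^x s exp(-s^3/3) ds], with both integrals
    rescaled to [[0, 1]], is an exact derivative of an integral over [[0, 1]]. *)
Lemma mom_product_const (x : R) : mom 0 x * mom 1 x + mom_corr x = mom_corr 0.
Proof.
  assert (D : forall y, is_derive (fun x => mom 0 x * mom 1 x + mom_corr x) y 0).
  { intro y.
    assert (E : y ^ 0 * exp (- (y ^ 3 / 3)) * mom 1 y + mom 0 y * (y ^ 1 * exp (- (y ^ 3 / 3)))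
      + RInt (fun u => - ((1 + u) * y ^ 2 * exp (- (y ^ 3 * (1 + u ^ 3) / 3)))) 0 1 = 0).
    { rewrite (mom_scale 1 y), (mom_scale 0 y).
      assert (C0 : ex_RInt (fun u => y * ((y * u) ^ 0 * exp (- ((y * u) ^ 3 / 3)))) 0 1)
        by (apply ex_RInt_cont, cont_ex_derive; intro; auto_derive; exact I).
      assert (C1 : ex_RInt (fun u => y * ((y * u) ^ 1 * exp (- ((y * u) ^ 3 / 3)))) 0 1)
        by (apply ex_RInt_cont, cont_ex_derive; intro; auto_derive; exact I).
      assert (C2 : ex_RInt (fun u => - ((1 + u) * y ^ 2 * exp (- (y ^ 3 * (1 + u ^ 3) / 3)))) 0 1)
        by (apply ex_RInt_cont, cont_ex_derive; intro; auto_derive; exact I).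
      set (e := exp (- (y ^ 3 / 3))).
      assert (I3 := @is_RInt_plus R_NormedModule _ _ _ _ _ _
        (is_RInt_plus_R _ _ _ _ _ _
          (is_RInt_scal_R _ 0 1 e _ (RInt_correct_R _ _ _ C1))
          (is_RInt_scal_R _ 0 1 (y * e) _ (RInt_correct_R _ _ _ C0)))
        (RInt_correct_R _ _ _ C2)).
      assert (Z : is_RInt (fun _ : R => 0) 0 1 0).
      { assert (Z := @is_RInt_const R_NormedModule 0 1 0).
        change (is_RInt (fun _ : R => 0) 0 1 ((1 - 0) * 0)) in Z. rewrite Rmult_0_r in Z. exact Z. }
      apply (is_RInt_ext _ (fun _ => 0)) in I3.
      - apply is_RInt_unique_R in Z. apply is_RInt_unique_R in I3.
        rewrite Z in I3. symmetry. etransitivity; [exact I3 |]. req. unfold plus, scal; simpl. unfold mult; simpl. fold e. ring.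
      - intros u _. unfold plus, scal; simpl. unfold mult; simpl. unfold e.
        replace (- (y * (y * (y * 1)) * (1 + u * (u * (u * 1))) / 3)) with
          (- (y ^ 3 / 3) + - (y * u * (y * u * (y * u * 1)) / 3)) by field.
        rewrite exp_plus. simpl. ring. }
    rewrite <- E. apply is_derive_plus_R; [| apply is_derive_mom_corr].
    apply is_derive_mult_R; apply is_derive_mom. }
  destruct (MVT_gen (fun x => mom 0 x * mom 1 x + mom_corr x) 0 x (fun _ => 0)) as [c [_ E]].
  - intros; apply D.
  - intros y _. apply continuity_pt_filterlim.
    apply (derive_cont_R (fun x => mom 0 x * mom 1 x + mom_corr x)).
    eexists; apply D.
  - assert (E0 : mom 0 0 = 0) by (exact (@RInt_point R_CompleteNormedModule 0 _)). rewrite E0 in E. lra.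
Qed.

(** Here [(1 + u) / (1 + u^3) = 1 / (1 - u + u^2)] has an arctangent as primitive. *)
Lemma mom_corr_0 : mom_corr 0 = 2 * PI / (3 * sqrt 3).
Proof.
  assert (Hs := sqrt3_bounds). assert (Hss : sqrt 3 * sqrt 3 = 3) by (apply sqrt_sqrt; lra).
  unfold mom_corr.
  transitivity (RInt (fun u => / (1 - u + u ^ 2)) 0 1).
  - apply RInt_ext. intros u Hu. rewrite Rmin_left, Rmax_right in Hu by lra.
    replace (- (0 ^ 3 * (1 + u ^ 3) / 3)) with 0 by field. rewrite exp_0. 
    req. field. simpl. split; [nra |]. assert (H := cube_pos u ltac:(lra)). simpl in H. lra.
  - assert (A1 : atan (/ sqrt 3) = PI / 6).
    { rewrite <- (atan_tan (PI / 6)) by (generalize PI_RGT_0; lra). f_equal. rewrite tan_PI6. field. lra. }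
    replace (2 * PI / (3 * sqrt 3)) with
      (minus (2 / sqrt 3 * atan ((2 * 1 - 1) / sqrt 3)) (2 / sqrt 3 * atan ((2 * 0 - 1) / sqrt 3))).
    + apply is_RInt_unique. apply (is_RInt_derive (fun u => 2 / sqrt 3 * atan ((2 * u - 1) / sqrt 3))).
      * intros u _. auto_derive; [exact I |]. req.
        assert (0 < 1 - u + u * u) by nra.
        transitivity (4 / (sqrt 3 * sqrt 3 + (2 * u - 1) ^ 2)); [field; repeat split; nra |].
        rewrite Hss. field. split; nra.
      * intros u _. apply derive_cont_R. auto_derive. nra.
    + replace ((2 * 1 - 1) / sqrt 3) with (/ sqrt 3) by (field; lra).
      replace ((2 * 0 - 1) / sqrt 3) with (- / sqrt 3) by (field; lra).
      rewrite atan_opp, A1. unfold minus, plus, opp; simpl. field. lra.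
Qed.

(** The reflection formula [Gamma (1/3) Gamma (2/3) = 2 pi / sqrt 3], in terms of moments. *)
Lemma mom_product (M0 M1 : R) : lim_infty (mom 0) M0 -> lim_infty (mom 1) M1 ->
  M0 * M1 = 2 * PI / (3 * sqrt 3).
Proof.
  intros H0 H1. rewrite <- mom_corr_0.
  destruct (exp_cubic_bound (/ 3) 0) as [K [HK HB]]; [lra |].
  assert (L : lim_infty mom_corr 0).
  { apply (lim_infty_squeeze _ (2 * K)). intros x Hx.
    assert (Ex : ex_RInt (fun u => (1 + u) / (1 + u ^ 3) * exp (- (x ^ 3 * (1 + u ^ 3) / 3))) 0 1).
    { apply ex_RInt_01. intros t Ht. assert (H := cube_pos t ltac:(lra)).
      apply derive_cont_R. auto_derive. simpl in H. lra. }
    eapply Rle_trans; [apply (abs_RInt_le_const _ 0 1 (2 * K * exp (- x))); [lra | exact Ex |] | right; ring].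
    intros t Ht. assert (H := cube_pos t ltac:(lra)).
    assert (Ht3 := pow_le t 3 ltac:(lra)). assert (Hx3 := pow_le x 3 Hx).
    assert (Hd : 0 <= (1 + t) / (1 + t ^ 3) <= 2).
    { split; [apply Rmult_le_pos; [lra | left; now apply Rinv_0_lt_compat] |].
      apply (Rmult_le_reg_r (1 + t ^ 3)); [exact H |]. unfold Rdiv. rewrite Rmult_assoc, Rinv_l by lra. lra. }
    rewrite Rabs_pos_eq by (apply Rmult_le_pos; [lra | left; apply exp_pos]).
    rewrite Rmult_assoc. apply Rmult_le_compat; [lra | left; apply exp_pos | lra |].
    specialize (HB x 0 Hx (Rle_refl 0)). eapply Rle_trans; [| exact HB].
    apply exp_le. nra. }
  apply (lim_infty_unique (fun x => mom 0 x * mom 1 x + mom_corr x)).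
  - replace (M0 * M1) with (M0 * M1 + 0) by ring. apply lim_infty_plus; [now apply lim_infty_mult | exact L].
  - apply (lim_infty_ext (fun _ => mom_corr 0)); [intros; now rewrite mom_product_const | apply lim_infty_const].
Qed.

(** * The Gamma function at 1/3 and 2/3 *)

Lemma Rpower_third_cube (y : R) : 0 < y -> Rpower y (/ 3) ^ 3 = y.
Proof.
  intro H. rewrite <- Rpower_pow by apply exp_pos. rewrite Rpower_mult.
  replace (/ 3 * INR 3) with 1 by (simpl; field). now apply Rpower_1.
Qed.

Lemma RInt_gamma_mom (k : nat) (a b : R) : 0 < a -> 0 < b ->
  is_RInt (fun t => Rpower t ((INR k + 1) / 3 - 1) * exp (- t)) (a ^ 3 / 3) (b ^ 3 / 3)
    (Rpower 3 (1 - (INR k + 1) / 3) * (mom k b - mom k a)).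
Proof.
  intros Ha Hb. set (s := (INR k + 1) / 3).
  assert (Hm : forall x, Rmin a b <= x -> 0 < x).
  { intros x Hx. eapply Rlt_le_trans; [| exact Hx]. now apply Rmin_pos. }
  assert (Cf : forall x, 0 < x -> continuous (fun t => Rpower t (s - 1) * exp (- t)) x).
  { intros x Hx. apply derive_cont_R. unfold Rpower. auto_derive. exact Hx. }
  assert (P3 : forall x, 0 < x -> 0 < x ^ 3 / 3) by (intros x Hx; generalize (pow_lt x 3 Hx); lra).
  assert (E := RInt_comp (fun t => Rpower t (s - 1) * exp (- t)) (fun T => T ^ 3 / 3) (fun T => T ^ 2) a b).
  assert (Ex : ex_RInt (fun t => Rpower t (s - 1) * exp (- t)) (a ^ 3 / 3) (b ^ 3 / 3)).
  { apply (@ex_RInt_continuous R_CompleteNormedModule). intros x [Hx _]. apply Cf.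
    eapply Rlt_le_trans; [| exact Hx]. apply Rmin_pos; now apply P3. }
  apply RInt_correct_R in Ex.
  assert (Ev : RInt (fun t => Rpower t (s - 1) * exp (- t)) (a ^ 3 / 3) (b ^ 3 / 3)
     = Rpower 3 (1 - s) * (mom k b - mom k a)); [| rewrite Ev in Ex; exact Ex].
  rewrite <- E; clear E.
  - assert (Ech := mom_Chasles k a b).
    set (v := RInt (fun T => T ^ k * exp (- (T ^ 3 / 3))) a b) in Ech. change R in (type of v).
    replace (mom k b - mom k a) with v by lra. unfold v.
    symmetry. rewrite <- (RInt_scal (V := R_CompleteNormedModule)) by (apply ex_RInt_cont, cont_mom).
    apply RInt_ext. intros x [Hx _]. assert (Hx0 := Hm x ltac:(lra)).
    unfold scal; simpl. unfold mult; simpl.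
    change (x * (x * (x * 1))) with (x ^ 3). change (x * (x * 1)) with (x ^ 2).
    rewrite <- !Rmult_assoc. f_equal.
    rewrite <- (Rpower_pow k x), <- (Rpower_pow 2 x) by exact Hx0.
    unfold Rpower. rewrite <- !exp_plus. f_equal.
    rewrite ln_div by (try apply pow_lt; lra). rewrite ln_pow by exact Hx0.
    unfold s. simpl (INR 3). simpl (INR 2). field.
  - intros x [Hx _]. apply Cf, P3, Hm, Hx.
  - intros x _. split.
    + auto_derive; [exact I |]. req. simpl. field.
    + apply derive_cont_R. auto_derive. exact I.
Qed.

Lemma mom_near_0 (k : nat) (a : R) : 0 <= a <= 1 -> Rabs (mom k a) <= a.
Proof.
  intro Ha. unfold mom.
  eapply Rle_trans; [apply (abs_RInt_le_const _ 0 a 1); [lra | apply ex_RInt_cont, cont_mom |] | lra].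
  intros t Ht. rewrite Rabs_pos_eq by (apply Rmult_le_pos; [apply pow_le; lra | left; apply exp_pos]).
  rewrite <- (Rmult_1_l 1). apply Rmult_le_compat; [apply pow_le; lra | left; apply exp_pos | |].
  - rewrite <- (pow1 k). apply pow_incr. lra.
  - rewrite <- exp_0. apply exp_le. generalize (pow_le t 3 ltac:(lra)). lra.
Qed.

(** Substitution of [t = T^3 / 3]. *)
Lemma Gamma_mom (k : nat) (M : R) : lim_infty (mom k) M ->
  Gamma ((INR k + 1) / 3) = Rpower 3 (1 - (INR k + 1) / 3) * M.
Proof.
  intro HM. set (s := (INR k + 1) / 3). set (A := Rpower 3 (1 - s)).
  assert (HA : 0 < A) by apply exp_pos.
  unfold Gamma. apply is_RInt_gen_unique.
  unfold is_RInt_gen. apply filterlimi_locally. intro e.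
  destruct e as [e He]. simpl.
  assert (Hd : 0 < e / A / 2) by (apply Rdiv_lt_0_compat; [now apply Rdiv_lt_0_compat | lra]).
  destruct (HM _ Hd) as [r0 [Hr0 Hlim]].
  set (d := Rmin 1 (e / A / 2)). assert (Hdp : 0 < d) by (apply Rmin_pos; lra).
  apply Filter_prod with (Q := fun x => 0 < x < d ^ 3 / 3) (R := fun y => Rmax 0 (r0 ^ 3 / 3) < y).
  - assert (Hd3 : 0 < d ^ 3 / 3) by (generalize (pow_lt d 3 Hdp); lra).
    exists (mkposreal _ Hd3). intros y Hy Hy0. split; [exact Hy0 |].
    change (Rabs (y - 0) < d ^ 3 / 3) in Hy. apply Rabs_def2 in Hy. lra.
  - exists (Rmax 0 (r0 ^ 3 / 3)). intros y Hy. exact Hy.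
  - intros x y Hx Hy.
    assert (Hy0 : 0 < y) by (generalize (Rmax_l 0 (r0 ^ 3 / 3)); lra).
    assert (Hyr : r0 ^ 3 / 3 < y) by (generalize (Rmax_r 0 (r0 ^ 3 / 3)); lra).
    set (a := Rpower (3 * x) (/ 3)). set (b := Rpower (3 * y) (/ 3)).
    assert (Ha : 0 < a) by apply exp_pos. assert (Hb : 0 < b) by apply exp_pos.
    assert (Ea : a ^ 3 = 3 * x) by (apply Rpower_third_cube; lra).
    assert (Eb : b ^ 3 = 3 * y) by (apply Rpower_third_cube; lra).
    assert (Had : a < d).
    { apply Rnot_le_lt. intro L. assert (d ^ 3 <= a ^ 3) by (apply pow_incr; lra). lra. }
    assert (Hbr : r0 <= b).
    { apply Rnot_lt_le. intro L. assert (b ^ 3 <= r0 ^ 3) by (apply pow_incr; lra). lra. }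
    exists (A * (mom k b - mom k a)). split.
    + replace x with (a ^ 3 / 3) by lra. replace y with (b ^ 3 / 3) by lra.
      now apply RInt_gamma_mom.
    + change (Rabs (A * (mom k b - mom k a) - A * M) < e).
      assert (H1 := Hlim b Hbr).
      assert (H2 := mom_near_0 k a ltac:(generalize (Rmin_l 1 (e / A / 2)); unfold d in Had; lra)).
      assert (H3 : a < e / A / 2) by (generalize (Rmin_r 1 (e / A / 2)); unfold d in Had; lra).
      replace (A * (mom k b - mom k a) - A * M) with (A * ((mom k b - M) + - mom k a)) by ring.
      rewrite Rabs_mult, (Rabs_pos_eq A) by lra.
      apply Rlt_le_trans with (A * (e / A / 2 + e / A / 2)); [| right; field; lra].
      apply Rmult_lt_compat_l; [exact HA |].
      eapply Rle_lt_trans; [apply Rabs_triang |]. rewrite Rabs_Ropp. lra.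
Qed.

(** * The Airy functions as integrals *)

Lemma airy_f_sum (X : R) : airy_f X = airy_sum 0 X.
Proof.
  apply Series_ext. intro j. unfold airy_coef. simpl (INR 0). rewrite Rplus_0_l. reflexivity.
Qed.

Lemma airy_g_sum (X : R) : airy_g X = X * airy_sum 1 X.
Proof.
  unfold airy_sum. rewrite <- Series_scal_l. apply Series_ext. intro j. unfold airy_coef.
  replace ((INR 1 + 1) / 3) with (2 / 3) by (simpl; field).
  rewrite (Nat.add_comm 1 (3 * j)), pow_add, pow_1. field. apply INR_fact_neq_0.
Qed.

Lemma airy_constants (M0 M1 : R) : lim_infty (mom 0) M0 -> lim_infty (mom 1) M1 ->
  PI * airy_c1 = sqrt 3 / 2 * M0 /\ PI * airy_c2 = sqrt 3 / 2 * M1.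
Proof.
  intros H0 H1. assert (HP := mom_product M0 M1 H0 H1). assert (HPI := PI_RGT_0).
  assert (Hs := sqrt3_bounds). assert (Hss : sqrt 3 * sqrt 3 = 3) by (apply sqrt_sqrt; lra).
  assert (P : 0 < M0 * M1) by (rewrite HP; apply Rdiv_lt_0_compat; lra).
  assert (N0 : M0 <> 0) by (intro E; rewrite E in P; lra).
  assert (N1 : M1 <> 0) by (intro E; rewrite E in P; lra).
  assert (EP : PI = M0 * M1 * 3 * sqrt 3 / 2) by (rewrite HP; field; lra).
  apply Gamma_mom in H0. apply Gamma_mom in H1.
  replace ((INR 0 + 1) / 3) with (1 / 3) in H0 by (simpl; field).
  replace ((INR 1 + 1) / 3) with (2 / 3) in H1 by (simpl; field).
  unfold airy_c1, airy_c2. rewrite H0, H1, EP.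
  assert (E1 : Rpower 3 (- (2 / 3)) = / (3 * / Rpower 3 (1 - 2 / 3))).
  { replace (- (2 / 3)) with (- (1) + (1 - 2 / 3)) by field. rewrite Rpower_plus, Rpower_Ropp, Rpower_1 by lra.
    field. apply Rgt_not_eq, exp_pos. }
  assert (E2 : Rpower 3 (- (1 / 3)) = / (3 * / Rpower 3 (1 - 1 / 3))).
  { replace (- (1 / 3)) with (- (1) + (1 - 1 / 3)) by field. rewrite Rpower_plus, Rpower_Ropp, Rpower_1 by lra.
    field. apply Rgt_not_eq, exp_pos. }
  rewrite E1, E2.
  assert (Q1 : Rpower 3 (1 - 2 / 3) <> 0) by apply Rgt_not_eq, exp_pos.
  assert (Q2 : Rpower 3 (1 - 1 / 3) <> 0) by apply Rgt_not_eq, exp_pos.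
  split; field; auto.
Qed.

Lemma omega_cube : (omega * (omega * omega) = 1)%C.
Proof.
  assert (Hss : sqrt 3 * sqrt 3 = 3) by (apply sqrt_sqrt; lra).
  unfold omega. apply C_ext; reim.
  - apply Rminus_diag_uniq. match goal with |- ?l = 0 => replace l with (3 / 8 * (sqrt 3 * sqrt 3 - 3)) by field end.
    rewrite Hss. ring.
  - match goal with |- ?l = 0 => replace l with (sqrt 3 / 8 * (3 - sqrt 3 * sqrt 3)) by field end.
    rewrite Hss. ring.
Qed.

(** [Ai X] and [Bi X] are the classical combinations of the integrals along the rays of arguments
    [0] and [2 pi / 3]; the third series, of the exponents [2] modulo [3], cancels since
    [omega^3 = 1]. *)
Lemma J_airy (k : C) (X : R) :
  lim_infty (fun r => J (k * omega)%C (X * omega)%C r - J k X r) (PI * (Re k * Ai X - Im k * Bi X)).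
Proof.
  destruct (mom_lim 0) as [M0 H0]. destruct (mom_lim 1) as [M1 H1]. destruct (mom_lim 2) as [M2 H2].
  destruct (airy_constants M0 M1 H0 H1) as [C1 C2].
  assert (HM : exists M : nat -> R, (forall i, lim_infty (mom i) (M i)) /\ M 0%nat = M0 /\ M 1%nat = M1 /\ M 2%nat = M2).
  { exists (fun i => proj1_sig (constructive_indefinite_description _ (mom_lim i))).
    assert (HM : forall i, lim_infty (mom i) (proj1_sig (constructive_indefinite_description _ (mom_lim i)))).
    { intro i. apply proj2_sig. }
    split; [exact HM |].
    split; [| split]; eapply lim_infty_unique; try apply HM; assumption. }
  destruct HM as [M [HM [E0 [E1 E2]]]].
  assert (Hss : sqrt 3 * sqrt 3 = 3) by (apply sqrt_sqrt; lra).
  assert (HX : ((X * omega) * ((X * omega) * (X * omega)) = X ^ 3)%C).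
  { transitivity (X ^ 3 * (omega * (omega * omega)))%C; [simpl; ring | rewrite omega_cube; ring]. }
  assert (HX1 : (X * (X * X) = X ^ 3)%C) by (simpl; ring).
  assert (L1 := J_lim (k * omega)%C (X * omega)%C X M HX HM).
  assert (L2 := lim_infty_scal (-1) _ _ (J_lim k X X M HX1 HM)).
  assert (L := lim_infty_plus _ _ _ _ L1 L2).
  replace (PI * (Re k * Ai X - Im k * Bi X)) with
   (Im (k * omega)%C * M 0%nat * airy_sum 0 X + Im (k * omega * (X * omega))%C * M 1%nat * airy_sum 1 X +
     Im (k * omega * (X * omega * (X * omega)))%C * M 2%nat * airy_sum 2 X +
     -1 * (Im k * M 0%nat * airy_sum 0 X + Im (k * X)%C * M 1%nat * airy_sum 1 X + Im (k * (X * X))%C * M 2%nat * airy_sum 2 X)).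
  - eapply lim_infty_ext; [| exact L]. intros r _. simpl. ring.
  - rewrite E0, E1. unfold Ai, Bi. rewrite airy_f_sum, airy_g_sum.
    replace (k * omega * (X * omega * (X * omega)))%C with ((X * X)%R * k)%C
      by (rewrite RtoC_mult; transitivity (X * X * k * (omega * (omega * omega)))%C; [rewrite omega_cube; ring | ring]).
    replace (PI * (Re k * (airy_c1 * airy_sum 0 X - airy_c2 * (X * airy_sum 1 X)) -
       Im k * (sqrt 3 * (airy_c1 * airy_sum 0 X + airy_c2 * (X * airy_sum 1 X)))))
     with (Re k * ((PI * airy_c1) * airy_sum 0 X - (PI * airy_c2) * (X * airy_sum 1 X))
       - Im k * (sqrt 3 * ((PI * airy_c1) * airy_sum 0 X + (PI * airy_c2) * (X * airy_sum 1 X)))) by ring.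
    rewrite C1, C2.
    replace (Im k * (sqrt 3 * (sqrt 3 / 2 * M0 * airy_sum 0 X + sqrt 3 / 2 * M1 * (X * airy_sum 1 X))))
     with (Im k * (sqrt 3 * sqrt 3 / 2 * (M0 * airy_sum 0 X + M1 * (X * airy_sum 1 X)))) by field.
    rewrite Hss. unfold omega. reim.
    replace (Re k * (sqrt 3 / 2) + Im k * - (1 / 2)) with (Re k * sqrt 3 / 2 - Im k / 2) by field.
    generalize (airy_sum 0 X) (airy_sum 1 X) (airy_sum 2 X); intros s0 s1 s2.
    apply Rminus_diag_uniq.
    match goal with |- ?l = 0 => replace l with (Im k * M1 * X * s1 / 4 * (3 - sqrt 3 * sqrt 3)) by field end.
    rewrite Hss. ring.
Qed.

(** * Estimates for the complex exponential *)

(** Applied to both components, hence the factor 2. *)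
Lemma cder_mvt (f df : R -> C) (T K : R) : 0 <= T ->
  (forall s, 0 <= s <= T -> cder f s (df s)) -> (forall s, 0 <= s <= T -> Cmod (df s) <= K) ->
  Cmod (f T - f 0) <= 2 * K * T.
Proof.
  intros HT Hd HK. eapply Rle_trans; [apply Cmod_le_abs |]. reim.
  assert (H1 : Rabs (Re (f T) - Re (f 0)) <= K * T).
  { apply (mvt_abs (fun s => Re (f s)) (fun s => Re (df s))); [exact HT | |].
    - intros s Hs. apply Hd, Hs.
    - intros s Hs. eapply Rle_trans; [apply Re_le_Cmod | now apply HK]. }
  assert (H2 : Rabs (Im (f T) - Im (f 0)) <= K * T).
  { apply (mvt_abs (fun s => Im (f s)) (fun s => Im (df s))); [exact HT | |].
    - intros s Hs. apply Hd, Hs.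
    - intros s Hs. eapply Rle_trans; [apply Im_le_Cmod | now apply HK]. }
  lra.
Qed.

Lemma Cexp_sub_1 (w : C) : Cmod (Cexp w - 1) <= 2 * Cmod w * exp (Cmod w).
Proof.
  replace (Cexp w - 1)%C with (Cexp (1 * w) - Cexp (0 * w))%C.
  - replace (2 * Cmod w * exp (Cmod w)) with (2 * (Cmod w * exp (Cmod w)) * 1) by ring.
    apply (cder_mvt (fun s : R => Cexp (s * w)) (fun s : R => w * Cexp (s * w))%C); [lra | |].
    + intros s _. eapply cder_ext; [| | apply (cder_exp_line 1 w s)]; [intro u; cbv beta; ring | ring].
    + intros s Hs. rewrite Cmod_mult, Cmod_Cexp. apply Rmult_le_compat_l; [apply Cmod_ge_0 |].
      apply exp_le. reim. generalize (Re_le_Cmod w), (Rle_abs (Re w)), (Cmod_ge_0 w); nra.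
  - replace (0 * w)%C with (RtoC 0) by ring. rewrite Cexp_0. f_equal. f_equal. ring.
Qed.

Lemma Cexp_sub_1_small (w : C) : Cmod w <= 1 -> Cmod (Cexp w - 1) <= 6 * Cmod w.
Proof.
  intro H. eapply Rle_trans; [apply Cexp_sub_1 |].
  assert (exp (Cmod w) <= 3) by (eapply Rle_trans; [apply exp_le; exact H | apply exp_le_3]).
  generalize (Cmod_ge_0 w); nra.
Qed.

Lemma Cexp_sub_1_sub (w : C) : Cmod w <= 1 -> Cmod (Cexp w - 1 - w) <= 12 * Cmod w ^ 2.
Proof.
  intro H.
  replace (Cexp w - 1 - w)%C with ((Cexp (1 * w) - 1 * w) - (Cexp (0 * w) - 0 * w))%C.
  - replace (12 * Cmod w ^ 2) with (2 * (Cmod w * (6 * Cmod w)) * 1) by ring.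
    apply (cder_mvt (fun s : R => Cexp (s * w) - s * w)%C (fun s : R => w * (Cexp (s * w) - 1))%C); [lra | |].
    + intros s _. replace (w * (Cexp (s * w) - 1))%C with (1 * w * Cexp (s * w) - w)%C by ring.
      apply cder_minus.
      * eapply cder_ext; [| | apply (cder_exp_line 1 w s)]; [intro u; cbv beta; ring | ring].
      * eapply cder_ext; [| | apply (cder_line 0 w s)]; [intro u; cbv beta; ring | ring].
    + intros s Hs. rewrite Cmod_mult. apply Rmult_le_compat_l; [apply Cmod_ge_0 |].
      assert (E : Cmod (s * w) <= Cmod w).
      { rewrite Cmod_mult, Cmod_R, Rabs_pos_eq by lra. generalize (Cmod_ge_0 w); nra. }
      eapply Rle_trans; [apply Cexp_sub_1_small; lra | lra].
  - replace (0 * w)%C with (RtoC 0) by ring. rewrite Cexp_0.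
    replace (1 * w)%C with w by ring. ring.
Qed.

Lemma Cmod_sub_ge (u v : C) : Cmod u - Cmod v <= Cmod (u + v).
Proof.
  generalize (Cmod_triangle (u + v) (- v)). rewrite Cmod_opp.
  replace (u + v + - v)%C with u by ring. lra.
Qed.

(** * The double saddle point *)

(** The directions along which [- zeta^3] decreases most rapidly, in the closed upper half plane. *)
Definition valley (d : C) : Prop := Cmod d = 1 /\ (d * (d * d) = 1)%C /\ 0 <= Im d.

Lemma valley_1 : valley 1.
Proof. split; [apply Cmod_1 | split; [ring | reim; simpl; lra]]. Qed.

Lemma valley_omega : valley omega.
Proof.
  split; [| split; [exact omega_cube | unfold omega; reim; generalize sqrt3_bounds; lra]].
  assert (E := f_equal Cmod omega_cube). rewrite !Cmod_mult, Cmod_1 in E.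
  assert (H := Cmod_ge_0 omega). nra.
Qed.

Section Saddle.
Variables (p q m0 u0 B : R).
Hypotheses (Hp : 0 < p) (Hq : 0 < q) (Hpq : p + q = 1) (Hm0 : 0 < m0) (Hu0 : 0 < u0) (HB : 0 <= B).

Definition Ymin (z U : R) : R := p + (q - p) * z - 2 * z * U.
Definition mu (U : R) : R := / ((q - U) * (U + p)).
Definition kap (z U : R) : R := z * U ^ 2 * mu U.

(** [U = U0 z], at distance at least [m0] from the branch point [q] and [u0] from the pole [0]. *)
Definition is_saddle (z U : R) : Prop :=
  p <= z < 1 /\ u0 <= U <= q - m0 /\ z * U ^ 2 = p * q * (1 - z).

(** The exponents [x], [N - x] and [n - N], with [N = nu^3] and [x = N Y^- - beta N^(1/3)]. *)
Definition power_q (nu z U beta : R) : R := nu ^ 3 * Ymin z U - beta * nu.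
Definition power_p (nu z U beta : R) : R := nu ^ 3 * (1 - Ymin z U) + beta * nu.
Definition power_0 (nu z : R) : R := nu ^ 3 * (z - 1).

(** The numerator of the logarithmic derivative of the integrand over the common denominator
    [(e - q) (e + p)]: for [beta = 0] it has the double zero [U]. *)
Lemma dlog_num (nu z U beta e : R) : z * U ^ 2 = p * q * (1 - z) ->
  power_q nu z U beta * e * (e + p) + power_p nu z U beta * e * (e - q) + power_0 nu z * (e - q) * (e + p)
  = nu ^ 3 * z * (e - U) ^ 2 - beta * nu * e.
Proof.
  intro H.
  assert (H' : nu ^ 3 * z * U ^ 2 = nu ^ 3 * (p * (1 - p) * (1 - z))).
  { replace (1 - p) with q by lra. rewrite <- H. ring. }
  unfold power_q, power_p, power_0, Ymin. replace q with (1 - p) by lra.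
  transitivity (nu ^ 3 * z * e ^ 2 - nu ^ 3 * z * 2 * U * e + nu ^ 3 * (p * (1 - p) * (1 - z)) - beta * nu * e);
    [ring | rewrite <- H'; ring].
Qed.

Lemma dlog_num_C (nu z U beta : R) (e : C) : z * U ^ 2 = p * q * (1 - z) ->
  (power_q nu z U beta * e * (e + p) + power_p nu z U beta * e * (e - q) + power_0 nu z * (e - q) * (e + p)
  = (nu ^ 3)%R * z * ((e - U) * (e - U)) - (beta * nu)%R * e)%C.
Proof.
  intro H.
  assert (H' : (nu ^ 3 * z * (U * U))%R = (nu ^ 3 * (p * (1 - p) * (1 - z)))%R).
  { replace (1 - p) with q by lra. rewrite <- H. ring. }
  apply (f_equal RtoC) in H'.
  unfold power_q, power_p, power_0, Ymin. replace q with (1 - p) by lra.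
  generalize (nu ^ 3) H'; intros n3 H2. clear H'.
  repeat progress rewrite ?RtoC_plus, ?RtoC_mult, ?RtoC_minus in *.
  transitivity (n3 * z * (e * e) - n3 * z * 2 * U * e + n3 * (p * (1 - p) * (1 - z)) - beta * nu * e)%C;
    [ring | rewrite <- H2; ring].
Qed.

(** [Y^- = z (q - U)^2 / q], which shows that [Y^-] is positive; [Ymin_p] is the same for [1 - Y^-]. *)
Lemma Ymin_q (z U : R) : z * U ^ 2 = p * q * (1 - z) -> q * Ymin z U = z * (q - U) ^ 2.
Proof.
  intro H. transitivity (z * U ^ 2 + z * q * (q - 2 * U)); [| ring]. rewrite H. unfold Ymin.
  replace p with (1 - q) by lra. ring.
Qed.

Lemma Ymin_p (z U : R) : z * U ^ 2 = p * q * (1 - z) -> p * (1 - Ymin z U) = z * (U + p) ^ 2.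
Proof.
  intro H. transitivity (z * U ^ 2 + z * p * (p + 2 * U)); [| ring]. rewrite H. unfold Ymin.
  replace q with (1 - p) by lra. ring.
Qed.

Lemma saddle_bounds (z U : R) : is_saddle z U ->
  0 < U <= 1 /\ m0 <= q - U /\ 0 < z <= 1.
Proof. unfold is_saddle. intros [H1 [H2 H3]]. lra. Qed.

Lemma Ymin_bounds (z U : R) : is_saddle z U -> p * m0 ^ 2 <= Ymin z U <= 1 - p ^ 2.
Proof.
  intros [H1 [H2 H3]].
  assert (E1 := Ymin_q z U H3). assert (E2 := Ymin_p z U H3).
  assert (S1 : m0 ^ 2 <= (q - U) ^ 2) by (apply pow_incr; lra).
  assert (S2 : p ^ 2 <= (U + p) ^ 2) by (apply pow_incr; lra).
  assert (P0 : 0 <= m0 ^ 2) by (apply pow_le; lra).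
  split.
  - assert (Y0 : 0 <= Ymin z U) by (apply (Rmult_le_reg_l q); [lra | rewrite E1; nra]).
    apply Rle_trans with (q * Ymin z U); [rewrite E1; apply Rmult_le_compat; lra | nra].
  - assert (p * p ^ 2 <= p * (1 - Ymin z U)) by (rewrite E2; apply Rmult_le_compat; nra).
    apply Rmult_le_reg_l in H; lra.
Qed.

Lemma mu_bounds (U : R) : 0 < U -> m0 <= q - U -> 1 <= mu U <= / (m0 * p).
Proof.
  intros H1 H2. unfold mu. assert (0 < m0 * p) by now apply Rmult_lt_0_compat.
  assert (m0 * p <= (q - U) * (U + p)) by (apply Rmult_le_compat; lra).
  split; [rewrite <- Rinv_1 |]; apply Rinv_le_contravar; nra.
Qed.

Lemma kap_bounds (z U : R) : is_saddle z U -> p * u0 ^ 2 <= kap z U <= / (m0 * p).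
Proof.
  intro H. destruct (saddle_bounds z U H) as [H1 [H2 H3]]. destruct H as [G1 [G2 G3]].
  destruct (mu_bounds U ltac:(lra) H2) as [M1 M2]. unfold kap.
  assert (u0 ^ 2 <= U ^ 2) by (apply pow_incr; lra).
  assert (0 <= u0 ^ 2) by (apply pow_le; lra).
  assert (U ^ 2 <= 1) by (rewrite <- (pow1 2); apply pow_incr; lra).
  assert (p * u0 ^ 2 <= z * U ^ 2) by (apply Rmult_le_compat; lra).
  assert (0 <= p * u0 ^ 2) by (apply Rmult_le_pos; lra).
  split.
  - rewrite <- (Rmult_1_r (p * u0 ^ 2)). apply Rmult_le_compat; lra.
  - rewrite <- (Rmult_1_l (/ (m0 * p))). apply Rmult_le_compat; nra.
Qed.

(** A bound for [1 / ((q - u) (u + p))] near the saddle point. *)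
Definition recip_bd : R := 2 / (m0 * p).

Lemma recip_bd_pos : 0 < recip_bd.
Proof. unfold recip_bd. apply Rdiv_lt_0_compat; [lra | now apply Rmult_lt_0_compat]. Qed.

(** The two factors of the logarithmic derivative that vary along the contour, compared with their
    values at the saddle point. *)
Lemma saddle_factor (U : R) (xi : C) : 0 < U -> m0 <= q - U -> Cmod xi <= m0 / 12 ->
  let e := (U * Cexp xi)%C in let h := (/ ((q - e) * (e + p)))%C in
  (q - e <> 0)%C /\ (e + p <> 0)%C /\
  Cmod ((e - U) * (e - U) * h - (U ^ 2 * mu U)%R * (xi * xi)) <= (84 * recip_bd + 24 * recip_bd ^ 2) * Cmod xi ^ 3 /\
  Cmod (e * h - (U * mu U)%R) <= (84 * recip_bd + 24 * recip_bd ^ 2) * Cmod xi.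
Proof.
  intros HU Hm Hxi e h.
  assert (Hx0 := Cmod_ge_0 xi). assert (HH := recip_bd_pos).
  set (E := (Cexp xi - 1)%C).
  assert (HE1 : Cmod E <= 6 * Cmod xi) by (apply Cexp_sub_1_small; lra).
  assert (HE2 : Cmod (E - xi) <= 12 * Cmod xi ^ 2) by (apply Cexp_sub_1_sub; lra).
  assert (EeU : (e - U)%C = (U * E)%C) by (unfold e, E; ring).
  assert (MU : Cmod U = U) by (rewrite Cmod_R; apply Rabs_pos_eq; lra).
  assert (HeU : Cmod (e - U) <= U * (6 * Cmod xi)).
  { rewrite EeU, Cmod_mult, MU. apply Rmult_le_compat_l; lra. }
  assert (HeU' : Cmod (e - U) <= 6 * Cmod xi) by nra.
  assert (D1 : m0 / 2 <= Cmod (q - e)).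
  { replace (q - e)%C with ((q - U)%R + - (e - U))%C by (rewrite RtoC_minus; ring).
    eapply Rle_trans; [| apply Cmod_sub_ge]. rewrite Cmod_opp, Cmod_R, Rabs_pos_eq; lra. }
  assert (D2 : p <= Cmod (e + p)).
  { replace (e + p)%C with ((U + p)%R + (e - U))%C by (rewrite RtoC_plus; ring).
    eapply Rle_trans; [| apply Cmod_sub_ge]. rewrite Cmod_R, Rabs_pos_eq by lra. nra. }
  assert (N1 : (q - e <> 0)%C) by (intro X; rewrite X, Cmod_0 in D1; lra).
  assert (N2 : (e + p <> 0)%C) by (intro X; rewrite X, Cmod_0 in D2; lra).
  assert (Hh : Cmod h <= recip_bd).
  { unfold h, recip_bd. rewrite Cmod_inv by now apply Cmult_neq_0. rewrite Cmod_mult.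
    replace (2 / (m0 * p)) with (/ (m0 / 2 * p)) by (field; lra).
    apply Rinv_le_contravar; [apply Rmult_lt_0_compat; lra | apply Rmult_le_compat; lra]. }
  destruct (mu_bounds U HU Hm) as [M1 M2].
  assert (M3 : mu U <= recip_bd).
  { eapply Rle_trans; [exact M2 |]. unfold recip_bd, Rdiv. 
    assert (0 < / (m0 * p)) by (apply Rinv_0_lt_compat, Rmult_lt_0_compat; lra). lra. }
  assert (MM : Cmod (mu U) = mu U) by (rewrite Cmod_R; apply Rabs_pos_eq; lra).
  assert (He : Cmod e <= 2).
  { replace e with (U + (e - U))%C by ring. eapply Rle_trans; [apply Cmod_triangle |]. rewrite MU. lra. }
  assert (Hd : Cmod (h - mu U) <= 24 * recip_bd ^ 2 * Cmod xi).
  { replace (h - mu U)%C with (h * mu U * ((e - U) * ((U + e) - (q - p)%R)))%C.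
    - rewrite !Cmod_mult, MM.
      assert (Ht : Cmod ((U + e) - (q - p)%R) <= 4).
      { eapply Rle_trans; [apply Cmod_triangle |]. rewrite Cmod_opp, Cmod_R.
        assert (Rabs (q - p) <= 1) by (apply Rabs_le; lra).
        generalize (Cmod_triangle U e). rewrite MU. lra. }
      replace (24 * recip_bd ^ 2 * Cmod xi) with (recip_bd * recip_bd * (6 * Cmod xi * 4)) by ring.
      apply Rmult_le_compat.
      + apply Rmult_le_pos; [apply Cmod_ge_0 | lra].
      + apply Rmult_le_pos; apply Cmod_ge_0.
      + apply Rmult_le_compat; try lra; apply Cmod_ge_0.
      + apply Rmult_le_compat; try lra; apply Cmod_ge_0.
    - assert (Em : (mu U * ((q - U) * (U + p)) = 1)%C).
      { rewrite <- RtoC_minus, <- RtoC_plus, <- !RtoC_mult. f_equal. unfold mu. field. lra. }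
      assert (Eh : (h * ((q - e) * (e + p)) = 1)%C) by (unfold h; field; auto).
      transitivity (h * (mu U * ((q - U) * (U + p))) - mu U * (h * ((q - e) * (e + p))))%C;
        [| rewrite Em, Eh; ring].
      rewrite RtoC_minus. ring. }
  split; [exact N1 |]. split; [exact N2 |]. split.
  - replace ((e - U) * (e - U) * h - (U ^ 2 * mu U)%R * (xi * xi))%C with
      (U * U * ((E - xi) * (E + xi)) * h + U * U * (xi * xi) * (h - mu U))%C
      by (rewrite EeU; simpl; rewrite !RtoC_mult; ring).
    assert (HE3 : Cmod (E + xi) <= 7 * Cmod xi) by (eapply Rle_trans; [apply Cmod_triangle | lra]).
    eapply Rle_trans; [apply Cmod_triangle |]. rewrite !Cmod_mult, MU.
    replace ((84 * recip_bd + 24 * recip_bd ^ 2) * Cmod xi ^ 3) with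
      (1 * 1 * (12 * Cmod xi ^ 2 * (7 * Cmod xi)) * recip_bd + 1 * 1 * (Cmod xi * Cmod xi) * (24 * recip_bd ^ 2 * Cmod xi)) by ring.
    assert (UU : 0 <= U * U <= 1 * 1) by nra.
    assert (G1 := Cmod_ge_0 (E - xi)). assert (G2 := Cmod_ge_0 (E + xi)). assert (G3 := Cmod_ge_0 h).
    assert (G4 := Cmod_ge_0 (h - mu U)).
    apply Rplus_le_compat.
    + apply Rmult_le_compat; [| lra | | lra].
      * apply Rmult_le_pos; [lra | now apply Rmult_le_pos].
      * apply Rmult_le_compat; [lra | now apply Rmult_le_pos | lra |]. now apply Rmult_le_compat.
    + apply Rmult_le_compat; [| lra | | lra].
      * apply Rmult_le_pos; [lra | now apply Rmult_le_pos].
      * apply Rmult_le_compat; [lra | now apply Rmult_le_pos | lra | lra].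
  - replace (e * h - (U * mu U)%R)%C with ((e - U) * h + U * (h - mu U))%C by (rewrite RtoC_mult; ring).
    eapply Rle_trans; [apply Cmod_triangle |]. rewrite !Cmod_mult, MU.
    assert (Cmod (e - U) * Cmod h <= 6 * Cmod xi * recip_bd) by (apply Rmult_le_compat; try lra; apply Cmod_ge_0).
    assert (U * Cmod (h - mu U) <= 1 * (24 * recip_bd ^ 2 * Cmod xi)).
    { apply Rmult_le_compat; try lra. apply Cmod_ge_0. }
    nra.
Qed.

(** * The cubic expansion at the saddle point *)

Definition logG (nu z U beta : R) (w : C) : C :=
  (power_q nu z U beta * ulog (Cexp w - q) + power_p nu z U beta * ulog (Cexp w + p) + power_0 nu z * w)%C.

(** The cubic model of [logG (ln U + t d) - logG (ln U)]; the factor [d^3 = 1] is left out of the cubic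
    term. *)
Definition mainexp (nu z U beta : R) (d : C) (t : R) : C :=
  ((- (nu ^ 3 * kap z U * (t ^ 3 / 3)))%R + (beta * nu * (U * mu U) * t)%R * d)%C.

Definition local_const : R := 2 * (84 * recip_bd + 24 * recip_bd ^ 2) * (1 + B).

Lemma local_const_pos : 0 < local_const.
Proof. unfold local_const. assert (H := recip_bd_pos). assert (0 <= recip_bd ^ 2) by (apply pow_le; lra). nra. Qed.

Lemma Cexp_ln (U : R) (w : C) : 0 < U -> Cexp (ln U + w)%C = (U * Cexp w)%C.
Proof. intro H. rewrite Cexp_plus, Cexp_real, exp_ln by exact H. reflexivity. Qed.

Lemma offslit_near (U : R) (d : C) (t : R) : 0 < U -> m0 <= q - U -> valley d -> 0 <= t <= m0 / 12 ->
  offslit (Cexp (ln U + t * d) - q)%C /\ offslit (Cexp (ln U + t * d) + p)%C.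
Proof.
  intros HU Hm [Hd1 [Hd2 Hd3]] Ht.
  assert (Mt : Cmod (t * d) = t) by (rewrite Cmod_mult, Hd1, Cmod_R, Rabs_pos_eq; lra).
  destruct (saddle_factor U (t * d)%C HU Hm ltac:(lra)) as [N1 [N2 _]].
  rewrite Cexp_ln by exact HU.
  assert (I : 0 <= Im (U * Cexp (t * d))%C).
  { rewrite im_scal_l. apply Rmult_le_pos; [lra |]. apply Im_Cexp_ge_0. rewrite im_scal_l.
    assert (Im d <= 1) by (generalize (Im_le_Cmod d), (Rle_abs (Im d)); lra).
    assert (3 < PI) by (generalize PI2_3_2; lra). nra. }
  split; apply offslit_upper; try (rewrite ?Im_minus, ?Im_plus, Im_R; lra).
  - intro X. apply N1. replace (q - U * Cexp (t * d))%C with (- (U * Cexp (t * d) - q))%C by ring. rewrite X. ring.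
  - exact N2.
Qed.

(** The derivatives of both sides along the ray differ by [O(nu^3 t^3 + nu t)], by [saddle_factor]. *)
Lemma local_log (nu z U beta : R) (d : C) (t : R) :
  0 < nu -> is_saddle z U -> Rabs beta <= B -> valley d -> 0 <= t <= m0 / 12 ->
  Cmod (logG nu z U beta (ln U + t * d) - logG nu z U beta (ln U) - mainexp nu z U beta d t)
    <= local_const * (nu ^ 3 * t ^ 4 + nu * t ^ 2).
Proof.
  intros Hnu HS Hbe Hd Ht. destruct (saddle_bounds z U HS) as [H1 [H2 H3]].
  destruct HS as [_ [_ Hz]].
  set (K := 84 * recip_bd + 24 * recip_bd ^ 2).
  assert (HK : 0 < K) by (unfold K; assert (H := recip_bd_pos); assert (0 <= recip_bd ^ 2) by (apply pow_le; lra); nra).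
  assert (P3 : 0 < nu ^ 3) by now apply pow_lt.
  set (f := fun s : R => (logG nu z U beta (ln U + s * d) - mainexp nu z U beta d s)%C).
  set (df := fun s : R => let e := (U * Cexp (s * d))%C in
    (d * ((power_q nu z U beta * e / (e - q) + power_p nu z U beta * e / (e + p) + power_0 nu z)
      - ((- (nu ^ 3 * kap z U))%R * ((s * d) * (s * d)) + (beta * nu * (U * mu U))%R)))%C).
  replace (logG nu z U beta (ln U + t * d) - logG nu z U beta (ln U) - mainexp nu z U beta d t)%C with (f t - f 0)%C.
  2: { unfold f. replace (ln U + 0 * d)%C with (RtoC (ln U)) by ring.
       replace (mainexp nu z U beta d 0) with (RtoC 0); [ring |].
       unfold mainexp. apply C_ext; reim; field. }
  replace (local_const * (nu ^ 3 * t ^ 4 + nu * t ^ 2)) with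
    (2 * (K * (1 + B) * (nu ^ 3 * t ^ 3 + nu * t)) * t) by (unfold local_const, K; ring).
  apply (cder_mvt f df); [lra | |].
  - intros s Hs. destruct (offslit_near U d s ltac:(lra) H2 Hd ltac:(lra)) as [O1 O2].
    assert (Hl : cder (fun s : R => (ln U + s * d)%C) s d) by apply cder_line.
    assert (He := cder_Cexp _ _ _ Hl).
    unfold f. eapply cder_ext; [intro; reflexivity | | apply cder_minus].
    2: { unfold logG. apply cder_plus; [apply cder_plus |].
         - apply cder_scal, cder_ulog; [exact O1 |]. apply cder_minus; [exact He | apply cder_const].
         - apply cder_scal, cder_ulog; [exact O2 |]. apply cder_plus; [exact He | apply cder_const].
         - apply cder_scal, Hl. }
    2: { instantiate (1 := ((- (nu ^ 3 * kap z U * s ^ 2))%R + (beta * nu * (U * mu U))%R * d)%C).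
         split; unfold mainexp; reim.
         - apply (is_derive_ext (fun s => - (nu ^ 3 * kap z U * (s ^ 3 / 3)) + beta * nu * (U * mu U) * s * Re d)).
           + intro u. req. reim. ring.
           + auto_derive; [exact I |]. req. field.
         - apply (is_derive_ext (fun s => beta * nu * (U * mu U) * s * Im d)).
           + intro u. req. reim. ring.
           + auto_derive; [exact I |]. req. field. }
    unfold df. rewrite <- (Cexp_ln U) by lra.
    assert (Q1 : (Cexp (ln U + s * d) - q <> 0)%C) by (intro X; apply offslit_pos in O1; rewrite X, Cmod_0 in O1; lra).
    assert (Q2 : (Cexp (ln U + s * d) + p <> 0)%C) by (intro X; apply offslit_pos in O2; rewrite X, Cmod_0 in O2; lra).
    set (e := Cexp (ln U + s * d)) in *.
    assert (Ed : (RtoC (- (nu ^ 3 * kap z U * s ^ 2)) = d * ((- (nu ^ 3 * kap z U))%R * (s * d * (s * d))))%C).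
    { destruct Hd as [_ [Hd _]].
      transitivity ((- (nu ^ 3 * kap z U))%R * (s * s) * (d * (d * d)))%C; [| ring].
      rewrite Hd, <- !RtoC_mult. f_equal. ring. }
    rewrite Ed. field. auto.
  - intros s Hs. destruct Hd as [Hd1 [Hd2 Hd3]].
    assert (Ms : Cmod (s * d) = s) by (rewrite Cmod_mult, Hd1, Cmod_R, Rabs_pos_eq; lra).
    destruct (saddle_factor U (s * d)%C ltac:(lra) H2 ltac:(lra)) as [N1 [N2 [L1 L2]]].
    unfold df. set (e := (U * Cexp (s * d))%C) in *. cbv zeta in L1, L2. rewrite Ms in L1, L2. fold K in L1, L2.
    set (h := (/ ((q - e) * (e + p)))%C) in *.
    assert (En : (power_q nu z U beta * e / (e - q) + power_p nu z U beta * e / (e + p) + power_0 nu z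
      = - (((nu ^ 3)%R * z * ((e - U) * (e - U)) - (beta * nu)%R * e) * h))%C).
    { rewrite <- (dlog_num_C nu z U beta e Hz). unfold h.
      assert (N3 : (e - q <> 0)%C) by (intro X; apply N1; replace (q - e)%C with (- (e - q))%C by ring; rewrite X; ring).
      field. auto. }
    rewrite En. rewrite Cmod_mult, Hd1, Rmult_1_l.
    replace (- (((nu ^ 3)%R * z * ((e - U) * (e - U)) - (beta * nu)%R * e) * h)
      - ((- (nu ^ 3 * kap z U))%R * (s * d * (s * d)) + (beta * nu * (U * mu U))%R))%C
     with (- ((nu ^ 3 * z)%R * ((e - U) * (e - U) * h - (U ^ 2 * mu U)%R * (s * d * (s * d))))
       + (beta * nu)%R * (e * h - (U * mu U)%R))%C.
    + eapply Rle_trans; [apply Cmod_triangle |]. rewrite Cmod_opp, !Cmod_mult, !Cmod_R.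
      assert (A1 : Rabs (nu ^ 3 * z) <= nu ^ 3) by (rewrite Rabs_pos_eq; nra).
      assert (A2 : Rabs (beta * nu) <= B * nu) by (rewrite Rabs_mult, (Rabs_pos_eq nu) by lra; nra).
      assert (S3 : s ^ 3 <= t ^ 3) by (apply pow_incr; lra).
      assert (S0 : 0 <= s ^ 3) by (apply pow_le; lra).
      apply Rle_trans with (nu ^ 3 * (K * t ^ 3) + B * nu * (K * t)).
      * apply Rplus_le_compat; (apply Rmult_le_compat; [apply Rabs_pos | apply Cmod_ge_0 | assumption |]).
        -- eapply Rle_trans; [exact L1 |]. apply Rmult_le_compat_l; lra.
        -- eapply Rle_trans; [exact L2 |]. apply Rmult_le_compat_l; lra.
      * assert (0 <= nu ^ 3 * (K * t ^ 3)) by (apply Rmult_le_pos; [lra | apply Rmult_le_pos; lra]).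
        assert (0 <= nu * (K * t)) by (apply Rmult_le_pos; [lra | apply Rmult_le_pos; lra]).
        nra.
    + unfold kap. rewrite ?RtoC_opp, ?RtoC_mult. rewrite ?RtoC_opp, ?RtoC_mult. ring.
Qed.

(** * The two segments at the saddle point *)

Definition integrand (nu z U beta : R) : C -> C := kfun q p (power_q nu z U beta) (power_p nu z U beta) (power_0 nu z).

(** Modulus and phase of the integrand at the saddle point. *)
Definition saddle_mod (nu z U beta : R) : R :=
  exp (power_q nu z U beta * ln (q - U) + power_p nu z U beta * ln (U + p) + power_0 nu z * ln U).
Definition saddle_phase (nu z U beta : R) : C := Cexp (0, PI * power_q nu z U beta).

Definition kap_root (z U : R) : R := Rpower (kap z U) (/ 3).
(** The argument of the Airy functions; [vartheta_airy_arg] gives its expression by [vartheta]. *)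
Definition airy_arg (z U beta : R) : R := beta * (U * mu U) / kap_root z U.

Definition kap_low : R := Rmin 1 (p * u0 ^ 2).
(** The length of the two segments at the saddle point: so short that the error of the cubic model is
    at most half of the cubic term, plus a linear one. *)
Definition tau0 : R := Rmin (m0 / 12) (kap_low ^ 3 / (6 * local_const)).

Lemma kap_low_pos : 0 < kap_low <= 1.
Proof.
  unfold kap_low. split; [| apply Rmin_l]. apply Rmin_pos; [lra |].
  apply Rmult_lt_0_compat; [exact Hp | now apply pow_lt].
Qed.

Lemma tau0_pos : 0 < tau0 <= m0 / 12.
Proof.
  unfold tau0. split; [| apply Rmin_l]. assert (H := local_const_pos).
  apply Rmin_pos; [lra |]. apply Rdiv_lt_0_compat; [apply pow_lt, kap_low_pos | lra].
Qed.

Lemma tau0_local_const : local_const * tau0 <= kap_low ^ 3 / 6.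
Proof.
  assert (H := local_const_pos).
  apply Rle_trans with (local_const * (kap_low ^ 3 / (6 * local_const))); [| right; field; lra].
  apply Rmult_le_compat_l; [lra | apply Rmin_r].
Qed.

Lemma Cmod_phase (nu z U beta : R) : Cmod (saddle_phase nu z U beta) = 1.
Proof. unfold saddle_phase. rewrite Cmod_Cexp. reim. apply exp_0. Qed.

Lemma saddle_mod_pos (nu z U beta : R) : 0 < saddle_mod nu z U beta.
Proof. apply exp_pos. Qed.

Lemma kap_root_spec (z U : R) : is_saddle z U -> kap_root z U ^ 3 = kap z U /\ kap_low <= kap_root z U.
Proof.
  intro HS. assert (K := kap_bounds z U HS).
  assert (P0 : 0 < p * u0 ^ 2) by (apply Rmult_lt_0_compat; [exact Hp | now apply pow_lt]).
  assert (E : kap_root z U ^ 3 = kap z U) by (apply Rpower_third_cube; lra).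
  split; [exact E |]. apply Rnot_lt_le. intro L.
  assert (H0 : 0 < kap_root z U) by apply exp_pos.
  assert (H1 := kap_low_pos). assert (H2 : kap_low <= p * u0 ^ 2) by apply Rmin_r.
  assert (kap_root z U ^ 3 <= kap_root z U) by nra. lra.
Qed.

Lemma airy_arg_bound (z U beta : R) : is_saddle z U -> Rabs beta <= B ->
  Rabs (airy_arg z U beta) <= B / (m0 * p * kap_low).
Proof.
  intros HS Hb. destruct (saddle_bounds z U HS) as [H1 [H2 _]].
  destruct (kap_root_spec z U HS) as [_ K]. assert (KP := kap_low_pos).
  destruct (mu_bounds U ltac:(lra) H2) as [M1 M2].
  assert (Hmp : 0 < m0 * p) by now apply Rmult_lt_0_compat.
  unfold airy_arg, Rdiv. rewrite !Rabs_mult, Rabs_inv, (Rabs_pos_eq (kap_root z U)), (Rabs_pos_eq U), (Rabs_pos_eq (mu U)) by lra.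
  replace (B * / (m0 * p * kap_low)) with (B * / (m0 * p) * / kap_low) by (field; lra).
  apply Rmult_le_compat.
  - apply Rmult_le_pos; [apply Rabs_pos | apply Rmult_le_pos; lra].
  - left. apply Rinv_0_lt_compat; lra.
  - apply Rmult_le_compat; [apply Rabs_pos | apply Rmult_le_pos; lra | exact Hb |].
    rewrite <- (Rmult_1_l (/ (m0 * p))). apply Rmult_le_compat; lra.
  - apply Rinv_le_contravar; lra.
Qed.

Lemma integrand_logG (nu z U beta : R) (w : C) : offslit (Cexp w - q)%C -> offslit (Cexp w + p)%C ->
  integrand nu z U beta w = Cexp (logG nu z U beta w).
Proof.
  intros O1 O2. unfold integrand, kfun, logG. rewrite !upow_pos by now apply offslit_pos.
  rewrite !Cexp_plus. reflexivity.
Qed.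

Lemma logG_saddle (nu z U beta : R) : 0 < U -> U < q ->
  Cexp (logG nu z U beta (ln U)) = (saddle_mod nu z U beta * saddle_phase nu z U beta)%C.
Proof.
  intros HU HUq. unfold logG. rewrite Cexp_real, exp_ln by exact HU.
  rewrite <- RtoC_minus, <- RtoC_plus.
  replace (U - q) with (- (q - U)) by ring. rewrite ulog_neg, ulog_pos by lra.
  unfold saddle_mod, saddle_phase. rewrite <- Cexp_real, <- Cexp_plus. f_equal.
  apply C_ext; reim; ring.
Qed.

(** In the variable [T = k3 t] the exponents differ by [O((T^4 + T^2) / nu)], and also by at most half of
    the cubic term plus a linear one, so the difference of the integrands is [O(exp (- T) / nu)].
    The second estimate bounds the integrand at the far end of the segment. *)
Lemma ray_estimate : exists K, 0 < K /\ forall nu z U beta d,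
  0 < nu -> is_saddle z U -> Rabs beta <= B -> valley d ->
  Rabs (nu * kap_root z U / saddle_mod nu z U beta * seg (integrand nu z U beta) (ln U) (tau0 * d)%C
    - J (saddle_phase nu z U beta * d)%C (airy_arg z U beta * d)%C (tau0 * (nu * kap_root z U))) <= K / nu /\
  Cmod (integrand nu z U beta (ln U + tau0 * d)%C) <= saddle_mod nu z U beta * (K * exp (- (tau0 * (nu * kap_root z U)))).
Proof.
  assert (KP := kap_low_pos). assert (TP := tau0_pos). assert (CP := local_const_pos).
  assert (Hmp : 0 < m0 * p) by now apply Rmult_lt_0_compat.
  set (XM := B / (m0 * p * kap_low)).
  assert (HXM : 0 <= XM).
  { unfold XM. apply Rmult_le_pos; [exact HB |]. left. apply Rinv_0_lt_compat, Rmult_lt_0_compat; lra. }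
  set (A := local_const / kap_low). assert (HA : 0 < A) by (apply Rdiv_lt_0_compat; lra).
  destruct (exp_cubic_bound (/ 6) (XM + A + 1)) as [K0 [HK0 HE]]; [lra |].
  set (D := 2 * local_const / kap_low ^ 4).
  assert (K4 : 0 < kap_low ^ 4) by (apply pow_lt; lra).
  assert (HD : 0 < D) by (apply Rdiv_lt_0_compat; lra).
  set (K := 26 * D * K0 + K0).
  assert (DK0 : 0 < D * K0) by now apply Rmult_lt_0_compat.
  exists K. split; [unfold K; lra |].
  intros nu z U beta d Hnu HS Hbe Hd.
  destruct (saddle_bounds z U HS) as [H1 [H2 H3]].
  destruct (kap_root_spec z U HS) as [E3 KL]. set (k := kap_root z U) in *.
  set (k3 := nu * k). assert (Hk3 : 0 < k3) by (apply Rmult_lt_0_compat; lra).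
  assert (HX := airy_arg_bound z U beta HS Hbe). fold XM in HX. set (X := airy_arg z U beta) in *.
  assert (EX : X * k3 = beta * nu * (U * mu U)).
  { unfold X, airy_arg. fold k. unfold k3. field. lra. }
  set (ph := saddle_phase nu z U beta). set (gs := saddle_mod nu z U beta).
  assert (Hgs : 0 < gs) by apply saddle_mod_pos.
  assert (Hd1 : Cmod d = 1) by apply Hd.
  set (R1 := tau0 * k3). assert (HR1 : 0 < R1) by (apply Rmult_lt_0_compat; lra).
  (* the error E of the exponent in the variable T = k3 t *)
  assert (Main : forall T, 0 <= T <= R1 -> exists E : C,
    integrand nu z U beta (ln U + (T / k3)%R * d)%C = (gs * ph * ((exp (- (T ^ 3 / 3)))%R * Cexp (T * (X * d))) * Cexp E)%C
    /\ Cmod E <= D / 2 / nu * (T ^ 4 + T ^ 2) /\ Cmod E <= T ^ 3 / 6 + A * T).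
  { intros T HT. set (t := T / k3).
    assert (Ht : 0 <= t <= tau0).
    { unfold t. split; [apply Rmult_le_pos; [lra | left; now apply Rinv_0_lt_compat] |].
      apply (Rmult_le_reg_r k3); [exact Hk3 |]. replace (T / k3 * k3) with T by (field; lra). exact (proj2 HT). }
    assert (ET : T = k3 * t) by (unfold t; field; lra).
    destruct (offslit_near U d t ltac:(lra) H2 Hd ltac:(lra)) as [O1 O2].
    exists (logG nu z U beta (ln U + t * d) - logG nu z U beta (ln U) - mainexp nu z U beta d t)%C.
    assert (L := local_log nu z U beta d t Hnu HS Hbe Hd ltac:(lra)).
    assert (P4 : 0 <= nu ^ 3 * t ^ 4) by (apply Rmult_le_pos; apply pow_le; lra).
    assert (P2 : 0 <= nu * t ^ 2) by (apply Rmult_le_pos; [lra | apply pow_le; lra]).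
    split; [| split].
    - rewrite integrand_logG by assumption. unfold gs, ph. rewrite <- logG_saddle by lra.
      rewrite <- Cexp_real, <- !Cexp_plus. f_equal.
      assert (EM : mainexp nu z U beta d t = ((- (T ^ 3 / 3))%R + T * (X * d))%C).
      { unfold mainexp. rewrite <- E3, <- EX. replace (nu ^ 3 * k ^ 3 * (t ^ 3 / 3)) with (T ^ 3 / 3)
          by (rewrite ET; unfold k3; field).
        rewrite ET, !RtoC_mult. ring. }
      rewrite <- EM. ring.
    - eapply Rle_trans; [exact L |].
      replace (nu ^ 3 * t ^ 4) with (T ^ 4 / k ^ 4 / nu) by (rewrite ET; unfold k3; field; lra).
      replace (nu * t ^ 2) with (T ^ 2 / k ^ 2 / nu) by (rewrite ET; unfold k3; field; lra).
      replace (D / 2 / nu * (T ^ 4 + T ^ 2)) with (local_const * (T ^ 4 / kap_low ^ 4 / nu + T ^ 2 / kap_low ^ 4 / nu))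
        by (unfold D; field; lra).
      apply Rmult_le_compat_l; [lra |].
      assert (I1 : / k ^ 4 <= / kap_low ^ 4) by (apply Rinv_le_contravar; [exact K4 | apply pow_incr; lra]).
      assert (I2 : / k ^ 2 <= / kap_low ^ 4).
      { apply Rinv_le_contravar; [exact K4 |]. apply Rle_trans with (kap_low ^ 2); [| apply pow_incr; lra].
        replace (kap_low ^ 4) with (kap_low ^ 2 * kap_low ^ 2) by ring. assert (0 <= kap_low ^ 2 <= 1); [| nra].
        split; [apply pow_le; lra | rewrite <- (pow1 2); apply pow_incr; lra]. }
      assert (In : 0 < / nu) by now apply Rinv_0_lt_compat.
      apply Rplus_le_compat; unfold Rdiv; (apply Rmult_le_compat_r; [lra |]; apply Rmult_le_compat_l; [apply pow_le; lra | assumption]).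
    - eapply Rle_trans; [exact L |].
      assert (I3 : 0 <= t ^ 3) by (apply pow_le; lra).
      apply Rle_trans with (local_const * tau0 * (nu ^ 3 * t ^ 3 + nu * t)).
      + rewrite (Rmult_assoc _ tau0). apply Rmult_le_compat_l; [lra |].
        assert (N3 : 0 < nu ^ 3) by now apply pow_lt.
        assert (nu ^ 3 * t ^ 4 <= tau0 * (nu ^ 3 * t ^ 3)).
        { replace (nu ^ 3 * t ^ 4) with (t * (nu ^ 3 * t ^ 3)) by ring.
          apply Rmult_le_compat_r; [apply Rmult_le_pos; lra | lra]. }
        assert (nu * t ^ 2 <= tau0 * (nu * t)).
        { replace (nu * t ^ 2) with (t * (nu * t)) by ring.
          apply Rmult_le_compat_r; [apply Rmult_le_pos; lra | lra]. }
        lra.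
      + rewrite Rmult_plus_distr_l. apply Rplus_le_compat.
        * apply Rle_trans with (kap_low ^ 3 / 6 * (nu ^ 3 * t ^ 3)).
          -- apply Rmult_le_compat_r; [apply Rmult_le_pos; [apply pow_le; lra | exact I3] | exact tau0_local_const].
          -- replace (T ^ 3 / 6) with (k ^ 3 / 6 * (nu ^ 3 * t ^ 3)) by (rewrite ET; unfold k3; field).
             apply Rmult_le_compat_r; [apply Rmult_le_pos; [apply pow_le; lra | exact I3] |].
             assert (kap_low ^ 3 <= k ^ 3) by (apply pow_incr; lra). lra.
        * apply Rle_trans with (local_const * 1 * (nu * t)).
          -- apply Rmult_le_compat_r; [apply Rmult_le_pos; lra |]. apply Rmult_le_compat_l; lra.
          -- unfold A. replace (local_const / kap_low * T) with (local_const * (nu * t) * (k / kap_low))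
               by (rewrite ET; unfold k3; field; lra).
             rewrite Rmult_1_r. rewrite <- (Rmult_1_r (local_const * (nu * t))) at 1.
             apply Rmult_le_compat_l; [apply Rmult_le_pos; [lra | apply Rmult_le_pos; lra] |].
             apply (Rmult_le_reg_r kap_low); [lra |]. replace (k / kap_low * kap_low) with k by (field; lra). lra. }
  assert (MX : forall T, 0 <= T -> Cmod (Cexp (T * (X * d))) <= exp (XM * T)).
  { intros T HT. rewrite Cmod_Cexp. apply exp_le. reim.
    generalize (Re_le_Cmod d). rewrite Hd1. intro Hr.
    assert (A1 : Rabs (X * Re d) <= XM * 1) by (rewrite Rabs_mult; apply Rmult_le_compat; auto using Rabs_pos).
    generalize (Rle_abs (X * Re d)). nra. }
  split.
  - set (f := fun s : R => Im (integrand nu z U beta (ln U + s * (tau0 * d)) * (tau0 * d))%C).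
    assert (Cf : forall s, 0 <= s <= 1 -> continuous f s).
    { intros s Hs. unfold f.
      assert (O : offslit (Cexp (ln U + s * (tau0 * d)) - q)%C /\ offslit (Cexp (ln U + s * (tau0 * d)) + p)%C).
      { replace (s * (tau0 * d))%C with ((s * tau0)%R * d)%C by (rewrite RtoC_mult; ring).
        apply (offslit_near); auto; [lra | nra]. }
      apply (ccont_mult (fun s : R => integrand nu z U beta (ln U + s * (tau0 * d))%C) (fun _ => (tau0 * d)%C));
        [| apply ccont_const].
      apply (ccont_kfun (fun _ => q) (fun _ => p)); auto using continuous_const.
      - eapply cder_ccont, cder_line.
      - left; apply O.
      - left; apply O. }
    assert (If : ex_RInt f 0 1) by now apply ex_RInt_01.
    assert (If' : ex_RInt f (/ R1 * 0 + 0) (/ R1 * R1 + 0)).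
    { replace (/ R1 * 0 + 0) with 0 by ring. replace (/ R1 * R1 + 0) with 1 by (field; lra). exact If. }
    assert (Es := @RInt_comp_lin R_CompleteNormedModule f (/ R1) 0 0 R1 If').
    assert (Ie := @ex_RInt_comp_lin R_NormedModule f (/ R1) 0 0 R1 If').
    replace (/ R1 * 0 + 0) with 0 in Es by ring. replace (/ R1 * R1 + 0) with 1 in Es by (field; lra).
    change (seg (integrand nu z U beta) (ln U) (tau0 * d)%C) with (RInt f 0 1).
    set (g := fun T => scal (/ R1) (f (/ R1 * T + 0))) in *.
    set (h := fun T => exp (- (T ^ 3 / 3)) * Im (ph * d * Cexp (T * (X * d)))%C).
    assert (Ih : ex_RInt h 0 R1) by (apply ex_RInt_cont, cont_J).
    assert (Eg : RInt g 0 R1 = RInt f 0 1) by exact Es.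
    assert (Ig : is_RInt (fun T => minus (scal (k3 / gs) (g T)) (h T)) 0 R1
      (minus (scal (k3 / gs) (RInt g 0 R1)) (RInt h 0 R1))).
    { apply is_RInt_minus_R; [apply is_RInt_scal_R |];
        now apply RInt_correct_R. }
    rewrite Eg in Ig.
    replace (k3 / gs * RInt f 0 1 - J (ph * d) (X * d) R1) with
      (RInt (fun T => minus (scal (k3 / gs) (g T)) (h T)) 0 R1).
    2: { apply is_RInt_unique_R in Ig. etransitivity; [exact Ig |]. reflexivity. }
    eapply Rle_trans; [apply (RInt_exp_bound _ (26 * D * K0 / nu)); [lra | eexists; exact Ig |] |].
    + intros T HT. destruct (Main T HT) as [E [EG [B1 B2]]].
      replace (minus (scal (k3 / gs) (g T)) (h T)) with
        (Im (ph * d * ((exp (- (T ^ 3 / 3)))%R * Cexp (T * (X * d))) * (Cexp E - 1))%C).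
      2: { change (minus (scal (k3 / gs) (g T)) (h T)) with (k3 / gs * (/ R1 * f (/ R1 * T + 0)) - h T).
           unfold f, h.
           replace ((/ R1 * T + 0)%R * (tau0 * d))%C with ((T / k3)%R * d)%C.
           2: { rewrite Rplus_0_r. replace (T / k3)%R with (/ R1 * T * tau0)%R by (unfold R1; field; lra).
                rewrite !RtoC_mult. ring. }
           rewrite EG.
           replace (gs * ph * ((exp (- (T ^ 3 / 3)))%R * Cexp (T * (X * d))) * Cexp E * (tau0 * d))%C
            with ((gs * tau0)%R * (ph * d * ((exp (- (T ^ 3 / 3)))%R * Cexp (T * (X * d))) * Cexp E))%C
            by (rewrite RtoC_mult; ring).
           rewrite (im_scal_l (gs * tau0)).
           rewrite <- (im_scal_l (exp (- (T ^ 3 / 3)))).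
           replace (ph * d * ((exp (- (T ^ 3 / 3)))%R * Cexp (T * (X * d))) * (Cexp E - 1))%C
             with (ph * d * ((exp (- (T ^ 3 / 3)))%R * Cexp (T * (X * d))) * Cexp E
               - (exp (- (T ^ 3 / 3)))%R * (ph * d * Cexp (T * (X * d))))%C by ring.
           rewrite Im_minus.
           replace (k3 / gs * (/ R1 * (gs * tau0 * Im (ph * d * ((exp (- (T ^ 3 / 3)))%R * Cexp (T * (X * d))) * Cexp E)%C)))
             with (Im (ph * d * ((exp (- (T ^ 3 / 3)))%R * Cexp (T * (X * d))) * Cexp E)%C)
             by (unfold R1; field; lra).
           ring. }
      eapply Rle_trans; [apply Im_le_Cmod |].
      rewrite !Cmod_mult, Hd1, (Cmod_phase nu z U beta : Cmod ph = 1), Cmod_R, Rabs_pos_eq by (left; apply exp_pos).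
      assert (S1 := Cexp_sub_1 E).
      assert (T4 := exp_taylor_term T 4 ltac:(lra)). assert (T2 := exp_taylor_term T 2 ltac:(lra)).
      simpl fact in T4, T2. replace (INR 24) with 24 in T4 by (simpl; ring). replace (INR 2) with 2 in T2 by (simpl; ring).
      assert (P42 : T ^ 4 + T ^ 2 <= 26 * exp T) by lra.
      assert (HEt := HE T (XM + A + 1) ltac:(lra) (Rle_refl _)).
      replace (- (/ 6 * T ^ 3) + (XM + A + 1) * T) with
        (- (T ^ 3 / 3) + (XM * T + (T + (T ^ 3 / 6 + A * T)))) in HEt by field.
      rewrite !exp_plus in HEt.
      rewrite !Rmult_1_l. 
      assert (XX := MX T ltac:(lra)).
      assert (In : 0 < / nu) by now apply Rinv_0_lt_compat.
      assert (Dn : 0 < D / nu) by now apply Rdiv_lt_0_compat.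
      apply Rle_trans with (exp (- (T ^ 3 / 3)) * exp (XM * T) *
        (2 * (D / 2 / nu * (26 * exp T)) * (exp (T ^ 3 / 6) * exp (A * T)))).
      * apply Rmult_le_compat.
        -- apply Rmult_le_pos; [left; apply exp_pos | apply Cmod_ge_0].
        -- apply Cmod_ge_0.
        -- apply Rmult_le_compat_l; [left; apply exp_pos | exact XX].
        -- eapply Rle_trans; [exact S1 |]. rewrite <- exp_plus.
           apply Rmult_le_compat.
           ++ apply Rmult_le_pos; [lra | apply Cmod_ge_0].
           ++ left; apply exp_pos.
           ++ apply Rmult_le_compat_l; [lra |]. eapply Rle_trans; [exact B1 |].
              apply Rmult_le_compat_l; [| exact P42].
              replace (D / 2 / nu) with (D / nu / 2) by (field; lra). lra.
           ++ apply exp_le. exact B2.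
      * apply Rle_trans with (26 * (D / nu) * (K0 * exp (- T))); [| right; field; lra].
        eapply Rle_trans; [| apply Rmult_le_compat_l; [lra | exact HEt]].
        right. field. lra.
    + rewrite Ropp_0, exp_0.
      assert (0 <= 26 * D * K0 / nu) by (apply Rmult_le_pos; [lra | left; now apply Rinv_0_lt_compat]).
      apply Rle_trans with (26 * D * K0 / nu); [generalize (exp_pos (- R1)); nra |].
      unfold Rdiv. apply Rmult_le_compat_r; [left; now apply Rinv_0_lt_compat | unfold K; lra].
  - destruct (Main R1 ltac:(lra)) as [E [EG [_ B2]]].
    replace (R1 / k3) with tau0 in EG by (unfold R1; field; lra). rewrite EG.
    rewrite !Cmod_mult, (Cmod_phase nu z U beta : Cmod ph = 1), !Cmod_R, !Rabs_pos_eq by (try (left; apply exp_pos); lra).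
    rewrite Rmult_1_r, Rmult_assoc. apply Rmult_le_compat_l; [lra |].
    assert (HEt := HE R1 (XM + A) ltac:(lra) ltac:(lra)).
    replace (- (/ 6 * R1 ^ 3) + (XM + A) * R1) with (- (R1 ^ 3 / 3) + (XM * R1 + (R1 ^ 3 / 6 + A * R1))) in HEt by field.
    rewrite (exp_plus (- (R1 ^ 3 / 3))), (exp_plus (XM * R1)) in HEt.
    apply Rle_trans with (K0 * exp (- R1)).
    + eapply Rle_trans; [| exact HEt]. rewrite <- Rmult_assoc.
      apply Rmult_le_compat.
      * apply Rmult_le_pos; [left; apply exp_pos | apply Cmod_ge_0].
      * apply Cmod_ge_0.
      * apply Rmult_le_compat_l; [left; apply exp_pos | apply MX; lra].
      * rewrite Cmod_Cexp. apply exp_le. generalize (Re_le_Cmod E), (Rle_abs (Re E)); lra.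
    + apply Rmult_le_compat_r; [left; apply exp_pos | unfold K; lra].
Qed.



(** * The contour away from the saddle point *)

(** So large that [beta] does not disturb the monotonicity of the modulus away from the saddle point
    and that the exponents [x] and [N - x] exceed [1]. *)
Definition big (nu : R) : Prop := 1 <= nu /\
  2 * B + 2 <= p * u0 ^ 2 * tau0 ^ 2 * nu ^ 2 /\ 2 * B + 2 <= u0 * tau0 * p * m0 / 2 * nu ^ 2 /\
  2 * B + 2 <= p * m0 ^ 2 * nu ^ 2 /\ 2 * B + 2 <= p ^ 2 * nu ^ 2.

Section Fixed.
Variables (nu z U beta : R).
Hypotheses (Hbig : big nu) (HS : is_saddle z U) (Hbe : Rabs beta <= B).

Lemma fixed_facts : 0 < U <= 1 /\ m0 <= q - U /\ 0 < z <= 1 /\ p <= z /\ u0 <= U /\ 1 <= nu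
  /\ 0 < tau0 <= 1 / 12 /\ - B <= beta <= B /\ z * U ^ 2 = p * q * (1 - z).
Proof.
  destruct (saddle_bounds z U HS) as [H1 [H2 H3]].
  destruct HS as [S1 [S2 S3]]. assert (T := tau0_pos).
  assert (Hb := proj1 (Rabs_le_between beta B) Hbe).
  repeat split; try lra. apply Hbig.
Qed.

Lemma powers_gt_1 : 1 < power_q nu z U beta /\ 1 < power_p nu z U beta.
Proof.
  destruct fixed_facts as [_ [_ [_ [_ [_ [Hnu [_ [Hb _]]]]]]]].
  destruct Hbig as [_ [_ [_ [B3 B4]]]].
  assert (Y := Ymin_bounds z U HS).
  assert (N2 : 0 <= nu ^ 2) by (apply pow_le; lra).
  unfold power_q, power_p. set (y := Ymin z U) in *. 
  replace (nu ^ 3 * y - beta * nu) with (nu * (y * nu ^ 2 - beta)) by ring.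
  replace (nu ^ 3 * (1 - y) + beta * nu) with (nu * ((1 - y) * nu ^ 2 + beta)) by ring.
  assert (p * m0 ^ 2 * nu ^ 2 <= y * nu ^ 2) by (apply Rmult_le_compat_r; lra).
  assert (p ^ 2 * nu ^ 2 <= (1 - y) * nu ^ 2) by (apply Rmult_le_compat_r; lra).
  split; nra.
Qed.

(** As both exponents exceed [1], the branch points [q] and [- p] on the boundary of the strip do no
    harm. *)
Lemma holo_integrand (m : R) : holo (strip m) (integrand nu z U beta) (dkfun q p (power_q nu z U beta) (power_p nu z U beta) (power_0 nu z)).
Proof.
  destruct powers_gt_1 as [Ga Gb].
  assert (K : forall w, strip m w -> pow_diff (power_q nu z U beta) (Cexp w - q)%C /\ pow_diff (power_p nu z U beta) (Cexp w + p)%C).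
  { intros w [_ Hw]. assert (HI := Im_Cexp_ge_0 w Hw).
    assert (D : forall a v, 1 < a -> 0 <= Im v -> pow_diff a v).
    { intros a v Ha Hv. destruct (Req_dec (Cmod v) 0) as [E|E].
      - right. split; [now apply Cmod_eq_0 | exact Ha].
      - left. unfold offslit. generalize (Cmod_ge_0 v); lra. }
    split; apply D; try assumption; rewrite ?Im_minus, ?Im_plus, Im_R; lra. }
  destruct (holo_kfun q p (power_q nu z U beta) (power_p nu z U beta) (power_0 nu z)) as [H1 H2].
  split.
  - intros f t l Hf. apply H1. now apply K.
  - intros T f x Hf Hx. apply H2; [exact Hf | now apply K].
Qed.

Lemma Cmod_integrand_axis (s : R) : exp s < q -> Cmod (integrand nu z U beta s) =
  exp (power_q nu z U beta * ln (q - exp s) + power_p nu z U beta * ln (exp s + p) + power_0 nu z * s).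
Proof.
  intro H. assert (E := exp_pos s). unfold integrand, kfun. rewrite Cexp_real, <- RtoC_minus, <- RtoC_plus.
  rewrite !Cmod_mult, Cmod_Cexp, !Cmod_upow by (apply Cmod_R_pos; lra).
  rewrite !Cmod_R, (Rabs_pos_eq (exp s + p)) by lra.
  rewrite Rabs_minus_sym, Rabs_pos_eq by lra.
  unfold Rpower. rewrite <- !exp_plus. f_equal. reim. ring.
Qed.

Lemma integrand_0 (w : C) : (Cexp w - q = 0)%C \/ (Cexp w + p = 0)%C -> integrand nu z U beta w = 0.
Proof.
  intros [E|E]; unfold integrand, kfun; rewrite E, upow_0; ring.
Qed.

(** For [exp r < q] the modulus decreases by [dlog_num]; beyond [q] the integrand is real. *)
Lemma tail_axis (r : R) : ln U + tau0 <= r ->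
  Rabs (Im (integrand nu z U beta r)) <= Cmod (integrand nu z U beta (ln U + tau0)%R).
Proof.
  intro Hr. destruct fixed_facts as [F1 [F2 [F3 [F4 [F5 [F6 [F7 [F8 F9]]]]]]]].
  destruct (total_order_T (exp r) q) as [[L|E]|G].
  - eapply Rle_trans; [apply Im_le_Cmod |].
    rewrite !Cmod_integrand_axis by (first [assumption | eapply Rle_lt_trans; [apply exp_le; exact Hr | exact L]]).
    apply exp_le. apply Ropp_le_cancel.
    apply (mvt_le (fun s => - (power_q nu z U beta * ln (q - exp s) + power_p nu z U beta * ln (exp s + p) + power_0 nu z * s))
      (fun s => (nu ^ 3 * z * (exp s - U) ^ 2 - beta * nu * exp s) / ((q - exp s) * (exp s + p)))); [exact Hr | |].
    + intros s Hs. assert (Es := exp_pos s).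
      assert (Lq : exp s < q) by (eapply Rle_lt_trans; [apply exp_le; apply Hs | exact L]).
      auto_derive; [repeat split; lra |]. req.
      rewrite <- (dlog_num nu z U beta (exp s) F9). field. lra.
    + intros s Hs. assert (Es := exp_pos s).
      assert (Lq : exp s < q) by (eapply Rle_lt_trans; [apply exp_le; apply Hs | exact L]).
      apply Rmult_le_pos; [| left; apply Rinv_0_lt_compat, Rmult_lt_0_compat; lra].
      assert (Eu : U + U * tau0 <= exp s).
      { apply Rle_trans with (exp (ln U + tau0)); [| apply exp_le; apply Hs].
        rewrite exp_plus, exp_ln by lra. generalize (exp_ineq1_le tau0); nra. }
      assert (S2 : (u0 * tau0) ^ 2 <= (exp s - U) ^ 2) by (apply pow_incr; split; [nra | nra]).
      destruct Hbig as [_ [B1 _]].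
      assert (N2 : 0 <= nu ^ 2) by (apply pow_le; lra).
      assert (p * (u0 * tau0) ^ 2 <= z * (exp s - U) ^ 2).
      { apply Rmult_le_compat; try lra. apply pow_le. nra. }
      replace (nu ^ 3 * z * (exp s - U) ^ 2 - beta * nu * exp s) with
        (nu * ((z * (exp s - U) ^ 2) * nu ^ 2 - beta * exp s)) by ring.
      apply Rmult_le_pos; [lra |].
      assert (p * (u0 * tau0) ^ 2 * nu ^ 2 <= z * (exp s - U) ^ 2 * nu ^ 2) by (apply Rmult_le_compat_r; lra).
      replace (p * u0 ^ 2 * tau0 ^ 2 * nu ^ 2) with (p * (u0 * tau0) ^ 2 * nu ^ 2) in B1 by ring.
      assert (beta * exp s <= B) by nra. lra.
  - rewrite integrand_0; [rewrite Im_R, Rabs_R0; apply Cmod_ge_0 |].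
    left. rewrite Cexp_real, E. ring.
  - unfold integrand at 1. rewrite kfun_real by (generalize (exp_pos r); lra). rewrite Rabs_R0. apply Cmod_ge_0.
Qed.

(** The logarithm of the modulus of the integrand on [|u| = rho], as a function of the cosine of the
    argument. *)
Definition circ_exp (rho c : R) : R :=
  power_q nu z U beta / 2 * ln (rho ^ 2 + q ^ 2 - 2 * rho * q * c)
  + power_p nu z U beta / 2 * ln (rho ^ 2 + p ^ 2 + 2 * rho * p * c) + power_0 nu z * ln rho.

Lemma Cmod_sq_ln (v : C) (a : R) : 0 < Cmod v -> Rpower (Cmod v) a = exp (a / 2 * ln (Cmod v ^ 2)).
Proof. intro H. unfold Rpower. rewrite ln_pow by exact H. f_equal. simpl. field. Qed.

Lemma Cmod_integrand_polar (s th : R) : let rho := exp s in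
  rho < q -> 0 < rho ^ 2 + p ^ 2 + 2 * rho * p * cos th ->
  Cmod (integrand nu z U beta (s, th)) = exp (circ_exp rho (cos th)).
Proof.
  intros rho Hr Hc. assert (Hrho : 0 < rho) by apply exp_pos.
  assert (SC : sin th ^ 2 = 1 - cos th ^ 2).
  { generalize (sin2_cos2 th). unfold Rsqr. intro X. lra. }
  assert (E1 : Cmod (Cexp (s, th) - q) ^ 2 = rho ^ 2 + q ^ 2 - 2 * rho * q * cos th).
  { rewrite Cmod_sqr, Re_minus, Im_minus, Re_Cexp, Im_Cexp. reim. fold rho.
    transitivity (rho ^ 2 * cos th ^ 2 - 2 * rho * q * cos th + q ^ 2 + rho ^ 2 * sin th ^ 2); [ring | rewrite SC; ring]. }
  assert (E2 : Cmod (Cexp (s, th) + p) ^ 2 = rho ^ 2 + p ^ 2 + 2 * rho * p * cos th).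
  { rewrite Cmod_sqr, Re_plus, Im_plus, Re_Cexp, Im_Cexp. reim. fold rho.
    transitivity (rho ^ 2 * cos th ^ 2 + 2 * rho * p * cos th + p ^ 2 + rho ^ 2 * sin th ^ 2); [ring | rewrite SC; ring]. }
  assert (Q1 : 0 < rho ^ 2 + q ^ 2 - 2 * rho * q * cos th).
  { generalize (COS_bound th). intro X. assert (0 < (q - rho) ^ 2) by (apply pow_lt; lra).
    assert (2 * rho * q * cos th <= 2 * rho * q * 1) by (apply Rmult_le_compat_l; nra). nra. }
  assert (Pos : forall v, 0 < Cmod v ^ 2 -> 0 < Cmod v).
  { intros v Hv. destruct (Req_dec (Cmod v) 0) as [E|E]; [rewrite E in Hv; simpl in Hv; lra | generalize (Cmod_ge_0 v); lra]. }
  unfold integrand, kfun.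
  assert (V1 : 0 < Cmod (Cexp (s, th) - q)) by (apply Pos; rewrite E1; exact Q1).
  assert (V2 : 0 < Cmod (Cexp (s, th) + p)) by (apply Pos; rewrite E2; exact Hc).
  rewrite !Cmod_mult, !Cmod_upow, !Cmod_sq_ln, E1, E2, Cmod_Cexp by assumption.
  rewrite <- !exp_plus. unfold circ_exp. f_equal. reim. replace (ln rho) with s by (unfold rho; now rewrite ln_exp). ring.
Qed.

(** For [beta = 0] the numerator of the derivative in [c] is at [c = 1] a positive multiple of
    [(U - rho) (2 p q - (p - Y^-) (U + rho))], positive inside the saddle point. *)
Lemma circ_exp_mono (c1 c2 : R) : let rho := U * exp (- (tau0 / 2)) in
  c1 <= c2 -> c2 <= 1 -> 0 < rho ^ 2 + p ^ 2 + 2 * rho * p * c1 ->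
  circ_exp rho c1 <= circ_exp rho c2.
Proof.
  intros rho H12 H2 Hc. destruct fixed_facts as [F1 [F2 [F3 [F4 [F5 [F6 [F7 [F8 F9]]]]]]]].
  assert (Ee : 1 - tau0 / 4 >= exp (- (tau0 / 2))).
  { rewrite exp_Ropp. assert (X := exp_ineq1_le (tau0 / 2)).
    apply Rle_ge. apply (Rmult_le_reg_r (exp (tau0 / 2))); [apply exp_pos |].
    rewrite Rinv_l by (apply Rgt_not_eq, exp_pos). nra. }
  assert (E0 := exp_pos (- (tau0 / 2))).
  assert (Hrho : 0 < rho) by (apply Rmult_lt_0_compat; lra).
  assert (HrU : u0 * tau0 / 4 <= U - rho) by (unfold rho; nra).
  assert (Y := Ymin_bounds z U HS).
  assert (Ydef : p - Ymin z U = z * (2 * U - q + p)) by (unfold Ymin; ring).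
  set (y := Ymin z U) in *.
  assert (Y0 : 0 <= y) by (assert (0 <= p * m0 ^ 2) by (apply Rmult_le_pos; [lra | apply pow_le; lra]); lra).
  assert (EQ : rho ^ 2 * (p - y) + p * q * (q - y) - 2 * rho * p * q = (U - rho) * (2 * p * q - (p - y) * (U + rho))).
  { assert (p * q * (q - y) = 2 * p * q * U - (p - y) * U ^ 2).
    { rewrite Ydef. replace (q - y) with (q - p + z * (2 * U - q + p)) by (rewrite <- Ydef; ring).
      transitivity (2 * p * q * U - (2 * U - q + p) * (z * U ^ 2)); [rewrite F9 | ring].
      replace q with (1 - p) by lra. ring. }
    rewrite H. ring. }
  assert (HQ : u0 * tau0 * p * m0 / 2 <= rho ^ 2 * (p - y) + p * q * (q - y) - 2 * rho * p * q).
  { rewrite EQ. replace (u0 * tau0 * p * m0 / 2) with (u0 * tau0 / 4 * (2 * p * m0)) by field.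
    apply Rmult_le_compat; [| | exact HrU |].
    - apply Rmult_le_pos; [apply Rmult_le_pos; lra | lra].
    - apply Rmult_le_pos; lra.
    - assert ((p - y) * (U + rho) <= p * (2 * (q - m0))); [| nra].
      destruct (Rle_lt_dec 0 (p - y)) as [L|L]; [apply Rmult_le_compat; nra |].
      apply Rle_trans with 0; [nra |]. apply Rmult_le_pos; lra. }
  destruct Hbig as [_ [_ [B2 _]]].
  assert (N2 : 0 <= nu ^ 2) by (apply pow_le; lra).
  apply (mvt_le (circ_exp rho) (fun c => rho *
    (power_p nu z U beta * p * (rho ^ 2 + q ^ 2 - 2 * rho * q * c) - power_q nu z U beta * q * (rho ^ 2 + p ^ 2 + 2 * rho * p * c))
    / ((rho ^ 2 + q ^ 2 - 2 * rho * q * c) * (rho ^ 2 + p ^ 2 + 2 * rho * p * c)))); [exact H12 | |].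
  - intros c Hc'.
    assert (Q1 : 0 < rho ^ 2 + q ^ 2 - 2 * rho * q * c).
    { assert (0 < (q - rho) ^ 2) by (apply pow_lt; nra).
      assert (2 * rho * q * c <= 2 * rho * q * 1) by (apply Rmult_le_compat_l; nra). nra. }
    assert (Q2 : 0 < rho ^ 2 + p ^ 2 + 2 * rho * p * c).
    { assert (2 * rho * p * c1 <= 2 * rho * p * c) by (apply Rmult_le_compat_l; nra). lra. }
    unfold circ_exp. simpl in Q1, Q2. auto_derive; [repeat split; lra |]. req. field. simpl. lra.
  - intros c Hc'.
    assert (Q1 : 0 < rho ^ 2 + q ^ 2 - 2 * rho * q * c).
    { assert (0 < (q - rho) ^ 2) by (apply pow_lt; nra).
      assert (2 * rho * q * c <= 2 * rho * q * 1) by (apply Rmult_le_compat_l; nra). nra. }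
    assert (Q2 : 0 < rho ^ 2 + p ^ 2 + 2 * rho * p * c).
    { assert (2 * rho * p * c1 <= 2 * rho * p * c) by (apply Rmult_le_compat_l; nra). lra. }
    apply Rmult_le_pos; [| left; apply Rinv_0_lt_compat; now apply Rmult_lt_0_compat].
    apply Rmult_le_pos; [lra |].
    assert (En : power_p nu z U beta * p * (rho ^ 2 + q ^ 2 - 2 * rho * q * c) - power_q nu z U beta * q * (rho ^ 2 + p ^ 2 + 2 * rho * p * c)
      = nu * (nu ^ 2 * (rho ^ 2 * (p - y) + p * q * (q - y) - 2 * rho * p * q + 2 * rho * p * q * (1 - c)) + beta * (rho ^ 2 + p * q))).
    { unfold power_q, power_p. fold y. replace q with (1 - p) by lra. ring. }
    rewrite En. apply Rmult_le_pos; [lra |].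
    assert (0 <= 2 * rho * p * q * (1 - c)) by (repeat apply Rmult_le_pos; lra).
    assert (u0 * tau0 * p * m0 / 2 * nu ^ 2 <= nu ^ 2 * (rho ^ 2 * (p - y) + p * q * (q - y) - 2 * rho * p * q + 2 * rho * p * q * (1 - c))).
    { rewrite Rmult_comm. apply Rmult_le_compat_l; lra. }
    assert (rho <= 1) by nra.
    assert (0 <= rho ^ 2 + p * q <= 2) by (split; nra).
    assert (- (2 * B) <= beta * (rho ^ 2 + p * q)) by nra. lra.
Qed.

Lemma tail_vertical (th : R) : tau0 * (sqrt 3 / 2) <= th <= PI ->
  Cmod (integrand nu z U beta (ln U - tau0 / 2, th)) <= Cmod (integrand nu z U beta (ln U + tau0 * omega)%C).
Proof.
  intro Hth. destruct fixed_facts as [F1 [F2 [F3 [F4 [F5 [F6 [F7 [F8 F9]]]]]]]].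
  replace (ln U + tau0 * omega)%C with (ln U - tau0 / 2, tau0 * (sqrt 3 / 2)) by (unfold omega; apply C_ext; reim; field).
  set (th1 := tau0 * (sqrt 3 / 2)) in *.
  assert (S3 := sqrt3_bounds).
  assert (T1 : 0 <= th1 <= 1 / 12) by (unfold th1; split; nra).
  assert (Er : exp (ln U - tau0 / 2) = U * exp (- (tau0 / 2))) by (unfold Rminus; rewrite exp_plus, exp_ln by lra; reflexivity).
  assert (E1 : exp (- (tau0 / 2)) < 1) by (rewrite <- exp_0; apply exp_increasing; lra).
  assert (E0 := exp_pos (- (tau0 / 2))).
  set (rho := U * exp (- (tau0 / 2))) in *.
  assert (Hrho : 0 < rho < q) by (unfold rho; split; [apply Rmult_lt_0_compat; lra | nra]).
  assert (C12 : cos th <= cos th1) by (apply cos_decr_1; lra).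
  destruct (Req_dec (rho ^ 2 + p ^ 2 + 2 * rho * p * cos th) 0) as [Z|Z].
  - rewrite integrand_0; [rewrite Cmod_0; apply Cmod_ge_0 |]. right.
    assert (cos th = -1 /\ rho = p) as [Zc Zr].
    { generalize (COS_bound th). intro X. assert (0 <= 2 * rho * p * (1 + cos th)) by (apply Rmult_le_pos; nra).
      assert ((rho - p) ^ 2 + 2 * rho * p * (1 + cos th) = 0) by nra.
      assert (0 <= (rho - p) ^ 2) by (apply pow2_ge_0).
      assert (Z1 : (rho - p) ^ 2 = 0) by lra.
      assert (rho = p) by nra. split; [| assumption]. subst. 
      assert (0 < 2 * rho * p) by nra. nra. }
    assert (Zs : sin th = 0).
    { generalize (sin2_cos2 th). unfold Rsqr. rewrite Zc. intro X. nra. }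
    apply C_ext; rewrite ?Re_plus, ?Im_plus, ?Re_Cexp, ?Im_Cexp; reim; rewrite ?Er, ?Zc, ?Zs, ?Zr; ring.
  - assert (Pc : 0 < rho ^ 2 + p ^ 2 + 2 * rho * p * cos th).
    { generalize (COS_bound th). intro X. assert (0 <= 2 * rho * p * (1 + cos th)) by (apply Rmult_le_pos; nra).
      assert (0 <= (rho - p) ^ 2) by (apply pow2_ge_0). nra. }
    assert (Pc1 : 0 < rho ^ 2 + p ^ 2 + 2 * rho * p * cos th1).
    { assert (2 * rho * p * cos th <= 2 * rho * p * cos th1) by (apply Rmult_le_compat_l; nra). lra. }
    rewrite !Cmod_integrand_polar; rewrite ?Er; try assumption; try lra.
    apply exp_le, circ_exp_mono; [exact C12 | apply COS_bound | exact Pc].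
Qed.

Lemma Cmod_integrand_top (s : R) : exp s < p -> Cmod (integrand nu z U beta (s, PI)) =
  exp (power_q nu z U beta * ln (q + exp s) + power_p nu z U beta * ln (p - exp s) + power_0 nu z * s).
Proof.
  intro H. assert (E := exp_pos s). unfold integrand, kfun. rewrite Cexp_top, <- RtoC_minus, <- RtoC_plus.
  rewrite !Cmod_mult, Cmod_Cexp, !Cmod_upow by (apply Cmod_R_pos; lra).
  rewrite !Cmod_R. replace (- exp s - q) with (- (q + exp s)) by ring. rewrite Rabs_Ropp.
  rewrite !Rabs_pos_eq by lra. replace (- exp s + p) with (p - exp s) by ring.
  unfold Rpower. rewrite <- !exp_plus. f_equal. reim. ring.
Qed.

(** For [- p < u < 0] the modulus decreases as [|u|] grows, starting from the end of the vertical part;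
    for [u <= - p] the integrand is real. *)
Lemma tail_top (n : nat) (r : R) : nu ^ 3 * z = INR n -> ln U <= r ->
  Rabs (Im (integrand nu z U beta (path_end tau0 r))) <= Cmod (integrand nu z U beta (ln U + tau0 * omega)%C).
Proof.
  intros Hn Hr. destruct fixed_facts as [F1 [F2 [F3 [F4 [F5 [F6 [F7 [F8 F9]]]]]]]].
  unfold path_end. set (s0 := ln U - tau0 / 2). set (s1 := r - tau0 / 2).
  assert (Hs : s0 <= s1) by (unfold s0, s1; lra).
  destruct (total_order_T (exp s1) p) as [[L|E]|G].
  - eapply Rle_trans; [apply Im_le_Cmod |].
    apply Rle_trans with (Cmod (integrand nu z U beta (s0, PI))).
    2: { apply tail_vertical. assert (S3 := sqrt3_bounds). generalize PI2_3_2. intro. split; nra. }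
    rewrite !Cmod_integrand_top by (first [assumption | eapply Rle_lt_trans; [apply exp_le; exact Hs | exact L]]).
    apply exp_le. apply Ropp_le_cancel.
    apply (mvt_le (fun s => - (power_q nu z U beta * ln (q + exp s) + power_p nu z U beta * ln (p - exp s) + power_0 nu z * s))
      (fun s => (nu ^ 3 * z * (exp s + U) ^ 2 + beta * nu * exp s) / ((q + exp s) * (p - exp s)))); [exact Hs | |].
    + intros s Hs'. assert (Es := exp_pos s).
      assert (Lq : exp s < p) by (eapply Rle_lt_trans; [apply exp_le; apply Hs' | exact L]).
      auto_derive; [repeat split; lra |]. req.
      replace (nu ^ 3 * z * (exp s + U) ^ 2 + beta * nu * exp s) with
        (nu ^ 3 * z * (- exp s - U) ^ 2 - beta * nu * - exp s) by ring.
      rewrite <- (dlog_num nu z U beta (- exp s) F9). field. lra.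
    + intros s Hs'. assert (Es := exp_pos s).
      assert (Lq : exp s < p) by (eapply Rle_lt_trans; [apply exp_le; apply Hs' | exact L]).
      apply Rmult_le_pos; [| left; apply Rinv_0_lt_compat, Rmult_lt_0_compat; lra].
      destruct Hbig as [_ [B1 _]].
      assert (N2 : 0 <= nu ^ 2) by (apply pow_le; lra).
      assert (S2 : u0 ^ 2 <= (exp s + U) ^ 2) by (apply pow_incr; lra).
      assert (U2 : 0 <= u0 ^ 2) by (apply pow_le; lra).
      assert (p * u0 ^ 2 * tau0 ^ 2 <= z * (exp s + U) ^ 2).
      { assert (0 <= tau0 ^ 2 <= 1) by (split; [apply pow_le; lra | rewrite <- (pow1 2); apply pow_incr; lra]).
        assert (p * u0 ^ 2 <= z * (exp s + U) ^ 2) by (apply Rmult_le_compat; lra).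
        assert (0 <= p * u0 ^ 2) by (apply Rmult_le_pos; lra). nra. }
      replace (nu ^ 3 * z * (exp s + U) ^ 2 + beta * nu * exp s) with
        (nu * ((z * (exp s + U) ^ 2) * nu ^ 2 + beta * exp s)) by ring.
      apply Rmult_le_pos; [lra |].
      assert (p * u0 ^ 2 * tau0 ^ 2 * nu ^ 2 <= z * (exp s + U) ^ 2 * nu ^ 2) by (apply Rmult_le_compat_r; lra).
      assert (- B <= beta * exp s) by nra. lra.
  - rewrite integrand_0; [rewrite Im_R, Rabs_R0; apply Cmod_ge_0 |].
    right. rewrite Cexp_top, E, RtoC_opp. ring.
  - unfold integrand at 1. rewrite (kfun_top_real _ _ _ _ _ _ n).
    + rewrite Rabs_R0. apply Cmod_ge_0.
    + unfold power_q, power_p, power_0. rewrite <- Hn. ring.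
    + generalize (exp_pos s1); lra.
    + lra.
Qed.

End Fixed.

(** * The contour through the saddle point *)

Lemma lim_infty_near (F : R -> R) (l r b : R) : lim_infty F l -> 
  (forall s, r <= s -> Rabs (F s - F r) <= b) -> Rabs (F r - l) <= b.
Proof.
  intros HL Hb. apply Rnot_lt_le. intro C.
  destruct (HL (Rabs (F r - l) - b) ltac:(lra)) as [s0 [_ H]].
  specialize (H (Rmax r s0) (Rmax_r _ _)). specialize (Hb (Rmax r s0) (Rmax_l _ _)).
  set (v := F _) in *. assert (T := Rabs_triang (v - l) (- (v - F r))).
  rewrite Rabs_Ropp in T. replace (v - l + - (v - F r)) with (F r - l) in T by ring. lra.
Qed.



Hypothesis Hu1 : u0 <= 1.

Section Contour.
Variables (nu z U beta : R) (n : nat).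
Hypotheses (Hbig : big nu) (HS : is_saddle z U) (Hbe : Rabs beta <= B) (Hn : nu ^ 3 * z = INR n).

Notation G := (integrand nu z U beta).

Lemma G_holo m : holo (strip m) G (dkfun q p (power_q nu z U beta) (power_p nu z U beta) (power_0 nu z)).
Proof. apply (holo_integrand); tauto. Qed.

Lemma cont_G_axis r : continuous (fun s : R => Im (G s)) r.
Proof.
  destruct (G_holo (r - 1)) as [H _].
  assert (D := H (fun s : R => (0 + s * 1)%C) r 1).
  assert (E : forall s : R, (0 + s * 1)%C = RtoC s) by (intro; ring).
  apply (continuous_ext (fun s : R => Im (G (0 + s * 1)%C))); [intro s; now rewrite E |].
  refine (proj2 (cder_ccont _ _ _ (D _ (cder_line 0 1 r)))).
  cbv beta. rewrite E. split; reim; [lra | generalize PI_RGT_0; lra].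
Qed.

Lemma cont_G_top r : continuous (fun s : R => Im (G (path_end tau0 s))) r.
Proof.
  destruct (G_holo (r - tau0 / 2 - 1)) as [H _].
  set (w0 := (- tau0 / 2, PI) : C).
  assert (E : forall s : R, (w0 + s * 1)%C = path_end tau0 s).
  { intro s. unfold w0, path_end. apply C_ext; reim; field. }
  assert (D := H (fun s : R => (w0 + s * 1)%C) r 1).
  apply (continuous_ext (fun s : R => Im (G (w0 + s * 1)%C))); [intro s; now rewrite E |].
  refine (proj2 (cder_ccont _ _ _ (D _ (cder_line w0 1 r)))).
  cbv beta. rewrite E. unfold path_end. split; reim; [lra | generalize PI_RGT_0; lra].
Qed.

Lemma contour_shift : ln U <= 1 -> 0 <= tau0 <= 1 ->
  path tau0 1 G = path tau0 (ln U) G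
    + (RInt (fun r => Im (G (path_end tau0 r))) (ln U) 1 - RInt (fun r : R => Im (G r)) (ln U) 1).
Proof.
  intros HU Ht. set (m := ln U - 1).
  assert (H := G_holo m).
  assert (E : is_RInt (fun r : R => minus (Im (G (path_end tau0 r))) (Im (G r))) (ln U) 1
    (minus (path tau0 1 G) (path tau0 (ln U) G))).
  { apply (is_RInt_derive (fun r => path tau0 r G)).
    - intros r Hr. rewrite Rmin_left, Rmax_right in Hr by lra.
      assert (Hm : m < r - tau0 / 2) by (unfold m; lra).
      assert (D := path_shift m tau0 r _ _ Ht Hm H).
      rewrite (path_FTC m tau0 r Ht Hm _ _ H) in D. exact D.
    - intros r _. apply (@continuous_minus R_UniformSpace R_AbsRing R_NormedModule);
        [apply cont_G_top | apply cont_G_axis]. }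
  assert (E2 : is_RInt (fun r : R => minus (Im (G (path_end tau0 r))) (Im (G r))) (ln U) 1
    (minus (RInt (fun r => Im (G (path_end tau0 r))) (ln U) 1) (RInt (fun r : R => Im (G r)) (ln U) 1))).
  { apply is_RInt_minus_R; apply RInt_correct_R, ex_RInt_cont.
    - apply cont_G_top.
    - apply cont_G_axis. }
  apply is_RInt_unique_R in E. apply is_RInt_unique_R in E2.
  rewrite E in E2. revert E2.
  assert (Alg : forall a b c d : R, minus a b = minus c d -> a = b + (c - d))
    by (intros a b c d; unfold minus, plus, opp; simpl; lra).
  apply Alg.
Qed.

Lemma axis_seg : RInt (fun r : R => Im (G r)) (ln U) (ln U + tau0) = seg G (ln U) (tau0 * 1)%C.
Proof.
  unfold seg.
  assert (E := @RInt_comp_lin R_CompleteNormedModule (fun r : R => Im (G r)) tau0 (ln U) 0 1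
    ltac:(apply ex_RInt_cont, cont_G_axis)).
  replace (tau0 * 0 + ln U) with (ln U) in E by ring.
  replace (tau0 * 1 + ln U) with (ln U + tau0) in E by ring.
  rewrite <- E. apply RInt_ext. intros t _.
  replace (ln U + t * (tau0 * 1))%C with (RtoC (tau0 * t + ln U)) by (rewrite RtoC_plus, RtoC_mult; ring).
  replace (G (tau0 * t + ln U)%R * (tau0 * 1))%C with (tau0 * G (tau0 * t + ln U)%R)%C by ring.
  rewrite im_scal_l. reflexivity.
Qed.

Lemma contour_tails (M : R) : Cmod (G (ln U + tau0 * omega)%C) <= M -> Cmod (G (ln U + tau0 * 1)%C) <= M ->
  Rabs (path tau0 1 G - (seg G (ln U) (tau0 * omega)%C - seg G (ln U) (tau0 * 1)%C)) <= (4 + 2 * (1 - ln u0)) * M.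
Proof.
  intros M1 M2.
  destruct (fixed_facts nu z U beta Hbig HS Hbe)
    as [F1 [F2 [F3 [F4 [F5 [F6 [F7 [F8 F9]]]]]]]].
  assert (LU : ln u0 <= ln U <= 0).
  { split; [apply ln_le; lra |]. rewrite <- ln_1. apply ln_le; lra. }
  assert (Lu0 : ln u0 <= 0) by lra.
  assert (M0 : 0 <= M) by (eapply Rle_trans; [apply Cmod_ge_0 | exact M1]).
  rewrite contour_shift by lra.
  assert (EA : RInt (fun r : R => Im (G r)) (ln U) 1 = seg G (ln U) (tau0 * 1)%C + RInt (fun r : R => Im (G r)) (ln U + tau0) 1).
  { rewrite <- axis_seg. symmetry. apply RInt_Chasles_R; apply ex_RInt_cont, cont_G_axis. }
  rewrite EA. unfold path.
  set (s1 := seg G (ln U) (tau0 * omega)%C). set (s2 := seg G (ln U) (tau0 * 1)%C).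
  assert (T1 : Rabs (seg G (ln U + tau0 * omega)%C (rise tau0)) <= 4 * M).
  { unfold seg. eapply Rle_trans; [apply (abs_RInt_le_const _ 0 1 (4 * M)); [lra | |] | right; ring].
    - apply ex_seg. intros t Ht. destruct (G_holo (ln U - 1)) as [H _].
      eapply cder_ccont. apply (H (fun s : R => (ln U + tau0 * omega + s * rise tau0)%C)); [| apply cder_line].
      apply (strip_seg2 (ln U - 1) tau0 (ln U)); lra.
    - intros t Ht. eapply Rle_trans; [apply Im_le_Cmod |]. rewrite Cmod_mult, Rmult_comm.
      assert (S3 := sqrt3_bounds). assert (P4 := PI_4). assert (P3 := PI2_3_2).
      apply Rmult_le_compat; try apply Cmod_ge_0.
      + unfold rise. eapply Rle_trans; [apply Cmod_le_abs |]. reim. rewrite Rabs_R0, Rabs_pos_eq by nra. nra.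
      + replace (ln U + tau0 * omega + t * rise tau0)%C with (ln U - tau0 / 2, tau0 * (sqrt 3 / 2) + t * (PI - tau0 * (sqrt 3 / 2)))
          by (unfold omega, rise; apply C_ext; reim; field).
        eapply Rle_trans; [apply (tail_vertical); try tauto | exact M1].
        assert (0 <= tau0 * (sqrt 3 / 2) <= 1) by nra. split; nra. }
  assert (T2 : Rabs (RInt (fun r => Im (G (path_end tau0 r))) (ln U) 1) <= (1 - ln U) * M).
  { apply abs_RInt_le_const; [lra | apply ex_RInt_cont, cont_G_top |].
    intros r Hr. eapply Rle_trans; [apply (tail_top) with (n := n); try tauto | exact M1]. }
  assert (T3 : Rabs (RInt (fun r : R => Im (G r)) (ln U + tau0) 1) <= (1 - (ln U + tau0)) * M).
  { apply abs_RInt_le_const; [lra | apply ex_RInt_cont, cont_G_axis |].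
    intros r Hr. eapply Rle_trans; [apply (tail_axis); try tauto |].
    replace (RtoC (ln U + tau0)) with (ln U + tau0 * 1)%C by (rewrite RtoC_plus; ring). exact M2. }
  set (x1 := seg G (ln U + tau0 * omega)%C (rise tau0)) in *.
  set (x2 := RInt (fun r => Im (G (path_end tau0 r))) (ln U) 1) in *. change R in (type of x2).
  set (x3 := RInt (fun r : R => Im (G r)) (ln U + tau0) 1) in *. change R in (type of x3).
  replace (s1 + x1 + (x2 - (s2 + x3)) - (s1 - s2)) with (x1 + (x2 + - x3)) by ring.
  eapply Rle_trans; [apply Rabs_triang |].
  assert (Rabs (x2 + - x3) <= Rabs x2 + Rabs x3) by (eapply Rle_trans; [apply Rabs_triang | rewrite Rabs_Ropp; lra]).
  assert ((1 - ln U) * M <= (1 - ln u0) * M) by (apply Rmult_le_compat_r; lra).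
  assert ((1 - (ln U + tau0)) * M <= (1 - ln u0) * M) by (apply Rmult_le_compat_r; lra).
  lra.
Qed.

End Contour.

(** The asymptotic formula with all quantities divided by the modulus of the integrand at the saddle
    point and the width [1 / (nu kap^(1/3))] of the valleys. *)
Lemma core_estimate : exists K, 0 < K /\ forall nu z U beta n,
  big nu -> is_saddle z U -> Rabs beta <= B -> nu ^ 3 * z = INR n ->
  let ph := saddle_phase nu z U beta in let X := airy_arg z U beta in
  Rabs (nu * kap_root z U / saddle_mod nu z U beta * path tau0 1 (integrand nu z U beta)
    - PI * (Re ph * Ai X - Im ph * Bi X)) <= K / nu.
Proof.
  destruct (ray_estimate) as [K1 [HK1 HR]].
  assert (KP := kap_low_pos). assert (TP := tau0_pos).
  set (kl := kap_low) in *.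
  set (XM := B / (m0 * p * kl)).
  destruct (J_tail XM) as [K2 [HK2 HJ]].
  assert (Lu0 : ln u0 <= 0) by (rewrite <- ln_1; apply ln_le; lra).
  set (L := 4 + 2 * (1 - ln u0)). assert (HL : 0 < L) by (unfold L; lra).
  assert (Ht2 : 0 < tau0 ^ 2) by (apply pow_lt; lra).
  set (K := 2 * K1 + L * K1 * (2 / (tau0 ^ 2 * kl)) + 2 * K2 / (tau0 * kl)).
  assert (Htk : 0 < tau0 * kl) by (apply Rmult_lt_0_compat; lra).
  assert (Htk2 : 0 < tau0 ^ 2 * kl) by (apply Rmult_lt_0_compat; lra).
  assert (HK : 0 < K).
  { unfold K. assert (0 < L * K1 * (2 / (tau0 ^ 2 * kl))).
    { apply Rmult_lt_0_compat; [now apply Rmult_lt_0_compat | apply Rdiv_lt_0_compat; lra]. }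
    assert (0 < 2 * K2 / (tau0 * kl)) by (apply Rdiv_lt_0_compat; lra). lra. }
  exists K. split; [exact HK |].
  intros nu z U beta n Hbig HS Hbe Hn ph X.
  destruct (fixed_facts nu z U beta Hbig HS Hbe)
    as [F1 [F2 [F3 [F4 [F5 [F6 [F7 [F8 F9]]]]]]]].
  destruct (kap_root_spec z U HS) as [E3 KL]. fold kl in KL.
  assert (HX := airy_arg_bound z U beta HS Hbe). fold kl XM X in HX.
  destruct (HR nu z U beta omega ltac:(lra) HS Hbe valley_omega) as [R1 G1].
  destruct (HR nu z U beta 1 ltac:(lra) HS Hbe valley_1) as [R2 G2].
  set (k := kap_root z U) in *. set (k3 := nu * k) in *. set (gs := saddle_mod nu z U beta) in *.
  assert (Hgs : 0 < gs) by apply exp_pos.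
  assert (Hk3 : 0 < k3) by (apply Rmult_lt_0_compat; lra).
  assert (Hk3n : nu * kl <= k3) by (apply Rmult_le_compat_l; lra).
  set (RR := tau0 * k3) in *. assert (HRR : 0 < RR) by (apply Rmult_lt_0_compat; lra).
  assert (T := contour_tails nu z U beta n Hbig HS Hbe Hn _ G1 G2). fold L in T.
  set (P := path tau0 1 (integrand nu z U beta)) in *.
  set (s1 := seg (integrand nu z U beta) (ln U) (tau0 * omega)%C) in *.
  set (s2 := seg (integrand nu z U beta) (ln U) (tau0 * 1)%C) in *.
  fold ph X in R1, R2.
  replace (ph * 1)%C with ph in R2 by ring. replace (X * 1)%C with (RtoC X) in R2 by ring.
  assert (In : 0 < / nu) by (apply Rinv_0_lt_compat; lra).
  assert (E1 : exp (- RR) <= / RR).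
  { rewrite exp_Ropp. apply Rinv_le_contravar; [exact HRR |]. generalize (exp_ineq1_le RR); lra. }
  assert (E2 : exp (- RR) <= 2 / RR ^ 2).
  { rewrite exp_Ropp. replace (2 / RR ^ 2) with (/ (RR ^ 2 / 2)) by (field; lra).
    apply Rinv_le_contravar; [generalize (pow_lt RR 2 HRR); lra |].
    assert (Z := exp_taylor_term RR 2 ltac:(lra)). simpl fact in Z. replace (INR 2) with 2 in Z by (simpl; ring). exact Z. }
  assert (Mph : Cmod ph = 1) by apply Cmod_phase.
  (* the model integrals over the finite range differ little from those over the half line *)
  set (F := fun r => J (ph * omega)%C (X * omega)%C r - J ph X r).
  assert (LF : Rabs (F RR - PI * (Re ph * Ai X - Im ph * Bi X)) <= 2 * K2 * exp (- RR)).
  { apply lim_infty_near; [apply J_airy |]. intros s Hs.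
    assert (J1 := HJ (ph * omega)%C (X * omega)%C RR s).
    assert (J2 := HJ ph X RR s).
    assert (W : Cmod omega = 1) by apply valley_omega.
    rewrite !Cmod_mult, Mph, W, !Rmult_1_r, Cmod_R in J1. rewrite Mph, Cmod_R in J2.
    specialize (J1 HX ltac:(lra)). specialize (J2 HX ltac:(lra)). rewrite Rmult_1_l in J1, J2.
    unfold F. set (a1 := J (ph * omega)%C (X * omega)%C s) in *. set (a2 := J (ph * omega)%C (X * omega)%C RR) in *.
    set (b1 := J ph X s) in *. set (b2 := J ph X RR) in *.
    replace (a1 - b1 - (a2 - b2)) with ((a1 - a2) + - (b1 - b2)) by ring.
    eapply Rle_trans; [apply Rabs_triang |]. rewrite Rabs_Ropp. lra. }
  assert (LT : Rabs (k3 / gs * (P - (s1 - s2))) <= L * K1 * (2 / (tau0 ^ 2 * kl)) / nu).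
  { assert (Hkg : 0 < k3 / gs) by now apply Rdiv_lt_0_compat.
    rewrite Rabs_mult, (Rabs_pos_eq (k3 / gs)) by lra.
    apply Rle_trans with (k3 / gs * (L * (gs * (K1 * (2 / RR ^ 2))))).
    - apply Rmult_le_compat_l; [lra |]. eapply Rle_trans; [exact T |].
      apply Rmult_le_compat_l; [lra |]. apply Rmult_le_compat_l; [lra |]. apply Rmult_le_compat_l; lra.
    - replace (k3 / gs * (L * (gs * (K1 * (2 / RR ^ 2))))) with (L * K1 * (2 / tau0 ^ 2 * / k3)) by (unfold RR; field; lra).
      replace (L * K1 * (2 / (tau0 ^ 2 * kl)) / nu) with (L * K1 * (2 / tau0 ^ 2 * / (nu * kl))) by (field; lra).
      apply Rmult_le_compat_l; [apply Rmult_le_pos; lra |].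
      apply Rmult_le_compat_l; [left; apply Rdiv_lt_0_compat; lra |].
      apply Rinv_le_contravar; [apply Rmult_lt_0_compat; lra | exact Hk3n]. }
  assert (LE : 2 * K2 * exp (- RR) <= 2 * K2 / (tau0 * kl) / nu).
  { apply Rle_trans with (2 * K2 * / RR); [apply Rmult_le_compat_l; lra |].
    replace (2 * K2 / (tau0 * kl) / nu) with (2 * K2 * / (tau0 * (nu * kl))) by (field; lra).
    apply Rmult_le_compat_l; [lra |]. apply Rinv_le_contravar.
    - apply Rmult_lt_0_compat; [lra | apply Rmult_lt_0_compat; lra].
    - apply Rmult_le_compat_l; lra. }
  set (a1 := J (ph * omega)%C (X * omega)%C RR) in *. set (b1 := J ph X RR) in *.
  set (lim := PI * (Re ph * Ai X - Im ph * Bi X)) in *.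
  replace (k3 / gs * P - lim) with
    (k3 / gs * (P - (s1 - s2)) + ((k3 / gs * s1 - a1) + (- (k3 / gs * s2 - b1) + (F RR - lim))))
    by (unfold F; fold a1 b1; field; lra).
  eapply Rle_trans; [apply Rabs_triang |].
  eapply Rle_trans; [apply Rplus_le_compat_l, Rabs_triang |].
  eapply Rle_trans; [apply Rplus_le_compat_l, Rplus_le_compat_l, Rabs_triang |].
  rewrite Rabs_Ropp.
  replace (K / nu) with (L * K1 * (2 / (tau0 ^ 2 * kl)) / nu + (K1 / nu + (K1 / nu + 2 * K2 / (tau0 * kl) / nu)))
    by (unfold K; field; lra).
  lra.
Qed.

End Saddle.

(** * The formula in terms of the stated quantities *)

Section Translation.
Variables (p q : R).
Hypotheses (Hp : 0 < p) (Hq : 0 < q) (Hpq : p + q = 1).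

Lemma U0_saddle (a b z : R) : p < a -> b < 1 -> a <= z <= b ->
  is_saddle p q (q - U0 p q a) (U0 p q b) z (U0 p q z).
Proof.
  intros Ha Hb Hz.
  assert (Pz : forall z, p < z < 1 -> 0 <= p * q * (1 - z) / z).
  { intros x Hx. apply Rmult_le_pos; [apply Rmult_le_pos; [nra | lra] | left; apply Rinv_0_lt_compat; lra]. }
  assert (Mono : forall x y, p < x -> x <= y -> y < 1 -> U0 p q y <= U0 p q x).
  { intros x y Hx Hxy Hy. unfold U0. apply sqrt_le_1; [apply Pz; lra | apply Pz; lra |].
    unfold Rdiv. apply Rmult_le_compat.
    - apply Rmult_le_pos; [nra | lra].
    - left; apply Rinv_0_lt_compat; lra.
    - apply Rmult_le_compat_l; nra.
    - apply Rinv_le_contravar; lra. }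
  split; [lra |]. split.
  - split; [apply Mono; lra |]. generalize (Mono a z). lra.
  - unfold U0. rewrite pow2_sqrt by (apply Pz; lra). field. lra.
Qed.

Lemma U0_pos (z : R) : p < z < 1 -> 0 < U0 p q z < q.
Proof.
  intro Hz. assert (X : 0 < p * q * (1 - z) / z).
  { apply Rmult_lt_0_compat; [apply Rmult_lt_0_compat; [nra | lra] | apply Rinv_0_lt_compat; lra]. }
  unfold U0. split; [now apply sqrt_lt_R0 |].
  rewrite <- (sqrt_pow2 q) at 2 by lra. apply sqrt_lt_1; [lra | apply pow_le; lra |].
  apply (Rmult_lt_reg_r z); [lra |]. replace (p * q * (1 - z) / z * z) with (p * q * (1 - z)) by (field; lra). 
  nra.
Qed.

Section Point.
Variables (nu z U beta : R).
Hypotheses (Hnu : 0 < nu) (Hz : p < z < 1) (EU : U = U0 p q z).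

Lemma U_pos : 0 < U < q.
Proof. rewrite EU. now apply U0_pos. Qed.

Lemma eps_powers : Rpower (/ nu ^ 3) (1 / 3) = / nu /\ Rpower (/ nu ^ 3) (2 / 3) = / nu ^ 2
  /\ Rpower (/ nu ^ 3) (- (1 / 3)) = nu.
Proof.
  assert (E : forall k, Rpower (/ nu ^ 3) k = exp (- (3 * k) * ln nu)).
  { intro k. unfold Rpower. rewrite ln_Rinv by (now apply pow_lt). rewrite ln_pow by exact Hnu.
    f_equal. simpl. ring. }
  rewrite !E. split; [| split].
  - replace (- (3 * (1 / 3)) * ln nu) with (- ln nu) by field. now rewrite exp_Ropp, exp_ln.
  - replace (- (3 * (2 / 3)) * ln nu) with (- (INR 2 * ln nu)) by (simpl; field).
    rewrite <- ln_pow by exact Hnu. rewrite exp_Ropp, exp_ln by (now apply pow_lt). reflexivity.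
  - replace (- (3 * - (1 / 3)) * ln nu) with (ln nu) by field. now rewrite exp_ln.
Qed.

Lemma ln_kap_root : ln (kap_root p q z U) = / 3 * (ln z + 2 * ln U - ln (q - U) - ln (U + p)).
Proof.
  destruct U_pos as [U1 U2].
  unfold kap_root, Rpower. rewrite ln_exp. unfold kap, mu.
  assert (0 < (q - U) * (U + p)) by (apply Rmult_lt_0_compat; lra).
  assert (0 < U ^ 2) by now apply pow_lt.
  rewrite !ln_mult; try lra; try (apply Rmult_lt_0_compat; lra); try (apply Rinv_0_lt_compat; lra).
  rewrite ln_Rinv, ln_mult, ln_pow by lra. simpl. ring.
Qed.

Lemma ln_vartheta : ln (vartheta p q z) = / 2 * (ln U - ln z) - ln (q - U) - ln (U + p).
Proof.
  destruct U_pos as [U1 U2]. unfold vartheta. rewrite <- EU.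
  assert (0 < (U + p) * (q - U)) by (apply Rmult_lt_0_compat; lra).
  assert (0 < U / z) by (apply Rdiv_lt_0_compat; lra).
  rewrite ln_div; [| now apply sqrt_lt_R0 | lra]. rewrite ln_mult by lra.
  assert (E : ln (U / z) = 2 * ln (sqrt (U / z))).
  { rewrite <- (sqrt_sqrt (U / z)) at 1 by lra. rewrite ln_mult by (now apply sqrt_lt_R0). ring. }
  rewrite ln_div in E by lra. lra.
Qed.

Lemma vartheta_airy_arg : Rpower (vartheta p q z) (2 / 3) * beta = airy_arg p q z U beta.
Proof.
  destruct U_pos as [U1 U2].
  assert (K : 0 < kap_root p q z U) by apply exp_pos.
  assert (HM : 0 < (q - U) * (U + p)) by (apply Rmult_lt_0_compat; lra).
  assert (M : 0 < mu p q U) by now apply Rinv_0_lt_compat.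
  unfold airy_arg. replace (beta * (U * mu p q U) / kap_root p q z U) with (U * mu p q U / kap_root p q z U * beta) by (field; lra).
  f_equal. rewrite <- (exp_ln (U * mu p q U / kap_root p q z U)).
  - unfold Rpower. f_equal. rewrite ln_vartheta, ln_div, ln_kap_root, ln_mult by (try assumption; apply Rmult_lt_0_compat; assumption).
    unfold mu. rewrite ln_Rinv, ln_mult by lra. field.
  - apply Rdiv_lt_0_compat; [apply Rmult_lt_0_compat; lra | exact K].
Qed.

Lemma vartheta_kap_root : Rpower (vartheta p q z) (- (1 / 3)) / sqrt (z * U) = / kap_root p q z U.
Proof.
  destruct U_pos as [U1 U2].
  assert (K : 0 < kap_root p q z U) by apply exp_pos.
  assert (ZU : 0 < z * U) by (apply Rmult_lt_0_compat; lra).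
  assert (S := sqrt_lt_R0 _ ZU).
  assert (E : ln z + ln U = 2 * ln (sqrt (z * U))).
  { rewrite <- ln_mult by lra. rewrite <- (sqrt_sqrt (z * U)) at 1 by lra. rewrite ln_mult by exact S. ring. }
  rewrite <- (exp_ln (/ kap_root p q z U)) by (now apply Rinv_0_lt_compat).
  rewrite <- (exp_ln (sqrt (z * U))) by exact S.
  unfold Rpower, Rdiv. rewrite <- exp_Ropp, <- exp_plus. f_equal.
  rewrite ln_Rinv, ln_kap_root, ln_vartheta by exact K. lra.
Qed.

Notation la := (power_q p q nu z U beta).
Notation lb := (power_p p q nu z U beta).
Notation gs := (saddle_mod p q nu z U beta).

(** The exponential prefactor has the modulus of the integrand at the saddle point; its phase is
    the one of [(-1) ^ n exp (- i pi x)]. *)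
Lemma prefactor_eq : prefactor p q (/ nu ^ 3) z beta =
  ((gs / (2 * (nu * kap_root p q z U)))%R * Cexp (0, PI * (nu ^ 3 * z - la))%R)%C.
Proof.
  destruct U_pos as [U1 U2]. destruct eps_powers as [E1 [E2 E3]].
  assert (K : 0 < kap_root p q z U) by apply exp_pos.
  assert (N3 : 0 < nu ^ 3) by now apply pow_lt.
  unfold prefactor. rewrite E1, E3.
  assert (EX : (/ (/ nu ^ 3)%R * psi0 p q z + ln_U0_ratio p q z * beta * nu)%C =
    ((la * ln (q - U) + lb * ln (U + p) + power_0 nu z * ln U)%R + (0, PI * (nu ^ 3 * z - la))%R)%C).
  { rewrite <- RtoC_inv by (apply Rinv_neq_0_compat; lra). rewrite Rinv_inv.
    unfold psi0, ln_U0_ratio, ln_U0_sub_q. rewrite <- EU. rewrite ln_div by lra.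
    change (Yminus p q z) with (p + (q - p) * z - 2 * z * U0 p q z). rewrite <- EU.
    unfold power_q, power_p, power_0, Ymin. apply C_ext; reim; ring. }
  rewrite EX, Cexp_plus, Cexp_real. fold gs.
  rewrite <- EU.
  assert (S : sqrt (z * U) <> 0).
  { apply Rgt_not_eq, sqrt_lt_R0, Rmult_lt_0_compat; lra. }
  rewrite <- (RtoC_div _ (sqrt (z * U))) by exact S. rewrite vartheta_kap_root.
  rewrite <- (RtoC_div 1 2) by lra.
  replace (gs / (2 * (nu * kap_root p q z U))) with (/ nu * gs * (1 / 2) * / kap_root p q z U) by (field; lra).
  rewrite !RtoC_mult. unfold saddle_mod. ring.
Qed.

(** With [e = exp (i pi x)] one has [e^2 + 1 = 2 e cos (pi x)] and [i (e^2 - 1) = - 2 e sin (pi x)]. *)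
Lemma bracket_eq : airy_bracket p q (/ nu ^ 3) z beta =
  (2 * Cexp (0, PI * la)%R * (cos (PI * la) * Ai (airy_arg p q z U beta) - sin (PI * la) * Bi (airy_arg p q z U beta))%R)%C.
Proof.
  destruct eps_powers as [E1 [E2 E3]]. assert (N3 : 0 < nu ^ 3) by now apply pow_lt.
  unfold airy_bracket, lambda_plus, lambda_minus. rewrite vartheta_airy_arg.
  assert (EL : lambda_phase p q (/ nu ^ 3) z beta = (Cexp (0, PI * la)%R * Cexp (0, PI * la)%R)%C).
  { unfold lambda_phase. rewrite <- Cexp_plus. f_equal. rewrite E2.
    change (Yminus p q z) with (p + (q - p) * z - 2 * z * U0 p q z). rewrite <- EU.
    unfold Cdiv. rewrite <- RtoC_inv by (apply Rinv_neq_0_compat; lra). rewrite Rinv_inv.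
    unfold power_q, Ymin. apply C_ext; reim; field; lra. }
  rewrite EL. generalize (Ai (airy_arg p q z U beta)) (Bi (airy_arg p q z U beta)); intros A Bv.
  assert (SC : sin (PI * la) * sin (PI * la) = 1 - cos (PI * la) * cos (PI * la)).
  { generalize (sin2_cos2 (PI * la)). unfold Rsqr. lra. }
  apply C_ext; reim; rewrite ?Re_Cexp, ?Im_Cexp; reim; rewrite exp_0;
    set (c := cos (PI * la)) in *; set (s := sin (PI * la)) in *.
  - apply Rminus_diag_uniq.
    match goal with |- ?l = 0 => replace l with (A * (1 - c * c - s * s)) by ring end. rewrite SC. ring.
  - apply Rminus_diag_uniq.
    match goal with |- ?l = 0 => replace l with (Bv * (s * s + c * c - 1)) by ring end. rewrite SC. ring.
Qed.

End Point.
End Translation.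

Lemma kcoef_Krawtchouk (p q : R) (N n : nat) (x : R) : Krawtchouk p q N n x = kcoef q p x (INR N - x) n.
Proof. reflexivity. Qed.

Theorem mainTheorem9 :
  forall p q : R, 0 < p < 1 -> 0 < q < 1 -> p + q = 1 ->
  forall a b B : R, p < a -> b < 1 ->
  forall delta eta : R, 0 < delta -> 0 < eta ->
  eventually (fun N : nat =>
    forall (n : nat) (z beta : R),
    INR n = z * INR N -> a <= z <= b -> Rabs beta <= B ->
    let eps := / INR N in
    let y := Yminus p q z - beta * Rpower eps (2 / 3) in
    let x := y * INR N in
    let K := Krawtchouk p q N n x in
    let Phi := prefactor p q eps z beta in
    let A := airy_bracket p q eps z beta in
    Cmod (K - Phi * A)%C <= eta * Cmod Phi /\
    (delta <= Cmod A -> Cmod (K / (Phi * A) - 1)%C <= eta)).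
Proof.
  intros p q Hp Hq Hpq a b B Ha Hb delta eta Hdelta Heta.
  destruct (Rlt_le_dec b a) as [Hab|Hab].
  { exists 0%nat. intros N _ n z beta _ Hz. exfalso; lra. }
  destruct (Rlt_le_dec B 0) as [HB|HB].
  { exists 0%nat. intros N _ n z beta _ _ Hbe. exfalso. generalize (Rabs_pos beta); lra. }
  set (u0 := U0 p q b). set (m0 := q - U0 p q a).
  assert (Hu0 : 0 < u0 < q) by (apply U0_pos; lra).
  assert (Hm0 : 0 < m0 < q) by (unfold m0; generalize (U0_pos p q ltac:(lra) ltac:(lra) Hpq a ltac:(lra)); lra).
  destruct (core_estimate p q m0 u0 B ltac:(lra) ltac:(lra) Hpq (proj1 Hm0) ltac:(lra) HB ltac:(lra)) as [C [HC HE]].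
  assert (HT := tau0_pos p m0 u0 B ltac:(lra) (proj1 Hm0) ltac:(lra) HB).
  set (tau := tau0 p m0 u0 B) in *.
  assert (Htau : 0 <= tau <= 1) by lra.
  (* the thresholds for nu = N^(1/3) *)
  set (c1 := p * u0 ^ 2 * tau ^ 2). set (c2 := u0 * tau * p * m0 / 2).
  set (c3 := p * m0 ^ 2). set (c4 := p ^ 2).
  assert (P : forall x, 0 < x -> 0 < x ^ 2) by (intros; now apply pow_lt).
  assert (C1 : 0 < c1) by (unfold c1; repeat apply Rmult_lt_0_compat; try lra; apply P; lra).
  assert (C2 : 0 < c2) by (unfold c2; apply Rdiv_lt_0_compat; [repeat apply Rmult_lt_0_compat; lra | lra]).
  assert (C3 : 0 < c3) by (unfold c3; apply Rmult_lt_0_compat; [lra | apply P; lra]).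
  assert (C4 : 0 < c4) by (apply P; lra).
  set (e0 := eta * Rmin 1 delta). 
  assert (Hmin : 0 < Rmin 1 delta) by (apply Rmin_pos; lra).
  assert (He0 : 0 < e0) by now apply Rmult_lt_0_compat.
  set (b2 := 2 * B + 2).
  assert (Q : forall c, 0 < c -> 0 < b2 / c) by (intros; apply Rdiv_lt_0_compat; unfold b2; lra).
  set (nu0 := 1 + b2 / c1 + b2 / c2 + b2 / c3 + b2 / c4 + 2 * C / e0).
  assert (HCe : 0 < 2 * C / e0) by (apply Rdiv_lt_0_compat; lra).
  assert (Q1 := Q c1 C1). assert (Q2 := Q c2 C2). assert (Q3 := Q c3 C3). assert (Q4 := Q c4 C4).
  assert (Hnu0 : 1 <= nu0) by (unfold nu0; lra).
  destruct (archimed (nu0 ^ 3)) as [Ar _].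
  exists (Z.to_nat (up (nu0 ^ 3))). intros N HN n z beta Hn Hz Hbe eps y x K Phi A.
  assert (N0 : nu0 ^ 3 <= INR N).
  { apply Rle_trans with (IZR (up (nu0 ^ 3))); [lra |].
    rewrite INR_IZR_INZ. apply IZR_le. lia. }
  assert (Hn03 : 1 <= nu0 ^ 3) by (rewrite <- (pow1 3); apply pow_incr; lra).
  set (nu := Rpower (INR N) (/ 3)).
  assert (Hnu : 0 < nu) by apply exp_pos.
  assert (E3 : nu ^ 3 = INR N) by (apply Rpower_third_cube; lra).
  assert (Hnn : nu0 <= nu).
  { apply Rnot_lt_le. intro L. assert (nu ^ 3 < nu0 ^ 3); [| lra].
    replace (nu ^ 3) with (nu * nu * nu) by ring. replace (nu0 ^ 3) with (nu0 * nu0 * nu0) by ring.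
    apply Rmult_gt_0_lt_compat; nra. }
  assert (Hbg : big p m0 u0 B nu).
  { assert (S : forall c, 0 < c -> b2 / c <= nu -> b2 <= c * nu ^ 2).
    { intros c Hc Hl. apply Rle_trans with (c * nu).
      - apply (Rmult_le_compat_l c) in Hl; [| lra]. replace (c * (b2 / c)) with b2 in Hl by (field; lra). exact Hl.
      - apply Rmult_le_compat_l; [lra |]. nra. }
    unfold big. fold tau b2 c1 c2 c3 c4. repeat split; try (apply S; [assumption |]); unfold nu0 in Hnn; lra. }
  set (U := U0 p q z).
  assert (HS : is_saddle p q m0 u0 z U) by (apply U0_saddle; lra).
  assert (Hzz : p < z < 1) by lra.
  assert (Hnz : nu ^ 3 * z = INR n) by (rewrite E3, Hn; ring).
  assert (HM := HE nu z U beta n Hbg HS Hbe Hnz). cbv zeta in HM. fold tau in HM.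
  destruct (eps_powers nu Hnu) as [P1 [P2 P3]].
  assert (Eeps : eps = / nu ^ 3) by (unfold eps; now rewrite E3).
  set (l := power_q p q nu z U beta) in *.
  assert (Ex : x = l).
  { unfold x, y, l. rewrite Eeps, P2, <- E3. unfold power_q, Ymin, Yminus. fold U. field. lra. }
  assert (EK : path tau 1 (integrand p q nu z U beta) = PI * (-1) ^ n * K).
  { unfold K. rewrite kcoef_Krawtchouk, Ex.
    rewrite <- (kcoef_path q p tau 1) by lra. f_equal. unfold integrand. fold l.
    f_equal; [unfold l, power_q, power_p; rewrite <- E3; ring | unfold l, power_q, power_0; rewrite <- Hnz, <- E3; ring]. }
  rewrite EK in HM.
  set (gs := saddle_mod p q nu z U beta) in *. assert (Hgs : 0 < gs) by apply exp_pos.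
  set (k3 := nu * kap_root p q z U) in *.
  assert (Hk3 : 0 < k3) by (apply Rmult_lt_0_compat; [exact Hnu | apply exp_pos]).
  set (X := airy_arg p q z U beta) in *.
  set (v := cos (PI * l) * Ai X - sin (PI * l) * Bi X).
  assert (Ev : Re (saddle_phase p q nu z U beta) * Ai X - Im (saddle_phase p q nu z U beta) * Bi X = v).
  { unfold saddle_phase. fold l. rewrite Re_Cexp, Im_Cexp. reim. rewrite exp_0. unfold v. ring. }
  rewrite Ev in HM.
  assert (EPhi : Phi = ((gs / (2 * k3))%R * Cexp (0, PI * (INR n - l))%R)%C).
  { unfold Phi. rewrite Eeps, (prefactor_eq p q ltac:(lra) ltac:(lra) Hpq nu z U beta Hnu Hzz eq_refl), Hnz. reflexivity. }
  assert (EA : A = (2 * Cexp (0, PI * l)%R * v)%C).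
  { unfold A. rewrite Eeps. apply (bracket_eq p q ltac:(lra) ltac:(lra) Hpq nu z U beta Hnu Hzz eq_refl). }
  assert (Hm : 0 < gs / (2 * k3)) by (apply Rdiv_lt_0_compat; lra).
  assert (MPhi : Cmod Phi = gs / (2 * k3)).
  { rewrite EPhi, Cmod_mult, Cmod_Cexp, Cmod_R, Rabs_pos_eq by lra. reim. rewrite exp_0. ring. }
  assert (Sgn : (-1) ^ n * (-1) ^ n = 1) by (rewrite <- Rpow_mult_distr; replace (-1 * -1) with 1 by ring; apply pow1).
  assert (EPA : (Phi * A)%C = RtoC (gs / k3 * (-1) ^ n * v)).
  { rewrite EPhi, EA.
    transitivity ((gs / (2 * k3))%R * 2 * v * (Cexp (0, PI * (INR n - l))%R * Cexp (0, PI * l)%R))%C; [ring |].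
    rewrite <- Cexp_plus.
    assert (EN : Cexp ((0, PI * (INR n - l))%R + (0, PI * l)%R)%C = RtoC ((-1) ^ n)).
    { replace ((0, PI * (INR n - l))%R + (0, PI * l)%R)%C with (0, INR n * PI)%R by (apply C_ext; reim; ring).
      clear. induction n as [|n IH].
      - simpl INR. rewrite Rmult_0_l. change ((0, 0) : C) with (RtoC 0). apply Cexp_0.
      - rewrite S_INR. replace (0, (INR n + 1) * PI)%R with ((0, INR n * PI)%R + (0, PI))%C by (apply C_ext; reim; ring).
        rewrite Cexp_plus, IH, Cexp_top, exp_0, <- RtoC_mult. f_equal. simpl. ring. }
    rewrite EN, <- !RtoC_mult. f_equal. field. lra. }
  assert (Main : Cmod (K - Phi * A)%C <= e0 * Cmod Phi).
  { rewrite EPA, <- RtoC_minus, Cmod_R, MPhi.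
    assert (HPI := PI2_3_2).
    assert (Ed : k3 / gs * (PI * (-1) ^ n * K) - PI * v = PI * (-1) ^ n * (k3 / gs) * (K - gs / k3 * (-1) ^ n * v)).
    { transitivity (k3 / gs * (PI * (-1) ^ n * K) - PI * v * ((-1) ^ n * (-1) ^ n)); [rewrite Sgn; ring | field; lra]. }
    assert (Hkg : 0 < k3 / gs) by now apply Rdiv_lt_0_compat.
    rewrite Ed, !Rabs_mult, pow_1_abs, (Rabs_pos_eq PI), (Rabs_pos_eq (k3 / gs)) in HM by lra.
    set (w := Rabs (K - gs / k3 * (-1) ^ n * v)) in *.
    assert (Hw : 0 <= w) by apply Rabs_pos.
    assert (H1 : k3 / gs * w <= C / nu).
    { eapply Rle_trans; [| exact HM]. assert (0 <= k3 / gs * w) by (apply Rmult_le_pos; lra). nra. }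
    assert (H2 : C / nu <= e0 / 2).
    { apply (Rmult_le_reg_r nu); [exact Hnu |]. replace (C / nu * nu) with C by (field; lra).
      assert (L : 2 * C / e0 <= nu) by (unfold nu0 in Hnn; lra).
      apply (Rmult_le_compat_l (e0 / 2)) in L; [| lra]. replace (e0 / 2 * (2 * C / e0)) with C in L by (field; lra). exact L. }
    apply (Rmult_le_reg_l (k3 / gs)); [exact Hkg |].
    replace (k3 / gs * (e0 * (gs / (2 * k3)))) with (e0 / 2) by (field; lra). lra. }
  assert (MP0 : 0 < Cmod Phi) by (rewrite MPhi; exact Hm).
  assert (e0 <= eta).
  { unfold e0. rewrite <- (Rmult_1_r eta) at 2. apply Rmult_le_compat_l; [lra | apply Rmin_l]. }
  split; [eapply Rle_trans; [exact Main |]; apply Rmult_le_compat_r; lra |].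
  intro HA.
  assert (MA : (Phi * A <> 0)%C).
  { apply Cmult_neq_0; intro E; [rewrite E, Cmod_0 in MP0 | rewrite E, Cmod_0 in HA]; lra. }
  replace (K / (Phi * A) - 1)%C with ((K - Phi * A) / (Phi * A))%C by (field; split; intro E; apply MA; rewrite E; ring).
  rewrite Cmod_div, Cmod_mult by exact MA.
  assert (Hpa : 0 < Cmod Phi * Cmod A) by (apply Rmult_lt_0_compat; lra).
  apply (Rmult_le_reg_r (Cmod Phi * Cmod A)); [exact Hpa |].
  unfold Rdiv. rewrite Rmult_assoc, Rinv_l, Rmult_1_r by lra.
  eapply Rle_trans; [exact Main |].
  apply Rle_trans with (eta * delta * Cmod Phi).
  - apply Rmult_le_compat_r; [lra |]. apply Rmult_le_compat_l; [lra | apply Rmin_r].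
  - replace (eta * delta * Cmod Phi) with (eta * (Cmod Phi * delta)) by ring.
    apply Rmult_le_compat_l; [lra |]. apply Rmult_le_compat_l; lra.
Qed.
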